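(* Let $\Omega\subset\mathbb{R}^n$ be a non-empty bounded open set. Let $f:\Omega\to\mathbb{R}^n$ be a bi-Sobolev homeomorphism such that $f\in W^{1,p}(\Omega,\mathbb{R}^n)$, $f^{-1}\in W^{1,q}(f(\Omega),\mathbb{R}^n)$, $f|_{\partial\Omega}=\mathrm{id}|_{\partial\Omega}$ and $Jf=0$ almost everywhere in $\Omega$. Then $p+q\le n+1$. Moreover, if $p+q=n+1$, then $p,q\in\mathbb{N}$ and $f,f^{-1}\notin C^\alpha$ for any $\alpha\in(0,1)$ (that is, neither $f$ nor $f^{-1}$ belongs to $C^\alpha$ for any $\alpha\in(0,1)$).
   Context: A bi-Sobolev homeomorphism $f:\Omega\to\mathbb{R}^n$ is a homeomorphism onto its image $f(\Omega)$ such that both $f$ and $f^{-1}$ are Sobolev maps (in $W^{1,1}$). The condition $f|_{\partial\Omega}=\mathrm{id}|_{\partial\Omega}$ means that $f$ extends continuously to $\overline\Omega$ with boundary values equal to the identity. Here $p,q\ge 1$. $Jf=\det Df$ is the Jacobian. $C^\alpha$ denotes the set of bounded Hölder continuous maps of exponent $\alpha$ (on $\Omega$, respectively on $f(\Omega)$). *)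

(* Defs.v *)
From HB Require Import structures.
From mathcomp Require Import all_boot all_order all_algebra.
From mathcomp Require Import all_classical all_reals all_analysis.

Set Implicit Arguments.
Unset Strict Implicit.
Unset Printing Implicit Defensive.
Import Order.TTheory GRing.Theory Num.Theory.
Import numFieldNormedType.Exports.

Local Open Scope classical_set_scope.
Local Open Scope ring_scope.

Definition measure_rV_display : measure_display -> measure_display.
Proof. exact. Qed.

Section measurable_rV.
Context {d} {T : sigmaRingType d}.
Variable n : nat.

Let coors : 'I_n -> 'rV[T]_n -> T := fun i x => x ord0 i.

Let rV_set0 : g_sigma_preimage coors set0.
Proof. exact: sigma_algebra0. Qed.

Let rV_setC A : g_sigma_preimage coors A -> g_sigma_preimage coors (~` A).
Proof. exact: sigma_algebraC. Qed.

Let rV_bigcup (F : _^nat) : (forall i, g_sigma_preimage coors (F i)) ->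
  g_sigma_preimage coors (\bigcup_i (F i)).
Proof. exact: sigma_algebra_bigcup. Qed.

(* The product sigma-algebra, as in the library's instance for [n.-tuple T]. *)
HB.instance Definition _ := @isMeasurable.Build (measure_rV_display d)
  'rV[T]_n (g_sigma_preimage coors) rV_set0 rV_setC rV_bigcup.

End measurable_rV.

Section lebesgue_measure_rV.
Context {R : realType}.
Implicit Type n : nat.

Lemma measurable_rV_coord n (i : 'I_n) :
  measurable_fun [set: 'rV[R]_n] (fun x : 'rV[R]_n => x ord0 i : R).
Proof.
move=> _ Y mY; rewrite setTI; apply: sub_sigma_algebra => /=.
rewrite -bigcup_seq/=; exists i => /=; first by rewrite mem_index_enum.
by exists Y => //; rewrite setTI.
Qed.

Lemma measurable_fun_rV d (T : measurableType d) n (f : T -> 'rV[R]_n) :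
  (forall i, measurable_fun [set: T] (fun x => f x ord0 i : R)) ->
  measurable_fun [set: T] f.
Proof.
move=> mf; apply: measurability => //.
move=> _ [B + <-]; rewrite -bigcup_seq => -[i _ [A mA <-]].
by rewrite setTI; exact: mf.
Qed.

Definition rV_cons n (x : R * 'rV[R]_n) : 'rV[R]_n.+1 :=
  \row_i oapp (fun j => x.2 ord0 j) x.1 (unlift ord0 i).

Definition rV_uncons n (x : 'rV[R]_n.+1) : R * 'rV[R]_n :=
  (x ord0 ord0, \row_j x ord0 (lift ord0 j)).

Lemma rV_cons0 n (x : R * 'rV[R]_n) : rV_cons x ord0 ord0 = x.1.
Proof. by rewrite mxE unlift_none. Qed.

Lemma rV_consS n (x : R * 'rV[R]_n) (j : 'I_n) :
  rV_cons x ord0 (lift ord0 j) = x.2 ord0 j.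
Proof. by rewrite mxE liftK. Qed.

Lemma rV_consK n : cancel (@rV_cons n) (@rV_uncons n).
Proof.
move=> [x v]; rewrite /rV_uncons rV_cons0; congr pair.
by apply/rowP => j; rewrite mxE rV_consS.
Qed.

Lemma measurable_rV_cons n : measurable_fun [set: R * 'rV[R]_n] (@rV_cons n).
Proof.
apply: measurable_fun_rV => i; case: (unliftP ord0 i) => [j|] ->.
- under eq_fun do rewrite rV_consS.
  apply: (@measurableT_comp _ _ _ _ _ _ (fun y : 'rV[R]_n => y ord0 j : R)) => //.
  exact: measurable_rV_coord.
- by under eq_fun do rewrite rV_cons0; exact: measurable_fst.
Qed.

Lemma measurable_rV_uncons n :
  measurable_fun [set: 'rV[R]_n.+1] (@rV_uncons n).
Proof.
apply/measurable_fun_pairP; split; first exact: measurable_rV_coord.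
apply: measurable_fun_rV => j /=.
by under eq_fun do rewrite mxE; exact: measurable_rV_coord.
Qed.

Section lebesgue_rV_step.
Variables (n : nat) (mu : {sigma_finite_measure set 'rV[R]_n -> \bar R}).
Local Open Scope ereal_scope.

Definition lebesgue_rV_step : set 'rV[R]_n.+1 -> \bar R :=
  pushforward (@lebesgue_measure R \x mu) (@rV_cons n).

Let step0 : lebesgue_rV_step set0 = 0.
Proof. by rewrite /lebesgue_rV_step /pushforward preimage_set0 measure0. Qed.

Let step_ge0 A : 0 <= lebesgue_rV_step A.
Proof. by rewrite /lebesgue_rV_step /pushforward; exact: measure_ge0. Qed.

Let step_sigma_additive : semi_sigma_additive lebesgue_rV_step.
Proof.
move=> F mF tF mUF; rewrite /lebesgue_rV_step /pushforward preimage_bigcup.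
apply: measure_semi_sigma_additive.
- by move=> k; rewrite -[X in measurable X]setTI; exact: measurable_rV_cons.
- apply/trivIsetP => /= i j _ _ ij; rewrite -preimage_setI.
  by move/trivIsetP : tF => /(_ _ _ _ _ ij) ->//; rewrite preimage_set0.
- rewrite -preimage_bigcup -[X in measurable X]setTI.
  exact: measurable_rV_cons.
Qed.

HB.instance Definition _ := isMeasure.Build _ _ _ lebesgue_rV_step
  step0 step_ge0 step_sigma_additive.

Let step_sigma_finite : sigma_finite setT lebesgue_rV_step.
Proof.
have /sigma_finiteP[F [TF ndF Foo]] := sigma_finiteT (@lebesgue_measure R).
have /sigma_finiteP[G [TG ndG Goo]] := sigma_finiteT mu.
exists (fun k => @rV_uncons n @^-1` (F k `*` G k)).
  rewrite -preimage_bigcup (_ : \bigcup_k _ = setT) ?preimage_setT//.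
  apply/seteqP; split => // -[x v] _.
  have [i _ Fix] : (\bigcup_k F k) x by rewrite -TF.
  have [j _ Gjv] : (\bigcup_k G k) v by rewrite -TG.
  exists (maxn i j) => //; split => /=.
  - by move: x Fix; exact/subsetPset/ndF/leq_maxl.
  - by move: v Gjv; exact/subsetPset/ndG/leq_maxr.
move=> k; have [mF Fkoo] := Foo k; have [mG Gkoo] := Goo k; split.
  rewrite -[X in measurable X]setTI; apply: measurable_rV_uncons => //.
  exact: measurableX.
rewrite /lebesgue_rV_step /pushforward -comp_preimage.
rewrite (_ : _ \o _ = id); last by apply/funext => x /=; exact: rV_consK.
by rewrite product_measure1E// lte_mul_pinfty// ge0_fin_numE.
Qed.

HB.instance Definition _ := Measure_isSigmaFinite.Build _ _ _
  lebesgue_rV_step step_sigma_finite.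

End lebesgue_rV_step.

(* Lebesgue measure on Borel sets, uncompleted; every Lebesgue measurable
   function agrees almost everywhere with a Borel one. *)
Fixpoint lebesgue_measure_rV n :
    {sigma_finite_measure set 'rV[R]_n -> \bar R} :=
  match n with
  | 0 => dirac (0 : 'rV[R]_0)
  | m.+1 => lebesgue_rV_step (lebesgue_measure_rV m)
  end.

Definition rV_box n (a b : 'rV[R]_n) : set 'rV[R]_n :=
  [set x | forall i, x ord0 i \in `[a ord0 i, b ord0 i]].

Lemma measurable_rV_box n (a b : 'rV[R]_n) : measurable (rV_box a b).
Proof.
rewrite (_ : rV_box a b =
    \big[setI/setT]_(i < n) [set x : 'rV[R]_n | `[a ord0 i, b ord0 i]%classic (x ord0 i)]).
  apply: bigsetI_measurable => i _; rewrite -[X in measurable X]setTI.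
  exact: (@measurable_rV_coord _ i) => //.
rewrite -bigcap_seq; apply/seteqP; split => x /= xab i; first by move=> _; exact: xab.
by apply: xab; rewrite /= mem_index_enum.
Qed.

Lemma open_measurable_rV n (U : set 'rV[R]_n) : open U -> measurable U.
Proof.
move=> oU.
pose B (c : 'rV[rat]_n * 'rV[rat]_n) : set 'rV[R]_n :=
  rV_box (map_mx ratr c.1) (map_mx ratr c.2).
have -> : U = \bigcup_c (if c \in [set c | B c `<=` U] then B c else set0).
  rewrite -bigcup_mkcond; apply/seteqP; split => [x Ux|x [c /= cU]]; last exact: cU.
  have /nbhs_ballP[e /= e0 xeU] := open_nbhs_nbhs (conj oU Ux).
  have /choice[a ha] i : exists q : rat, ratr q \in `]x ord0 i - e, x ord0 i[.
    by apply: rat_in_itvoo; rewrite ltrBlDr ltrDl.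
  have /choice[b hb] i : exists q : rat, ratr q \in `]x ord0 i, x ord0 i + e[.
    by apply: rat_in_itvoo; rewrite ltrDl.
  exists (\row_i a i, \row_i b i) => /=; last first.
    move=> i; rewrite !mxE in_itv/=.
    by have := ha i; have := hb i; rewrite !in_itv/= => /andP[/ltW -> _] /andP[_ /ltW ->].
  move=> y hy; apply: xeU; split => // i j; rewrite (ord1 i).
  have := hy j; have := ha j; have := hb j; rewrite !mxE !in_itv/=.
  move=> /andP[_ bx] /andP[ax _] /andP[ay yb].
  rewrite /ball/= distrC ltr_norml; apply/andP; split.
    by rewrite ltrBrDl; exact: lt_le_trans ay.
  by rewrite ltrBlDl; exact: le_lt_trans bx.
apply: countable_bigcupT_measurable => // c.
by case: ifP => // _; exact: measurable_rV_box.
Qed.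

Lemma lebesgue_measure_rV_box n (a b : 'rV[R]_n) :
  (forall i, a ord0 i <= b ord0 i) ->
  lebesgue_measure_rV n (rV_box a b) = (\prod_i (b ord0 i - a ord0 i))%:E.
Proof.
elim: n => [|n ih] in a b * => ab.
  rewrite big_ord0 /= diracE mem_set//; by case.
rewrite /= /lebesgue_rV_step /pushforward.
rewrite (_ : _ @^-1` _ = `[a ord0 ord0, b ord0 ord0]%classic `*`
    rV_box (\row_j a ord0 (lift ord0 j)) (\row_j b ord0 (lift ord0 j))).
  rewrite product_measure1E//; last exact: measurable_rV_box.
  rewrite ih; last by move=> i; rewrite !mxE.
  rewrite -[X in (X * _)%E]/(lebesgue_measure `[a ord0 ord0, b ord0 ord0]%classic).
  rewrite lebesgue_measure_itv/=.
  rewrite big_ord_recl EFinM; congr (_ * _)%E.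
    rewrite lte_fin; case: ltP => // ba.
    by rewrite (@le_anti _ _ (a ord0 ord0) (b ord0 ord0)) ?subrr// ab ba.
  by congr EFin; apply: eq_bigr => i _; rewrite !mxE.
apply/seteqP; split=> [[x v] h|[x v] [/= hx hv] i].
  split => [|j] /=; first by have := h ord0; rewrite rV_cons0.
  by have := h (lift ord0 j); rewrite rV_consS !mxE.
case: (unliftP ord0 i) => [j|] ->; last by rewrite rV_cons0.
by have := hv j; rewrite rV_consS !mxE.
Qed.

End lebesgue_measure_rV.

Section sobolev.
Context {R : realType} {n : nat}.
Local Notation V := 'rV[R]_n.
Local Notation mu := (@lebesgue_measure_rV R n).
Implicit Types (U : set V) (u w phi : V -> R) (f g : V -> V) (p q : R).

Definition basis_vec (j : 'I_n) : V := delta_mx ord0 j.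

(* Frechet differentiability of every iterated partial derivative, [s = [::]]
   being [phi] itself; this is C^oo. *)
Definition smooth phi :=
  forall (s : seq 'I_n) (x : V),
    differentiable (foldr (fun j h => 'D_(basis_vec j) h) phi s) x.

Definition support phi : set V := closure [set x | phi x != 0].

Definition test_function U phi :=
  [/\ smooth phi, compact (support phi) & support phi `<=` U].

Definition locally_integrable_on U u :=
  measurable_fun U u /\
  forall K, compact K -> K `<=` U -> (\int[mu]_(x in K) `|u x|%:E < +oo)%E.

Definition Lp_on U p u :=
  measurable_fun U u /\ (\int[mu]_(x in U) (`|u x| `^ p)%:E < +oo)%E.

Definition weak_partial U (j : 'I_n) u w :=
  [/\ locally_integrable_on U u, locally_integrable_on U w &
    forall phi, test_function U phi ->
      \int[mu]_(x in U) (u x * 'D_(basis_vec j) phi x) =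
      - \int[mu]_(x in U) (w x * phi x)].

(* Row [i] of [Df x] is the weak gradient of the [i]-th component of [f]; as for
   all predicates relative to [U], the values off [U] are irrelevant. *)
Definition weak_gradient U f (Df : V -> 'M[R]_n) :=
  forall i j, weak_partial U j (fun x => f x ord0 i) (fun x => Df x i j).

(* Stated for any set [U]; it is only meant for open ones. *)
Definition sobolev_W1 U p f :=
  (forall i, Lp_on U p (fun x => f x ord0 i)) /\
  exists2 Df : V -> 'M[R]_n, weak_gradient U f Df &
    forall i j, Lp_on U p (fun x => Df x i j).

(* [f] and [g] are total functions; [g] represents the inverse of [f] on the
   image of [U]. *)
Definition homeo_onto_image U f g :=
  [/\ {within U, continuous f}, {within f @` U, continuous g} &
    forall x, U x -> g (f x) = x].

Definition bi_sobolev_homeo U f g :=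
  [/\ homeo_onto_image U f g, sobolev_W1 U 1 f & sobolev_W1 (f @` U) 1 g].

Definition boundary U : set V := closure U `\` interior U.

Definition identity_on_boundary U f :=
  exists F : V -> V, [/\ {within closure U, continuous F},
    (forall x, U x -> F x = f x) & (forall x, boundary U x -> F x = x)].

(* The norm on row vectors is the sup norm; being equivalent to the Euclidean
   one, it yields the same bounded Hoelder maps. *)
Definition bounded_hoelder U (alpha : R) f :=
  (exists M : R, forall x, U x -> `|f x| <= M) /\
  (exists C : R, forall x y, U x -> U y -> `|f x - f y| <= C * `|x - y| `^ alpha).

End sobolev.

(* Main.v *)
(** If [p + q >= n + 1], there is an integer [k <= p] with [n - k < q].  Split the
    coordinates into a set of size [k], on which [H] is [f], and its complement [J],
    on which [H] is the identity, so that [H = K o f], where [K] replaces the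
    coordinates in [J] by those of the inverse [g].

    Since [det Df = 0] almost everywhere, [f] is close to a degenerate affine map at
    most points and most dyadic scales, so it maps the complement of some null set
    [N] to a null set.  Since [K] involves only [n - k < q] components of [g], a
    Morrey type estimate, obtained by halving cells only in the directions [J],
    shows that it preserves null sets.  Hence [H] maps the complement of [N] to a
    null set.

    On the other hand [H] is the identity on the boundary, so by Brouwer's theorem
    the averages [H_l] of [H] at scale [2 ^ - l] still cover a fixed cube.  A dyadic
    cell [Q] of that scale satisfies [|H_l(Q)| <= C int_2Q (1 + |Df|^p)], because
    only [k <= p] components have been averaged.  If an open [W] contains [N] and
    carries little of this integral, most points of the cube are values of [H_l]
    outside of [W] for infinitely many [l]; in the limit they are values of [H]
    outside of [N], a contradiction.  So in fact [p + q < n + 1], and the equality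
    case does not occur. *)

Require Import Defs.
From HB Require Import structures.
From mathcomp Require Import all_boot all_order all_fingroup all_algebra.
From mathcomp Require Import all_classical all_reals all_analysis.
From mathcomp Require Import measurable_realfun.
From mathcomp Require Import ring lra zify.
Import HBSimple.

Set Implicit Arguments.
Unset Strict Implicit.
Unset Printing Implicit Defensive.
Import Order.TTheory GRing.Theory Num.Theory.
Import numFieldNormedType.Exports.

Local Open Scope classical_set_scope.
Local Open Scope ring_scope.

(** * Brouwer's theorem from Kuhn's lemma *)

(** The threshold [n + 1] comes from an asymmetry. Averaging involves one scale at a time, so the
    power [k <= p] suffices for the components of [f]. Recovering values of the inverse needs a sum
    over all scales: after [s] halvings the means of the gradient may have grown like [2 ^ (s / q)]
    while the sides shrink like [2 ^ (- s / (n - k))], and the series converges only for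
    [n - k < q]. The largest integer [k <= p] satisfies [n - k < n + 1 - p].

    Weak derivatives enter through one estimate, comparing the integrals of [u] over a box and over
    its translate. Halving a cell is an instance of it; the linear part of the change is given by
    numbers independent of the function, so that all components of a map are compared with one
    affine map.

    Images are not known to be measurable, so bounds are phrased by measurable covers. Values at
    points are not obtained as limits of means: chains of cells stop at a finite step, beyond which
    continuity bounds the error. *)

Section kuhn_simplices.
Variables n m : nat.
Local Notation I := 'I_n.+1.
Local Notation grid := {ffun I -> 'I_m.+2}.
Local Notation F2 := 'F_2.

(** Addition in ['I_m.+2] is modulo [m + 2], so the grid is a discrete torus, without boundary;
    [s x] is the step of the walk at which coordinate [x] is raised. *)
Definition kuhn_vertex (v : grid) (s : {perm I}) (i : nat) : grid :=
  [ffun x => v x + (s x < i)%N%:R].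

Lemma F2_addxx (x : F2) : x + x = 0.
Proof. by rewrite -mulr2n -mulr_natr pchar_Fp_0 ?mulr0. Qed.

(** Multiplication by the transposition exchanges even and odd permutations, so the terms cancel in
    pairs modulo 2. *)
Lemma sum_swap_eq0 (h : {perm I} -> F2) (x y : I) : x != y ->
  (forall s, h (s * tperm x y)%g = h s) -> \sum_s h s = 0.
Proof.
move=> xy hs; rewrite (bigID (fun s : {perm I} => odd_perm s))/=.
rewrite [X in X + _](reindex_inj (mulIg (tperm x y)))/=.
rewrite [X in X + _](eq_bigl (fun s : {perm I} => ~~ odd_perm s)); last first.
  by move=> s; rewrite odd_permM odd_tperm xy addbT.
by rewrite (eq_bigr h) ?F2_addxx.
Qed.

Variable a : I -> grid -> F2.

(** A cup product of coboundaries modulo 2, evaluated on one simplex: it is 1 exactly when, for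
    every [i], label [i] changes along step [i]. *)
Definition kuhn_term (v : grid) (s : {perm I}) : F2 :=
  \prod_(i < n.+1) (a i (kuhn_vertex v s i.+1) + a i (kuhn_vertex v s i)).

(* The simplices [v0 < ... < v(n+1)] with [a 0] evaluated at [v0] and the
   differences of the other labels taken along all steps but the [j]-th. *)
Definition gap_sum (j : nat) : F2 :=
  \sum_v \sum_s a ord0 v * \prod_(i < n)
    (let u := kuhn_vertex v s in let b := a (lift ord0 i) in
     if (i < j)%N then b (u i.+1) + b (u i) else b (u i.+2) + b (u i.+1)).

Lemma kuhn_vertex_swap v s (x y : I) (i : nat) : (y = x.+1 :> nat) -> i != y ->
  kuhn_vertex v (s * tperm x y)%g i = kuhn_vertex v s i.
Proof.
move=> yx; rewrite eq_sym => iy; apply/ffunP => z; rewrite !ffunE permM; congr (_ + _ %:R).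
case: tpermP => [->|->|//]; rewrite ?yx.
- by rewrite [in RHS]leq_eqVlt -yx (negbTE iy).
- by rewrite [in LHS]leq_eqVlt -yx (negbTE iy).
Qed.

(** The two sums differ in one factor, and adding them removes vertex [j + 1] from it. No other
    factor involves that vertex, so exchanging the steps [j] and [j + 1] of the walk preserves the
    term. *)
Lemma gap_sum_step j : (j < n)%N -> gap_sum j = gap_sum j.+1.
Proof.
move=> jn; suff : gap_sum j + gap_sum j.+1 = 0.
  by move=> e; rewrite -[LHS]addr0 -(F2_addxx (gap_sum j.+1)) addrA e add0r.
rewrite /gap_sum -big_split/= big1// => v _.
pose i0 := Ordinal jn.
pose x0 : I := inord j; pose y0 : I := inord j.+1.
have x0E : x0 = j :> nat by rewrite inordK// ltnS ltnW.
have y0E : y0 = j.+1 :> nat by rewrite inordK.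
rewrite -big_split/= (eq_bigr (fun s : {perm I} => a ord0 v *
   ((a (lift ord0 i0) (kuhn_vertex v s j.+2) + a (lift ord0 i0) (kuhn_vertex v s j)) *
    \prod_(i < n | i != i0) (let u := kuhn_vertex v s in let b := a (lift ord0 i) in
     if (i < j)%N then b (u i.+1) + b (u i) else b (u i.+2) + b (u i.+1))))).
  apply: (@sum_swap_eq0 _ x0 y0).
    by rewrite -val_eqE/= x0E y0E neq_ltn ltnSn.
  move=> s; have sw i : i != j.+1 -> kuhn_vertex v (s * tperm x0 y0) i = kuhn_vertex v s i.
    by move=> ij; apply: kuhn_vertex_swap; rewrite y0E ?x0E.
  congr (_ * (_ * _)); first by rewrite !sw// ?neq_ltn ?ltnSn ?orbT.
  apply: eq_bigr => i ii0 /=; rewrite -val_eqE/= in ii0.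
  case: ltnP => ij.
    by rewrite !sw// ?eqSS// neq_ltn ?ij// ltnS ltnW.
  have ji : (j < i)%N by rewrite ltn_neqAle eq_sym ii0.
  by rewrite !sw// neq_ltn !ltnS ?ji ?(ltnW ji) orbT.
move=> s _; rewrite -mulrDr; congr (_ * _).
rewrite (bigD1 i0)//= [X in _ + X](bigD1 i0)//= ltnn ltnSn.
set Q := \prod_(i < n | _) _.
rewrite [X in _ + _ * X](_ : _ = Q); last first.
  apply: eq_bigr => i ii0; rewrite -val_eqE/= in ii0.
  by rewrite ltnS (leq_eqVlt i j) (negbTE ii0).
rewrite -mulrDl; congr (_ * _).
by rewrite -addrA [X in _ + X]addrA F2_addxx add0r.
Qed.

Lemma kuhn_vertex0 v s : kuhn_vertex v s 0%N = v.
Proof. by apply/ffunP => x; rewrite ffunE addr0. Qed.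

Let rot : {perm I} := perm (addIr (ord_max : I)).
Let shift (s : {perm I}) : grid := [ffun x => (s x == ord0)%:R].

(** Starting at the second vertex and putting the first step last visits the same vertices, up to
    the one that is dropped and the one that is added at the end. *)
Lemma kuhn_vertex_rot v s i : (i <= n)%N ->
  kuhn_vertex (v + shift s) (s * rot)%g i = kuhn_vertex v s i.+1.
Proof.
move=> le_in; apply/ffunP => x; rewrite !ffunE -addrA; congr (_ + _).
rewrite permM permE -natrD; congr _%:R; rewrite -val_eqE/=.
case: (s x : nat) (ltn_ord (s x)) => [|k] kn /=.
  by rewrite add0n modn_small// ltnNge le_in addn0.
by rewrite addSnnS modnDr modn_small ?ltnS// ltnW.
Qed.

(** Stokes' theorem on the torus. Splitting the first factor gives a sum based at the second vertex
    and [gap_sum 0]; moving the gap to the end and re-basing each simplex at its second vertex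
    identifies the two. *)
Lemma kuhn_sum_eq0 : \sum_v \sum_s kuhn_term v s = 0.
Proof.
have -> : \sum_v \sum_s kuhn_term v s =
  (\sum_v \sum_s a ord0 (kuhn_vertex v s 1%N) * \prod_(i < n)
    (a (lift ord0 i) (kuhn_vertex v s i.+2) + a (lift ord0 i) (kuhn_vertex v s i.+1)))
  + gap_sum 0%N.
  rewrite /gap_sum -big_split; apply: eq_bigr => v _; rewrite -big_split.
  by apply: eq_bigr => s _; rewrite /kuhn_term big_ord_recl/=; rewrite kuhn_vertex0 mulrDl.
have -> : gap_sum 0%N = gap_sum n.
  have : (n <= n)%N by []; elim: {-2}n => // j ih jn.
  by rewrite ih 1?ltnW// gap_sum_step.
rewrite /gap_sum exchange_big/= [X in _ + X]exchange_big/=.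
rewrite [X in _ + X](reindex_inj (mulIg rot))/=.
rewrite [X in _ + X](eq_bigr (fun s : {perm I} =>
  \sum_v a ord0 (kuhn_vertex v s 1%N) * \prod_(i < n)
    (a (lift ord0 i) (kuhn_vertex v s i.+2) + a (lift ord0 i) (kuhn_vertex v s i.+1)))).
  by rewrite F2_addxx.
move=> s _; rewrite (reindex_inj (addIr (shift s)))/=; apply: eq_bigr => v _.
have e1 : v + shift s = kuhn_vertex v s 1%N.
  by rewrite -(kuhn_vertex_rot v s (leq0n n)) kuhn_vertex0.
rewrite [X in a ord0 X]e1; congr (_ * _); apply: eq_bigr => i _.
by rewrite ltn_ord !kuhn_vertex_rot// ltnW.
Qed.
End kuhn_simplices.

(* Labels agreeing with those of the identity as soon as some coordinate is
   extreme: the simplices wrapping around the torus contribute the same to both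
   sums, which vanish, and exactly one other simplex counts for the identity. *)
Lemma kuhn_simplex_exists (n m : nat)
    (c : 'I_n.+1 -> nat) (cm : forall i, (c i <= m)%N)
    (a : 'I_n.+1 -> {ffun 'I_n.+1 -> 'I_m.+2} -> bool) :
  (forall i (v : {ffun 'I_n.+1 -> 'I_m.+2}), [exists x, (v x == ord0) || (v x == ord_max)] ->
     a i v = (c i < v i)%N) ->
  exists (v : {ffun 'I_n.+1 -> 'I_m.+2}) s, (forall x, (v x <= m)%N) /\
    forall i : 'I_n.+1, a i (kuhn_vertex v s i.+1) != a i (kuhn_vertex v s i).
Proof.
move=> ac.
pose b i v : 'F_2 := (a i v)%:R; pose b' i (v : {ffun 'I_n.+1 -> 'I_m.+2}) : 'F_2 := (c i < v i)%N%:R.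
pose wrap (v : {ffun 'I_n.+1 -> 'I_m.+2}) := [exists x, v x == ord_max].
have F2b (p q : bool) : (p%:R + q%:R : 'F_2) = (p != q)%:R.
  by case: p; case: q; apply/val_inj.
have : \sum_(v | ~~ wrap v) \sum_s kuhn_term b v s =
       \sum_(v | ~~ wrap v) \sum_s kuhn_term b' v s.
  have e1 := kuhn_sum_eq0 b; have e2 := kuhn_sum_eq0 b'.
  rewrite (bigID wrap)/= in e1; rewrite (bigID wrap)/= in e2.
  have eqw : \sum_(v | wrap v) \sum_s kuhn_term b' v s =
             \sum_(v | wrap v) \sum_s kuhn_term b v s.
    apply: eq_bigr => v /existsP[x /eqP vx]; apply: eq_bigr => s _.
    apply: eq_bigr => i _; rewrite /b /b' !ac//; apply/existsP; exists x.
      rewrite !ffunE vx; case: ltnP => _; last by rewrite addr0 eqxx orbT.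
      by rewrite -!val_eqE/= (@modn_small 1)// addn1 modnn.
    rewrite !ffunE vx; case: ltnP => _; last by rewrite addr0 eqxx orbT.
    by rewrite -!val_eqE/= (@modn_small 1)// addn1 modnn.
  by move: e2; rewrite eqw -[RHS]e1 => /addrI.
pose v0 : {ffun 'I_n.+1 -> 'I_m.+2} := [ffun i => inord (c i)].
have v0E i : v0 i = c i :> nat by rewrite ffunE inordK// ltnS (leqW (cm i)).
have nwrap v : ~~ wrap v -> forall x, (v x <= m)%N.
  move=> /existsPn vm x; have := ltn_ord (v x); rewrite !ltnS leq_eqVlt => /orP[|//].
  by move=> /eqP e; have := vm x; rewrite -val_eqE/= e eqxx.
have kvE v s i x : ~~ wrap v -> kuhn_vertex v s i x = (v x + (s x < i))%N :> nat.
  move=> /nwrap /(_ x) vx; rewrite ffunE/=; case: (s x < i)%N => /=; rewrite ?addn1 ?addn0.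
    by rewrite modn_small// !ltnS.
  by rewrite modn_small// ltnS leqW.
(* Label [i] of the identity reads coordinate [i] only. It changes along step [i] only if that step
   raises coordinate [i], from [c i] to [c i + 1]; this leaves the simplex at [c] with the identity
   permutation. *)
have fact v (s : {perm 'I_n.+1}) (i : 'I_n.+1) : ~~ wrap v -> (v i != c i :> nat) || (s i != i) ->
    b' i (kuhn_vertex v s i.+1) + b' i (kuhn_vertex v s i) = 0.
  move=> wv h; rewrite F2b !kvE//.
  suff -> : (c i < v i + (s i < i.+1))%N = (c i < v i + (s i < i))%N by rewrite eqxx.
  rewrite [(s i < i.+1)%N]ltnS [(s i <= i)%N]leq_eqVlt.
  case: (ltngtP (s i : nat) i) => [_|_|si] //=; rewrite addn0 addn1.
  move: h; rewrite -[s i == i]val_eqE/= si eqxx orbF ltnS leq_eqVlt eq_sym.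
  by move=> /negbTE ->.
have -> : \sum_(v | ~~ wrap v) \sum_s kuhn_term b' v s = 1.
  have wv0 : ~~ wrap v0.
    by apply/existsPn => x; rewrite -val_eqE/= v0E neq_ltn ltnS cm.
  rewrite (bigD1 v0)//= (bigD1 1%g)//= big1 ?big1 ?addr0.
  - rewrite /kuhn_term big1// => i _.
    by rewrite F2b !kvE// !v0E perm1 ltnn ltnSn addn0 addn1 ltnn ltnSn.
  - move=> v /andP[wv vv0]; apply: big1 => s _; apply/eqP/prodf_eq0.
    have [i vi] : exists i, v i != c i :> nat.
      apply/existsP; apply: contraNT vv0 => /existsPn vc; apply/eqP/ffunP => i.
      by apply/val_inj; rewrite /= v0E; apply/eqP; rewrite -[_ == _]negbK vc.
    by exists i => //; rewrite fact// vi.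
  - move=> s s1; apply/eqP/prodf_eq0.
    have [i si] : exists i, s i != i.
      apply/existsP; apply: contraNT s1 => /existsPn vc; apply/eqP/permP => i.
      by rewrite perm1; apply/eqP; rewrite -[_ == _]negbK vc.
    by exists i => //; rewrite fact// si orbT.
move=> sum1; apply: contrapT => none; suff /eqP : (1 : 'F_2) = 0 by rewrite oner_eq0.
rewrite -sum1 big1// => v wv; apply: big1 => s _.
apply/eqP/prodf_eq0.
have /existsP[i ai] : [exists i : 'I_n.+1, a i (kuhn_vertex v s i.+1) == a i (kuhn_vertex v s i)].
  apply: contra_notT none => /existsPn ai; exists v, s; split => //.
  exact: nwrap.
by exists i => //; rewrite /b F2b ai.
Qed.

(** * Continuity and compactness in terms of distances *)

Section sup_norm.
Context {R : realType} {n : nat}.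
Local Notation V := 'rV[R]_n.

Lemma rV_norm_le (x : V) (e : R) : 0 <= e ->
  (forall i, `|x ord0 i| <= e) -> `|x| <= e.
Proof.
move=> e0 xe; rewrite [leLHS]/Num.Def.normr/= mx_normrE; apply/bigmax_leP; split => //.
by move=> [i j] _ /=; rewrite (ord1 i).
Qed.

Lemma rV_norm_lt (x : V) (e : R) : 0 < e ->
  (forall i, `|x ord0 i| < e) -> `|x| < e.
Proof.
move=> e0 xe; rewrite [ltLHS]/Num.Def.normr/= mx_normrE; apply/bigmax_ltP; split => //.
by move=> [i j] _ /=; rewrite (ord1 i).
Qed.

Lemma rV_coord_le (x : V) i : `|x ord0 i| <= `|x|.
Proof.
rewrite [leRHS]/Num.Def.normr/= mx_normrE.
by apply/bigmax_geP; right; exists (ord0, i).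
Qed.

Lemma within_continuous_dist (A : set V) (f : V -> V) (x : V) (e : R) :
  {within A, continuous f} -> A x -> 0 < e ->
  exists2 d, 0 < d & forall y, A y -> `|x - y| < d -> `|f x - f y| < e.
Proof.
move=> /subspace_continuousP cf Ax e0.
have /cvgrPdist_lt /(_ _ e0) := cf _ Ax.
rewrite near_withinE => /nbhs_ballP[d /= d0 xd]; exists d => // y Ay xy.
by apply: xd => //; rewrite mx_norm_ball.
Qed.

Lemma continuous_withinP (A : set V) (f : V -> V) :
  (forall x e, A x -> 0 < e ->
    exists2 d, 0 < d & forall y, A y -> `|x - y| < d -> `|f x - f y| < e) ->
  {within A, continuous f}.
Proof.
move=> cf; apply/subspace_continuousP => x Ax; apply/cvgrPdist_lt => e e0.
have [d d0 xd] := cf _ _ Ax e0.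
rewrite near_withinE; apply/nbhs_ballP; exists d => //= y; rewrite mx_norm_ball => xy Ay.
exact: xd.
Qed.

Lemma openP_dist (A : set V) :
  open A <-> forall x, A x -> exists2 d, 0 < d & forall y, `|x - y| < d -> A y.
Proof.
rewrite openE; split => [oA x /oA/nbhs_ballP[d /= d0 xd]|oA x /oA[d d0 xd]].
  by exists d => // y xy; apply: xd; rewrite mx_norm_ball.
by apply/nbhs_ballP; exists d => //= y; rewrite mx_norm_ball; exact: xd.
Qed.

Lemma closureP_dist (A : set V) x :
  closure A x <-> forall d, 0 < d -> exists2 y, A y & `|x - y| < d.
Proof.
split => [clA d d0|clA B /nbhs_ballP[d /= d0 xB]].
  have [|y [Ay xy]] := clA (ball x d); first exact: nbhsx_ballx.
  by exists y => //; move: xy; rewrite mx_norm_ball.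
have [y Ay xy] := clA _ d0; exists y; split => //; apply: xB.
by rewrite mx_norm_ball.
Qed.

Lemma compact_seq_cluster (A : set V) (u : nat -> V) : compact A ->
  (forall k, A (u k)) ->
  exists2 x, A x & forall d N, 0 < d -> exists2 k, (N <= k)%N & `|x - u k| < d.
Proof.
move=> cA Au; have [] := cA (u @ \oo) _; first by exists 0%N => //= k _; exact: Au.
move=> x [Ax xu]; exists x => // d N d0.
have [] := xu (u @` [set k | (N <= k)%N]) (ball x d).
- by exists N => // k /= Nk; exists k.
- exact: nbhsx_ballx.
- by move=> _ [[k Nk <-]]; rewrite mx_norm_ball => xk; exists k.
Qed.

Lemma compact_uniform_dist (A : set V) (f : V -> V) (e : R) : compact A ->
  {within A, continuous f} -> 0 < e ->
  exists2 d, 0 < d & forall x y, A x -> A y -> `|x - y| < d -> `|f x - f y| < e.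
Proof.
move=> cA cf e0; apply: contrapT => nd.
have /choice[u uP] (k : nat) : exists u : V * V,
    [/\ A u.1, A u.2, `|u.1 - u.2| < k.+1%:R^-1 & e <= `|f u.1 - f u.2|].
  apply: contrapT => nu; apply: nd; exists k.+1%:R^-1 => // x y Ax Ay xy.
  by rewrite ltNge; apply/negP => fxy; apply: nu; exists (x, y).
have [||x Ax xu] := @compact_seq_cluster A (fst \o u) => //.
  by move=> k /=; case: (uP k).
have e20 : 0 < e / 2 by rewrite divr_gt0.
have [d d0 xd] := within_continuous_dist cf Ax e20.
have d20 : 0 < d / 2 by rewrite divr_gt0.
pose N := Num.truncn (d / 2)^-1.
have [k Nk xk] := xu _ N d20; have [A1 A2 u12 ef] := uP k.
have kd : k.+1%:R^-1 <= d / 2.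
  rewrite -[leRHS]invrK lef_pV2 ?posrE ?invr_gt0//.
  by apply: le_trans (ltW (truncnS_gt _)) _; rewrite ler_nat ltnS.
have := xd _ A1 (lt_trans xk _); have := xd _ A2.
rewrite ltr_pdivrMr// ltr_pMr// ltr1n => /(_ _) h2 /(_ isT) h1.
have {}h2 : `|f x - f (u k).2| < e / 2.
  apply: h2; rewrite -(subrKA (u k).1) (le_lt_trans (ler_normD _ _))//.
  by rewrite [ltRHS](splitr d) ltrD// (lt_le_trans u12).
have := ler_distD (f x) (f (u k).1) (f (u k).2).
rewrite (distrC _ (f x)) leNgt => /negP; apply.
by apply: lt_le_trans ef; rewrite [ltRHS](splitr e) ltrD.
Qed.

Lemma bounded_setP_norm (A : set V) :
  bounded_set A -> exists2 M, 0 < M & forall x, A x -> `|x| < M.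
Proof.
move=> [M [Mr AM]]; exists (`|M| + 2); first by rewrite ltr_pwDr.
move=> x Ax; apply: le_lt_trans (AM (`|M| + 1) _ _ Ax) _.
  by rewrite (le_lt_trans (ler_norm _))// ltrDl.
by rewrite ltrD2l ltr1n.
Qed.

Lemma compact_ballP (M : R) : compact [set x : V | `|x| <= M].
Proof.
apply: bounded_closed_compact.
  by exists M; split; [exact: num_real|move=> N MN x /= xM; exact: le_trans (ltW MN)].
move=> x /closureP_dist clx /=; apply/ler_addgt0Pr => e e0.
have [y /= yM xy] := clx _ e0.
rewrite -(subrK y x) addrC (le_trans (ler_normD _ _))// lerD// ltW//.
Qed.
End sup_norm.

(** * Maps that are the identity on the boundary *)

Section covering.
Context {R : realType} {n : nat}.
Local Notation V := 'rV[R]_n.+1.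
Local Notation I := 'I_n.+1.

(* Brouwer: a continuous self-map of [V] which is the identity far away is
   onto.  A grid simplex on which every coordinate of [G - y] changes sign is
   provided by [kuhn_simplex_exists]; refine the grid. *)
Lemma identity_far_surjective (G : V -> V) (r : R) (y : V) :
  {within setT, continuous G} -> (forall x, r <= `|x| -> G x = x) -> `|y| < r ->
  exists x, G x = y.
Proof.
move=> cG Gid yr; have r0 : 0 < r by rewrite (le_lt_trans _ yr).
pose h (m : nat) : R := 2 * r / m.+1%:R.
have h0 m : 0 < h m by rewrite divr_gt0// mulr_gt0.
have hm m : m.+1%:R * h m = 2 * r by rewrite mulrC divfK.
pose X m (v : {ffun I -> 'I_m.+2}) : V := \row_i (- r + (v i)%:R * h m).
pose t m i := (y ord0 i + r) / h m.
have yi i : - r < y ord0 i < r by rewrite -ltr_norml (le_lt_trans (rV_coord_le _ _)).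
have t0 m i : 0 <= t m i.
  by rewrite divr_ge0 ?(ltW (h0 m))// -[r]opprK subr_ge0 ltW//; case/andP: (yi i).
(* The grid cell of [y]: a grid point exceeds [y] in coordinate [i] exactly when its index exceeds
   [c m i]. *)
pose c m i := Num.truncn (t m i).
have cm m i : (c m i <= m)%N.
  rewrite -ltnS truncn_lt_nat// ltr_pdivrMr// hm.
  by have /andP[] := yi i; lra.
pose a m i v := y ord0 i < G (X m v) ord0 i.
have ac m i (v : {ffun I -> 'I_m.+2}) :
    [exists x, (v x == ord0) || (v x == ord_max)] -> a m i v = (c m i < v i)%N.
  move=> /existsP[x vx]; rewrite /a Gid.
    rewrite mxE truncn_lt_nat// ltr_pdivrMr//; apply/idP/idP; lra.
  apply: le_trans (rV_coord_le _ x); rewrite mxE.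
  case/orP : vx => /eqP -> /=; first by rewrite mul0r addr0 normrN ler_norm.
  by rewrite hm (_ : - r + 2 * r = r) ?ler_norm//; ring.
have X_in m v : `|X m v| <= r.
  apply: rV_norm_le (ltW r0) _ => i; rewrite mxE ler_norml.
  have : (v i)%:R * h m <= 2 * r by rewrite -(hm m) ler_pM2r// ler_nat -ltnS.
  have : 0 <= (v i)%:R * h m by rewrite mulr_ge0// ltW.
  by move=> A B; apply/andP; split; lra.
have /choice[w wP] (m : nat) : exists w : V, `|w| <= r /\ forall i, exists z z' : V,
    [/\ `|w - z| <= h m, `|w - z'| <= h m, y ord0 i < G z ord0 i & G z' ord0 i <= y ord0 i].
  have [v [s [vm vs]]] := kuhn_simplex_exists (cm m) (ac m).
  have wv j : `|X m v - X m (kuhn_vertex v s j)| <= h m.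
    apply: rV_norm_le (ltW (h0 m)) _ => i; rewrite !mxE.
    have -> : nat_of_ord (kuhn_vertex v s j i) = (v i + (s i < j))%N.
      rewrite ffunE/=.
      have := vm i; case: (s i < j)%N => /= vim; rewrite ?addn1 ?addn0.
        by rewrite modn_small// !ltnS.
      by rewrite modn_small// ltnS leqW.
    rewrite natrD mulrDl opprD addrACA subrr add0r opprD addrA subrr add0r normrN.
    case: (s i < j)%N; first by rewrite mul1r gtr0_norm.
    by rewrite mul0r normr0 ltW.
  exists (X m v); split => // i; have := vs i; rewrite /a.
  case: (ltP (y ord0 i) (G (X m (kuhn_vertex v s i.+1)) ord0 i)) => z1;
  case: (ltP (y ord0 i) (G (X m (kuhn_vertex v s i)) ord0 i)) => z2 //= _.
    by exists (X m (kuhn_vertex v s i.+1)), (X m (kuhn_vertex v s i)).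
  by exists (X m (kuhn_vertex v s i)), (X m (kuhn_vertex v s i.+1)).
have [|x _ xw] := @compact_seq_cluster _ _ _ w (@compact_ballP R n.+1 r).
  by move=> k; case: (wP k).
exists x; apply/rowP => i; apply/eqP; rewrite -subr_eq0 -normr_le0.
apply/ler_addgt0Pr => e e0; rewrite add0r.
have [d d0 xd] := within_continuous_dist cG (Logic.I : [set: V] x) e0.
have d20 : 0 < d / 2 by rewrite divr_gt0.
have [m Nm xm] := xw _ (Num.truncn (2 * r / (d / 2))) d20.
have hd : h m < d / 2.
  rewrite ltr_pdivrMr// [ltRHS]mulrC -ltr_pdivrMr//.
  by apply: lt_le_trans (truncnS_gt _) _; rewrite ler_nat ltnS.
have near z : `|w m - z| <= h m -> `|G x ord0 i - G z ord0 i| < e.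
  move=> wz; have xz : `|x - z| < d.
    rewrite -(subrKA (w m)) (le_lt_trans (ler_normD _ _))// [ltRHS](splitr d).
    by rewrite ltrD// (le_lt_trans wz).
  apply: le_lt_trans (xd z Logic.I xz).
  by have := rV_coord_le (G x - G z) i; rewrite !mxE.
have [_ /(_ i)[z [z' [/near + /near + yz z'y]]]] := wP m.
rewrite !ltr_norml ler_norml => /andP[A1 A2] /andP[B1 B2].
by apply/andP; split; lra.
Qed.

(** Extended by the identity outside [U], the map is continuous and the identity far away, hence
    onto; a point of [U] cannot be attained outside [U], where nothing moves. *)
Lemma covering_of_identity_on_boundary (U : set V) (F : V -> V) :
  open U -> bounded_set U -> {within closure U, continuous F} ->
  (forall x, boundary U x -> F x = x) -> U `<=` F @` U.
Proof.
move=> oU /bounded_setP_norm[M M0 UM] cF Fid y Uy.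
pose G x := if x \in U then F x else x.
have GU x : U x -> G x = F x by move=> Ux; rewrite /G mem_set.
have GnU x : ~ U x -> G x = x by move=> Ux; rewrite /G memNset.
have GcU x : closure U x -> G x = F x.
  move=> cUx; have [/GU//|nUx] := pselect (U x).
  by rewrite GnU// Fid//; split => // /interior_subset.
have cG : {within setT, continuous G}.
  apply: continuous_withinP => x e _ e0.
  have [cUx|ncUx] := pselect (closure U x).
    have [d d0 xd] := within_continuous_dist cF cUx e0.
    rewrite GcU//; have [Ux|nUx] := pselect (U x).
      have [d' d'0 xd'] := (openP_dist U).1 oU _ Ux.
      exists (Num.min d d') => [|z _]; first by rewrite lt_min d0.
      rewrite lt_min => /andP[xz xz']; rewrite GU; last exact: xd'.
      by apply: xd => //; apply: subset_closure; exact: xd'.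
    exists (Num.min d e) => [|z _]; first by rewrite lt_min d0.
    rewrite lt_min => /andP[xz xze].
    have [Uz|nUz] := pselect (U z).
      by rewrite GU//; apply: xd => //; exact: subset_closure.
    by rewrite (GnU z)// -GcU// GnU.
  have /(openP_dist _).1/(_ _ ncUx)[d d0 xd] : open (~` closure U).
    by rewrite openC; exact: closed_closure.
  have nU z : `|x - z| < d -> ~ U z by move=> /xd cz /subset_closure.
  exists (Num.min d e) => [|z _]; first by rewrite lt_min d0.
  rewrite lt_min => /andP[xz xze]; rewrite !GnU//; first exact: nU.
  by apply: nU; rewrite subrr normr0.
have [|x Gxy] := @identity_far_surjective G M y cG _ (UM _ Uy).
  by move=> x Mx; apply: GnU => /UM; rewrite ltNge Mx.
have [Ux|nUx] := pselect (U x); first by exists x => //; rewrite -GU.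
by move: Uy; rewrite -Gxy GnU.
Qed.

Lemma boundary_open (U : set V) x : open U -> boundary U x -> closure U x /\ ~ U x.
Proof. by move=> oU [cUx]; rewrite (interior_id U).1. Qed.

(* A point of [f @` U] on the boundary would be hit by [g] both inside [U] and,
   by continuity of [g], on the boundary; the points mapped outside the closure
   form an open set covered by its own image. *)
Lemma image_of_homeo_identity_on_boundary (U : set V) (f g : V -> V) :
  open U -> bounded_set U -> homeo_onto_image U f g -> identity_on_boundary U f ->
  f @` U = U.
Proof.
move=> oU bU [cf cg gf] [F [cF Ff Fid]].
have nb x : U x -> ~ boundary U (f x).
  move=> Ux bfx; have [cfx nfx] := boundary_open oU bfx; apply: nfx.
  have [d d0 xd] := (openP_dist U).1 oU _ Ux.
  have d20 : 0 < d / 2 by rewrite divr_gt0.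
  have ffx : (f @` U) (f x) by exists x.
  have [d1 d10 H1] := within_continuous_dist cg ffx d20.
  have [d2 d20' H2] := within_continuous_dist cF cfx d10.
  pose d3 := Num.min d2 (d / 2).
  have d30 : 0 < d3 by rewrite !lt_min d20'.
  have [z Uz] := (closureP_dist _ _).1 cfx d3 d30.
  rewrite !lt_min => /andP[z2 zd]; apply: xd.
  have := H1 (f z) (ex_intro2 _ _ z Uz erefl); rewrite !gf// => xz.
  rewrite -(subrKA z) (le_lt_trans (ler_normD _ _))// [ltRHS](splitr d).
  apply: ltrD; last by rewrite distrC.
  apply: xz; have := H2 z (subset_closure Uz) z2.
  by rewrite Fid// Ff.
have cFf x e : U x -> 0 < e ->
    exists2 d, 0 < d & forall y, `|x - y| < d -> U y /\ `|f x - f y| < e.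
  move=> Ux e0; have [d d0 xd] := within_continuous_dist cf Ux e0.
  have [d' d'0 xd'] := (openP_dist U).1 oU _ Ux.
  exists (Num.min d d') => [|y]; first by rewrite lt_min d0.
  by rewrite lt_min => /andP[xy /xd' Uy]; split => //; exact: xd.
pose Z := [set x | U x /\ ~ U (f x)].
have oZ : open Z.
  apply/openP_dist => x [Ux nUfx].
  have : ~ closure U (f x).
    by move=> cx; apply: (nb _ Ux); split => // /interior_subset.
  have /(openP_dist _).1 oc : open (~` closure U) by rewrite openC; exact: closed_closure.
  move=> /oc[e e0 xe]; have [d d0 xd] := cFf _ _ Ux e0.
  by exists d => // y /xd[Uy /xe cy]; split => // /subset_closure.
have ZU : Z `<=` U by move=> x [].
have bZ : bounded_set Z.
  by case: bU => M [Mr UM]; exists M; split => // N MN x /ZU; exact: UM.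
(* A boundary point of [Z] is not in [Z]; were it in [U], it would be mapped into the open set [U]
   together with its neighbours, some of which are in [Z]. So it lies on the boundary of [U]. *)
have Fid' x : boundary Z x -> F x = x.
  move=> /(boundary_open oZ)[cx nZx]; apply: Fid; split; first exact: closureS cx.
  move=> /interior_subset Ux.
  have Ufx : U (f x) by apply: contrapT => nUfx; apply: nZx.
  have [e e0 xe] := (openP_dist U).1 oU _ Ufx.
  have [d d0 xd] := cFf _ _ Ux e0.
  by have [y [Uy nUy] /xd[_ /xe]] := (closureP_dist _ _).1 cx d d0.
have noZ x : ~ Z x.
  move=> Zx; have [|z Zz zx] := covering_of_identity_on_boundary oZ bZ _ Fid' Zx.
    by apply: continuous_subspaceW cF; exact: closureS.
  by case: Zz Zx => Uz + [Ux _]; rewrite -Ff// zx.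
apply/seteqP; split => [_ [x Ux <-]|y Uy].
  by apply: contrapT => nUfx; apply: (noZ x).
by have [x Ux <-] := covering_of_identity_on_boundary oU bU cF Fid Uy; exists x => //; rewrite Ff.
Qed.
End covering.

(** * Smooth cut-offs and weak derivatives *)

Section smooth_functions_on_the_line.
Context {R : realType}.
Implicit Types (h g : R -> R) (p : {poly R}).

Lemma is_derive_fun_mul h g (x h' g' : R) :
  is_derive x 1 h h' -> is_derive x 1 g g' ->
  is_derive x 1 (fun y => h y * g y) (h' * g x + h x * g').
Proof.
move=> dh dg; have := @is_deriveM _ _ h g x 1 _ _ dh dg.
by move=> /is_derive_eq; apply; rewrite addrC [_ *: h']mulrC.
Qed.

Lemma is_derive_fun_add h g (x h' g' : R) :
  is_derive x 1 h h' -> is_derive x 1 g g' ->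
  is_derive x 1 (fun y => h y + g y) (h' + g').
Proof. by move=> dh dg; exact: (@is_deriveD _ _ _ h g). Qed.

Lemma is_derive_fun_scale h (c x h' : R) :
  is_derive x 1 h h' -> is_derive x 1 (fun y => c * h y) (c * h').
Proof. by move=> dh; exact: (@is_deriveZ _ _ _ h c). Qed.

Lemma is_derive_affine h (h' a b x : R) : is_derive (a * x + b) 1 h h' ->
  is_derive x 1 (fun y => h (a * y + b)) (a * h').
Proof.
move=> dh; rewrite mulrC; apply: (@is_derive1_comp _ h (fun y => a * y + b)) => //.
rewrite -[X in is_derive _ _ _ X]addr0; apply: is_derive_fun_add.
by rewrite -[X in is_derive _ _ _ X]mulr1; exact: is_derive_fun_scale.
Qed.

(** Derivatives are carried as witnesses, so that the rules for sums, products and affine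
    substitutions follow by induction on [k]. *)
Fixpoint differentiable_times (k : nat) h : Prop :=
  if k is k'.+1 then
    exists2 h' : R -> R, (forall x : R, is_derive x 1 h (h' x)) & differentiable_times k' h'
  else True.

Definition smooth_line h := forall k, differentiable_times k h.

Lemma differentiable_timesS k h :
  differentiable_times k.+1 h -> differentiable_times k h.
Proof. by elim: k h => // k ih h [h' dh /ih]; exists h'. Qed.

Lemma smooth_line_cst (c : R) : smooth_line (fun=> c).
Proof.
move=> k; elim: k c => // k ih c; exists (fun=> 0) => // x.
exact: is_derive_cst.
Qed.

Lemma differentiable_timesD k h g :
  differentiable_times k h -> differentiable_times k g ->
  differentiable_times k (fun x => h x + g x).
Proof.
elim: k h g => // k ih h g [h' dh sh] [g' dg sg].
exists (fun x => h' x + g' x); last exact: ih.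
by move=> x; exact: is_derive_fun_add.
Qed.

Lemma smooth_lineD h g : smooth_line h -> smooth_line g ->
  smooth_line (fun x => h x + g x).
Proof. by move=> sh sg k; exact: differentiable_timesD. Qed.

Lemma smooth_lineM h g : smooth_line h -> smooth_line g ->
  smooth_line (fun x => h x * g x).
Proof.
move=> sh sg k; elim: k h g {sh sg}(sh k) (sg k) => // k ih h g.
move=> /[dup] /differentiable_timesS sh [h' dh sh'].
move=> /[dup] /differentiable_timesS sg [g' dg sg'].
exists (fun x => h' x * g x + h x * g' x).
  by move=> x; exact: is_derive_fun_mul.
by apply: differentiable_timesD; exact: ih.
Qed.

Lemma differentiable_timesZ k (c : R) h :
  differentiable_times k h -> differentiable_times k (fun x => c * h x).
Proof.
elim: k h => // k ih h [h' dh sh]; exists (fun x => c * h' x); last exact: ih.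
by move=> x; exact: is_derive_fun_scale.
Qed.

Lemma smooth_line_affine h (a b : R) : smooth_line h ->
  smooth_line (fun x => h (a * x + b)).
Proof.
move=> sh k; elim: k h {sh}(sh k) => // k ih h [h' dh sh].
exists (fun x => a * h' (a * x + b)); first by move=> x; exact: is_derive_affine.
by apply: differentiable_timesZ; exact: ih.
Qed.

Lemma smooth_line_derive h h' : smooth_line h ->
  (forall x : R, is_derive x 1 h (h' x)) -> smooth_line h'.
Proof.
move=> sh dh k; have [h2 dh2 sh2] := sh k.+1.
suff -> : h' = h2 by [].
by apply/funext => x; rewrite -(@derive_val _ _ _ _ _ _ _ (dh x)) (@derive_val _ _ _ _ _ _ _ (dh2 x)).
Qed.

(** Each monomial is controlled by [s ^ i / i! <= e ^ s], whence the factorials in the constant. *)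
Lemma poly_expRN_bounded p : exists2 C : R, 0 < C &
  forall s, 0 < s -> `|p.[s]| * expR (- s) <= C.
Proof.
exists (1 + \sum_(i < size p) `|p`_i| * i`!%:R).
  by apply: ltr_pwDl => //; apply: sumr_ge0 => i _; rewrite mulr_ge0.
move=> s s0; rewrite horner_coef.
apply: (@le_trans _ _ (\sum_(i < size p) `|p`_i| * i`!%:R)); last by rewrite lerDr.
apply: (@le_trans _ _ ((\sum_(i < size p) `|p`_i| * s ^+ i) * expR (- s))).
  rewrite ler_wpM2r ?expR_ge0//; apply: le_trans (ler_norm_sum _ _ _) _.
  by apply: ler_sum => i _; rewrite normrM [X in _ * X]ger0_norm ?exprn_ge0 ?(ltW s0).
rewrite mulr_suml; apply: ler_sum => i _; rewrite -mulrA ler_wpM2l//.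
rewrite expRN ler_pdivrMr ?expR_gt0//.
have i0 : (0 : R) < i`!%:R by rewrite ltr0n fact_gt0.
rewrite mulrC -ler_pdivrMr//.
case: (nat_of_ord i) => [|j].
  by rewrite expr0 fact0 divr1; have := @pexpR_gt1 R s s0; move/ltW.
by apply: le_trans (expR_ge1Dxn j (ltW s0)); rewrite lerDr.
Qed.

(** The functions [p(1/t) e^(-1/t)], extended by 0, form a family closed under differentiation, [p]
    becoming [X^2 (p - p')]; all derivatives at 0 are thus treated at once. *)
Definition exp_inv p (t : R) : R := if 0 < t then p.[t^-1] * expR (- t^-1) else 0.

Lemma is_derive_exp_inv p (x : R) :
  is_derive x 1 (exp_inv p) (exp_inv ('X^2 * (p - p^`()%R)) x).
Proof.
have [x0|x0|<-] := ltgtP 0 x.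
- have nx : x != 0 by rewrite gt_eqF.
  apply: (@near_eq_is_derive R R R (fun t => p.[t^-1] * expR (- t^-1))).
    near=> t; rewrite /exp_inv ifT//; near: t; exact: lt_nbhsr.
  rewrite /exp_inv x0.
  have dV : is_derive x 1 (fun t : R => t^-1) (- x ^- 2).
    apply: DeriveDef; first exact: (@derivableV R R id).
    by rewrite (@deriveV R R id)// derive_id /GRing.scale/= mulr1.
  have -> : ('X^2 * (p - p^`()%R)).[x^-1] * expR (- x^-1) =
      p^`()%R.[x^-1] * (- x ^- 2) * expR (- x^-1) +
      p.[x^-1] * (expR (- x^-1) * (- - x ^- 2)).
    by rewrite !hornerE/= opprK exprVn; ring.
  apply: is_derive_fun_mul.
- apply: (@near_eq_is_derive R R R (fun=> 0)); last first.
    by rewrite /exp_inv ltNge (ltW x0)/=; exact: is_derive_cst.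
  near=> t; rewrite /exp_inv ifF//; apply/negbTE; rewrite -leNgt ltW//; near: t.
  exact: lt_nbhsl.
have -> : exp_inv ('X^2 * (p - p^`()%R)) 0 = 0 by rewrite /exp_inv ltxx.
(* The extra ['X^2] makes the difference quotient at 0 smaller than [C t], not just bounded. *)
have [C C0 pC] := poly_expRN_bounded ('X^2 * p).
have q0 : (fun h : R => h^-1 *: (exp_inv p (h *: 1 + 0) - exp_inv p 0)) @ 0^' --> (0 : R).
  apply/cvgrPdist_lt => e e0; near=> t.
  rewrite sub0r normrN addr0 /exp_inv ltxx subr0 /GRing.scale/= mulr1.
  case: (ltP 0 t) => t0; last by rewrite mulr0 normr0.
  have := pC t^-1; rewrite invr_gt0 => /(_ t0); rewrite !hornerE/= normrM.
  rewrite [`|_ ^+ 2|]ger0_norm ?exprn_ge0 ?invr_ge0 ?(ltW t0)// => pt.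
  rewrite !normrM (ger0_norm (expR_ge0 _)) ger0_norm ?invr_ge0 ?(ltW t0)//.
  have te : t * C < e.
    rewrite -ltr_pdivlMr//; near: t; exists (e / C) => /=; first exact: divr_gt0.
    by move=> y /=; rewrite sub0r normrN => + _; apply: le_lt_trans; exact: ler_norm.
  apply: le_lt_trans te.
  rewrite [leLHS](_ : _ = t * (t^-1 ^+ 2 * `|p.[t^-1]| * expR (- t^-1))).
    by rewrite ler_pM2l.
  by rewrite expr2 !mulrA mulfV ?mul1r// gt_eqF.
apply: DeriveDef; first by apply/cvg_ex; exists 0.
exact: cvg_lim q0.
Unshelve. all: end_near. Qed.

Lemma smooth_exp_inv p : smooth_line (exp_inv p).
Proof.
move=> k; elim: k p => // k ih p; exists (exp_inv ('X^2 * (p - p^`()%R))) => //.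
exact: is_derive_exp_inv.
Qed.

Lemma smooth_line_continuous h : smooth_line h -> continuous h.
Proof.
move=> sh x; have [h' dh _] := sh 1%N.
by apply: differentiable_continuous; apply/derivable1_diffP; exact: ex_derive.
Qed.

Lemma smooth_line_primitive h : smooth_line h -> (forall x, x <= 0 -> h x = 0) ->
  exists P, [/\ smooth_line P, forall x : R, is_derive x 1 P (h x) &
    forall x, x <= 0 -> P x = 0].
Proof.
(* The base point [-1] is harmless: [h] vanishes on the negative half-line, so the integral is a
   primitive on the whole line. *)
move=> sh h0; pose P x := (\int[lebesgue_measure]_(t in `[(-1)%R, x]) h t)%R.
have P0 x : x <= 0 -> P x = 0.
  move=> x0; rewrite /P (@eq_Rintegral _ _ _ lebesgue_measure _ (fun=> 0)).
    by rewrite /Rintegral integral0.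
  by move=> t; rewrite inE/= in_itv/= => /andP[_ tx]; rewrite h0// (le_trans tx).
have dP (x : R) : is_derive x 1 P (h x).
  have [x0|x0] := ltP x 0.
    rewrite h0 ?(ltW x0)//; apply: (@near_eq_is_derive R R R (fun=> 0)).
      near=> t; rewrite P0// ltW//; near: t; exact: lt_nbhsl.
  have [||||dP P'] := @continuous_FTC1_closed R h (-1) x (x + 1).
  - by rewrite ltrDl.
  - apply: continuous_compact_integrable; first exact: segment_compact.
    by apply: continuous_subspaceT; exact: smooth_line_continuous.
  - by rewrite (lt_le_trans _ x0)// ltrN10.
  - exact: smooth_line_continuous.
  - by apply: DeriveDef => //; rewrite -derive1E.
by exists P; split => // k; case: k => // k; exists h.
Unshelve. all: end_near. Qed.

(* [rho] is a smooth approximation of [max 0] and [sigma] its derivative. *)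
Lemma smooth_ramp : exists rho sigma : R -> R,
  [/\ smooth_line rho, smooth_line sigma, forall x : R, is_derive x 1 rho (sigma x) &
   [/\ forall x, x <= 0 -> rho x = 0, forall x, x <= 0 -> sigma x = 0,
       forall x, 1 <= x -> sigma x = 1 & forall x y, x <= y -> sigma x <= sigma y]].
Proof.
pose e := exp_inv 1; have se : smooth_line e by exact: smooth_exp_inv.
have e_gt0 x : 0 < x -> 0 < e x.
  by move=> x0; rewrite /e /exp_inv x0 hornerE mul1r expR_gt0.
have e0 x : x <= 0 -> e x = 0 by move=> x0; rewrite /e /exp_inv ltNge x0.
have e_ge0 x : 0 <= e x by have [/e0->//|/e_gt0/ltW] := leP x 0.
(* [b] is a bump carried by [[0, 1]]; its normalized primitive is the step [sigma], and a primitive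
   of that is the ramp [rho]. *)
pose b x := e x * e (-1 * x + 1).
have sb : smooth_line b by apply: smooth_lineM => //; exact: smooth_line_affine.
have [|S [sS dS S0]] := smooth_line_primitive sb.
  by move=> x x0; rewrite /b e0// mul0r.
have b_ge0 x : 0 <= b x by rewrite mulr_ge0.
have mvt x y : x < y -> exists2 z, x < z < y & S y - S x = b z * (y - x).
  move=> xy; have [|z] := @MVT R S b x y xy (fun z _ => dS z).
    by apply: continuous_subspaceT; exact: smooth_line_continuous.
  by rewrite in_itv/=; exists z.
have S_le x y : x <= y -> S x <= S y.
  rewrite le_eqVlt => /predU1P[->//|xy]; have [z _ E] := mvt _ _ xy.
  by rewrite -subr_ge0 E mulr_ge0// subr_ge0 ltW.
have S1 : 0 < S 1.
  have [z /andP[z0 z1]] := mvt 0 1 ltr01; rewrite (S0 0)// !subr0 mulr1 => ->.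
  by rewrite mulr_gt0// e_gt0// mulN1r addrC subr_gt0.
pose s x := (S 1)^-1 * S x.
have ss : smooth_line s.
  by apply: smooth_lineM => //; exact: smooth_line_cst.
have [|P [sP dP P0]] := smooth_line_primitive ss.
  by move=> x x0; rewrite /s (S0 x x0) mulr0.
exists P, s; split => //; split => //.
- by move=> x x0; rewrite /s (S0 x x0) mulr0.
- move=> x x1; suff -> : s x = s 1 by rewrite /s mulVf// gt_eqF.
  rewrite /s; congr (_ * _); move: x1; rewrite le_eqVlt => /predU1P[->//|x1].
  have [z /andP[z1 _] E] := mvt _ _ x1; apply/eqP; rewrite -subr_eq0 E.
  by rewrite /b [e (-1 * z + 1)]e0 ?mulr0 ?mul0r// mulN1r addrC subr_le0 ltW.
- by move=> x y xy; rewrite /s ler_wpM2l ?invr_ge0 ?(ltW S1)// S_le.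
Qed.
End smooth_functions_on_the_line.

Section product_test_functions.
Context {R : realType} {n : nat}.
Local Notation V := 'rV[R]_n.
Implicit Types (psi : 'I_n -> R -> R) (x : V).

Definition prod_fun psi (x : V) : R := \prod_i psi i (x ord0 i).

Definition fun_upd psi (j : 'I_n) (h : R -> R) : 'I_n -> R -> R :=
  fun i => if i == j then h else psi i.

Lemma prod_fun_upd psi j h x :
  prod_fun (fun_upd psi j h) x = h (x ord0 j) * \prod_(i | i != j) psi i (x ord0 i).
Proof.
rewrite /prod_fun (bigD1 j)//= /fun_upd eqxx; congr (_ * _).
by apply: eq_bigr => i /negbTE ->.
Qed.

Lemma differentiable_prod_fun psi x : (forall i, smooth_line (psi i)) ->
  differentiable (prod_fun psi) x.
Proof.
move=> spsi; rewrite /prod_fun; elim: (index_enum _) => [|i r ih].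
  rewrite (_ : (fun x0 => _) = cst 1); first exact: differentiable_cst.
  by apply/funext => y; rewrite big_nil.
rewrite (_ : (fun x0 => _) = ((fun y : V => psi i (y ord0 i)) *
    (fun y : V => \prod_(i <- r) psi i (y ord0 i)))); last first.
  by apply/funext => y; rewrite big_cons.
apply: differentiableM => //.
apply: (@differentiable_comp _ _ _ _ (fun y : V => y ord0 i) (psi i)).
  exact: differentiable_coord.
have [h' dh _] := spsi i 1%N.
by apply/derivable1_diffP; exact: ex_derive.
Qed.

Lemma derive_prod_fun psi j h x : (forall y : R, is_derive y 1 (psi j) (h y)) ->
  'D_(basis_vec j) (prod_fun psi) x = prod_fun (fun_upd psi j h) x.
Proof.
move=> dh; have [cv E] := dh (x ord0 j).
apply: cvg_lim; first exact: norm_hausdorff.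
rewrite prod_fun_upd mulrC -E.
set C := \prod_(i | _) _.
have CM : C * (t^-1 *: ((psi j \o shift (x ord0 j)) (t *: 1) - psi j (x ord0 j)))
    @[t --> 0^'] --> C * 'D_1 (psi j) (x ord0 j).
  by apply: cvgM; [exact: cvg_cst|exact: cv].
apply: cvg_trans CM; apply: near_eq_cvg; near=> t.
have E1 y : prod_fun psi y = psi j (y ord0 j) * \prod_(i | i != j) psi i (y ord0 i).
  by rewrite /prod_fun (bigD1 j).
rewrite /= !E1 [X in _ *: (_ * X - _)](eq_bigr (fun i => psi i (x ord0 i))).
  by rewrite -/C -mulrBl !mxE !eqxx /= /GRing.scale/= !mulr1 [LHS]mulrC mulrA.
by move=> i ij; rewrite !mxE eqxx/= (negbTE ij) mulr0 add0r.
Unshelve. all: end_near. Qed.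

(** A partial derivative only replaces one factor by its derivative, so products of functions of one
    coordinate are stable under iterated derivatives in any order. *)
Lemma smooth_prod_fun psi : (forall i, smooth_line (psi i)) -> smooth (prod_fun psi).
Proof.
move=> spsi s; suff [psi' spsi' ->] : exists2 psi', (forall i, smooth_line (psi' i)) &
    foldr (fun j h => 'D_(basis_vec j) h) (prod_fun psi) s = prod_fun psi'.
  by move=> x; exact: differentiable_prod_fun.
elim: s => [|j s [psi' spsi' E]]; first by exists psi.
have [h dh _] := spsi' j 1%N.
exists (fun_upd psi' j h) => /=.
  move=> i; rewrite /fun_upd; case: eqP => // _.
  exact: (smooth_line_derive (spsi' j)).
by rewrite E; apply/funext => x; exact: derive_prod_fun.
Qed.
End product_test_functions.

(** * Boxes and the integral form of weak derivatives *)

Section boxes.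
Context {R : realType} {n : nat}.
Local Notation V := 'rV[R]_n.
Local Notation mu := (@lebesgue_measure_rV R n).
Implicit Types (a b : V).

Definition open_box a b : set V := [set x | forall i, a ord0 i < x ord0 i < b ord0 i].

(* Half-open boxes, which are partitioned by their dyadic subdivisions. *)
Definition cell a b : set V := [set x | forall i, a ord0 i < x ord0 i <= b ord0 i].

Definition row_upd a (j : 'I_n) (t : R) : V := \row_i (if i == j then t else a ord0 i).

Lemma measurable_coord_itv (i : 'I_n) (I : interval R) :
  measurable [set x : V | x ord0 i \in I].
Proof.
rewrite -[X in measurable X]setTI.
exact: (@measurable_rV_coord R n i measurableT [set` I] (measurable_itv I)).
Qed.

Lemma measurable_forall_coord (P : 'I_n -> set V) :
  (forall i, measurable (P i)) -> measurable [set x | forall i, P i x].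
Proof.
move=> mP; rewrite (_ : mkset _ = \big[setI/setT]_(i < n) P i).
  exact: bigsetI_measurable.
rewrite -bigcap_seq; apply/seteqP; split => x /= Px i; first by move=> _; exact: Px.
by apply: Px; rewrite /= mem_index_enum.
Qed.

Lemma measurable_cell a b : measurable (cell a b).
Proof.
apply: measurable_forall_coord => i.
rewrite [X in measurable X](_ : _ = [set x : V | x ord0 i \in `]a ord0 i, b ord0 i]]).
  exact: measurable_coord_itv.
by apply/seteqP; split => x /=; rewrite in_itv.
Qed.

Lemma measurable_open_box a b : measurable (open_box a b).
Proof.
apply: measurable_forall_coord => i.
rewrite [X in measurable X](_ : _ = [set x : V | x ord0 i \in `]a ord0 i, b ord0 i[]).
  exact: measurable_coord_itv.
by apply/seteqP; split => x /=; rewrite in_itv.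
Qed.

Lemma cell_sub_box a b : cell a b `<=` rV_box a b.
Proof. by move=> x xab i; rewrite in_itv/=; case/andP: (xab i) => /ltW -> ->. Qed.

Lemma open_box_sub_cell a b : open_box a b `<=` cell a b.
Proof. by move=> x xab i; case/andP: (xab i) => -> /ltW ->. Qed.

Lemma rV_box_face_eq0 a b j t : (forall i, a ord0 i <= b ord0 i) ->
  mu (rV_box (row_upd a j t) (row_upd b j t)) = 0.
Proof.
move=> ab; rewrite lebesgue_measure_rV_box.
  by rewrite (bigD1 j)//= !mxE eqxx subrr mul0r.
by move=> i; rewrite !mxE; case: eqP.
Qed.

Lemma rV_box_negligible_boundary a b : (forall i, a ord0 i <= b ord0 i) ->
  mu (rV_box a b `\` open_box a b) = 0.
Proof.
move=> ab; pose F i t := rV_box (row_upd a i t) (row_upd b i t).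
have mF i t : measurable (F i t) by exact: measurable_rV_box.
apply/eqP; rewrite eq_le measure_ge0 andbT.
apply: (@le_trans _ _ (mu (\big[setU/set0]_(i < n) (F i (a ord0 i) `|` F i (b ord0 i))))).
  apply: le_measure; rewrite ?inE.
  - by apply: measurableD; [exact: measurable_rV_box|exact: measurable_open_box].
  - by apply: bigsetU_measurable => i _; apply: measurableU.
  - move=> x [xab nx]; apply: contrapT => nF; apply: nx => i.
    have := xab i; rewrite in_itv/= !le_eqVlt => /andP[/predU1P[ax|->]].
      case: nF; rewrite -bigcup_seq; exists i; rewrite /= ?mem_index_enum//.
      left=> k; rewrite !mxE; case: eqP => [->|_]; last exact: xab.
      by rewrite -ax in_itv/= lexx.
    move=> /predU1P[xb|->//].
    case: nF; rewrite -bigcup_seq; exists i; rewrite /= ?mem_index_enum//.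
    right=> k; rewrite !mxE; case: eqP => [->|_]; last exact: xab.
    by rewrite xb in_itv/= lexx.
suff [_ ->] : measurable (\big[setU/set0]_(i < n) (F i (a ord0 i) `|` F i (b ord0 i))) /\
    mu (\big[setU/set0]_(i < n) (F i (a ord0 i) `|` F i (b ord0 i))) = 0 by [].
elim/big_ind : _ => [|A B [mA A0] [mB B0]|i _]; first by rewrite measure0.
  by split; [exact: measurableU|exact: null_set_setU].
split; first exact: measurableU.
by apply: null_set_setU => //; exact: rV_box_face_eq0.
Qed.

(** Open, half-open and closed boxes differ by null faces. They are interchanged below: closed ones
    for compactness, half-open ones for partitions, open ones as limits of cut-offs. *)
Lemma measure_eq_box a b (A : set V) : (forall i, a ord0 i <= b ord0 i) ->
  measurable A -> open_box a b `<=` A -> A `<=` rV_box a b ->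
  mu (rV_box a b `\` A) = 0 /\ mu A = mu (rV_box a b).
Proof.
move=> ab mA oA Ac; have mB := measurable_rV_box a b.
have mO := measurable_open_box a b.
have N0 : mu (rV_box a b `\` A) = 0.
  apply/eqP; rewrite eq_le measure_ge0 andbT -(rV_box_negligible_boundary ab).
  apply: le_measure; rewrite ?inE; [exact: measurableD|exact: measurableD|].
  by move=> x [xB nA]; split => // /oA.
split=> //; rewrite -[in RHS](setDUK Ac) measureU//; last by rewrite setDIK.
  by rewrite [X in (_ + X)%E](_ : _ = 0%E) ?adde0.
exact: measurableD.
Qed.

Lemma measure_cell a b : (forall i, a ord0 i <= b ord0 i) ->
  mu (cell a b) = (\prod_i (b ord0 i - a ord0 i))%:E.
Proof.
move=> ab; rewrite -lebesgue_measure_rV_box//.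
by apply: (measure_eq_box ab (measurable_cell a b) _ _).2;
  [exact: open_box_sub_cell|exact: cell_sub_box].
Qed.

Lemma Rintegral_eq_box a b (A : set V) (h : V -> R) : (forall i, a ord0 i <= b ord0 i) ->
  measurable A -> open_box a b `<=` A -> A `<=` rV_box a b ->
  mu.-integrable (rV_box a b) (EFin \o h) ->
  (\int[mu]_(x in rV_box a b) h x)%R = (\int[mu]_(x in A) h x)%R.
Proof.
move=> ab mA oA Ac ih; have [N0 _] := measure_eq_box ab mA oA Ac.
have mB := measurable_rV_box a b.
rewrite /Rintegral (negligible_integral (measurableD mB mA) mB ih N0).
by rewrite setDD setIidr.
Qed.
End boxes.

Section translated_boxes.
Context {R : realType} {n : nat}.
Local Notation V := 'rV[R]_n.
Local Notation mu := (@lebesgue_measure_rV R n).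
Implicit Types (a b : V) (U : set V) (u w : V -> R).

(** The primitives [P] are kept because a test function is built from a difference of two translates
    of [P], whose derivative is the difference of two cut-offs. *)
Lemma interval_cutoff (a b : R) : a < b -> exists chi P : nat -> R -> R,
  [/\ forall m, smooth_line (chi m), forall m, smooth_line (P m),
      forall m (x : R), is_derive x 1 (P m) (chi m x) &
   [/\ forall m x, 0 <= chi m x <= 1, forall m x, x <= a \/ b <= x -> chi m x = 0 &
       forall x, a < x < b -> exists N, forall m, (N <= m)%N -> chi m x = 1]].
Proof.
move=> ab; have [rho [sigma [srho ssigma drho [rho0 sigma0 sigma1 sigma_le]]]] := @smooth_ramp R.
have sigma01 x : 0 <= sigma x <= 1.
  apply/andP; split; first by have [/sigma0->//|/ltW/sigma_le] := leP x 0; rewrite sigma0.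
  by have [/sigma1->//|/ltW/sigma_le] := leP 1 x; rewrite (sigma1 1).
have ba : 0 < b - a by rewrite subr_gt0.
(* The transition layers of a cut-off have width [1 / M m]; [M0] makes each of them fit into the
   interval. *)
pose M0 := (Num.truncn (b - a)^-1).+1.
pose M m : R := (m + M0)%:R.
have M_gt0 m : 0 < M m by rewrite ltr0n addnS.
have M_ge m : 1 <= M m * (b - a).
  rewrite -ler_pdivrMr// div1r; apply: le_trans (ltW (truncnS_gt _)) _.
  by rewrite ler_nat leq_addl.
pose chi m x := sigma (M m * x + (- (M m * a))) + -1 * sigma (M m * x + (1 - M m * b)).
pose P m x := (M m)^-1 * (rho (M m * x + (- (M m * a))) + -1 * rho (M m * x + (1 - M m * b))).
have chi_smooth m : smooth_line (chi m).
  apply: smooth_lineD; first exact: smooth_line_affine.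
  by apply: smooth_lineM; [exact: smooth_line_cst|exact: smooth_line_affine].
exists chi, P; split => //.
- move=> m; apply: smooth_lineM; first exact: smooth_line_cst.
  apply: smooth_lineD; first exact: smooth_line_affine.
  by apply: smooth_lineM; [exact: smooth_line_cst|exact: smooth_line_affine].
- move=> m x; have -> : chi m x = (M m)^-1 *
      (M m * sigma (M m * x + (- (M m * a))) + -1 * (M m * sigma (M m * x + (1 - M m * b)))).
    by rewrite [-1 * (_ * _)]mulrCA -mulrDr mulKf ?gt_eqF.
  exact: (is_derive_fun_scale _ (is_derive_fun_add (is_derive_affine (drho _))
    (is_derive_fun_scale _ (is_derive_affine (drho _))))).
split.
- move=> m x; rewrite /chi mulN1r; apply/andP; split.
    rewrite subr_ge0; apply: sigma_le; have := M_ge m; lra.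
  have /andP[_ s1] := sigma01 (M m * x + (- (M m * a))).
  by have /andP[s0 _] := sigma01 (M m * x + (1 - M m * b)); lra.
- move=> m x [xa|bx]; rewrite /chi.
    rewrite !sigma0 ?mulr0 ?addr0//.
      have h : M m * x <= M m * a by rewrite ler_pM2l.
      by have := M_ge m; lra.
    by rewrite -mulrBr pmulr_rle0// subr_le0.
  have h : M m * b <= M m * x by rewrite ler_pM2l.
  by rewrite !sigma1 ?mulr1 ?subrr//; have := M_ge m; lra.
- move=> x /andP[ax xb].
  have xa0 : 0 < x - a by rewrite subr_gt0.
  have bx0 : 0 < b - x by rewrite subr_gt0.
  exists (maxn (Num.truncn (x - a)^-1).+1 (Num.truncn (b - x)^-1).+1) => m.
  rewrite geq_max => /andP[m1 m2]; rewrite /chi.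
  have h1 : 1 <= M m * (x - a).
    rewrite -ler_pdivrMr// div1r; apply: le_trans (ltW (truncnS_gt _)) _.
    by rewrite ler_nat (leq_trans m1)// leq_addr.
  have h2 : 1 <= M m * (b - x).
    rewrite -ler_pdivrMr// div1r; apply: le_trans (ltW (truncnS_gt _)) _.
    by rewrite ler_nat (leq_trans m2)// leq_addr.
  by rewrite sigma1 ?sigma0 ?mulr0 ?addr0//; lra.
Qed.

Lemma continuous_measurable_rV (h : V -> R) : continuous h -> measurable_fun setT h.
Proof.
move=> ch; apply: (measurability _ (RGenOpens.measurableE R)) => //.
move=> _ [_ [c [d ->] <-]]; rewrite setTI; apply: open_measurable_rV.
by apply: open_comp => [x _|]; [exact: ch|exact: interval_open].
Qed.

Lemma compact_rV_box a b : compact (rV_box a b).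
Proof.
apply: (@rV_compact _ _ (fun i => `[a ord0 i, b ord0 i]%classic)) => i.
exact: segment_compact.
Qed.

Lemma compact_integrable U u (K : set V) : measurable U -> locally_integrable_on U u ->
  compact K -> measurable K -> K `<=` U -> mu.-integrable K (EFin \o u).
Proof.
move=> mU [mu_ lu] cK mK KU; apply/integrableP; split; last exact: lu.
by apply/measurable_EFinP; exact: measurable_funS mu_.
Qed.

Lemma Rintegral_support (A B : set V) (h : V -> R) : B `<=` A ->
  (forall x, A x -> ~ B x -> h x = 0) ->
  (\int[mu]_(x in A) h x)%R = (\int[mu]_(x in B) h x)%R.
Proof.
move=> BA h0; rewrite Rintegral_mkcond [RHS]Rintegral_mkcond; congr Rintegral.
apply/funext => x; rewrite /patch.
have [Bx|nBx] := pselect (B x); first by rewrite !mem_set//; exact: BA.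
rewrite (memNset nBx); have [Ax|nAx] := pselect (A x); last by rewrite memNset.
by rewrite mem_set// h0.
Qed.

Lemma Rintegral_cvg (D : set V) (h_ : nat -> V -> R) (h g : V -> R) : measurable D ->
  (forall m, measurable_fun D (h_ m)) ->
  (forall x, D x -> exists N, forall m, (N <= m)%N -> h_ m x = h x) ->
  mu.-integrable D (EFin \o g) -> (forall m x, D x -> `|h_ m x| <= g x) ->
  measurable_fun D h ->
  forall e : R, 0 < e -> exists N, forall m, (N <= m)%N ->
    `|(\int[mu]_(x in D) h x)%R - (\int[mu]_(x in D) h_ m x)%R| < e.
Proof.
move=> mD mh_ hN ig hg mh e e0.
have hcv x : D x -> (EFin \o h_ m) x @[m --> \oo] --> (EFin \o h) x.
  move=> Dx; have [N HN] := hN x Dx; apply: cvg_near_cst.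
  by exists N => // m /= Nm; rewrite HN.
have [|||||ih _ cv] := @dominated_convergence _ _ _ mu D mD
  (fun m => EFin \o h_ m) (EFin \o h) (EFin \o g).
- by move=> m; exact/measurable_EFinP.
- exact/measurable_EFinP.
- by apply: aeW => x; exact: hcv.
- by [].
- by apply: aeW => x m Dx /=; rewrite lee_fin hg.
move: cv; rewrite -(fineK (integrable_fin_num mD ih)) => /fine_cvg/cvgrPdist_lt/(_ _ e0).
by move=> [N _ HN]; exists N => m Nm; exact: HN.
Qed.

Lemma integrable_EFinB (D : set V) (h g : V -> R) : measurable D ->
  mu.-integrable D (EFin \o h) -> mu.-integrable D (EFin \o g) ->
  mu.-integrable D (EFin \o (fun x => h x - g x)).
Proof.
move=> mD ih ig; apply: (@eq_integrable _ _ _ mu D mD ((EFin \o h) \- (EFin \o g))%E) => //.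
exact: integrableB.
Qed.

Lemma real_seq_cluster (k : nat -> R) (M : R) : (forall m, `|k m| <= M) ->
  exists2 l : R, `|l| <= M & forall (e : R) N, 0 < e -> exists2 m, (N <= m)%N & `|l - k m| < e.
Proof.
move=> kM; have M0 : 0 <= M := le_trans (normr_ge0 _) (kM 0%N).
have [|x xM xk] := @compact_seq_cluster R 1 _ (fun m => const_mx (k m)) (@compact_ballP R 1 M).
  by move=> m; apply: rV_norm_le => // i; rewrite mxE.
exists (x ord0 ord0); first by apply: le_trans xM; exact: rV_coord_le.
move=> e N e0; have [m Nm xm] := xk e N e0; exists m => //.
by apply: le_lt_trans xm; have := rV_coord_le (x - const_mx (k m)) ord0; rewrite !mxE.
Qed.

Lemma indic_open_box a b (x : V) :
  \1_(open_box a b) x = \prod_i (a ord0 i < x ord0 i < b ord0 i)%R%:R :> R.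
Proof.
rewrite indicE; have [xo|xo] := pselect (open_box a b x).
  by rewrite mem_set// big1// => i _; rewrite xo.
rewrite memNset//; apply/esym/eqP/prodf_eq0.
have [i nxi] : exists i, ~ (a ord0 i < x ord0 i < b ord0 i).
  by apply: contrapT => h; apply: xo => i; apply: contrapT => hi; apply: h; exists i.
by exists i => //; move/negP/negbTE : nxi => ->.
Qed.

(* Test the weak derivative against smooth approximations of the indicator of
   the box, averaged over the translations by [s * e_j], [0 <= s <= t]; [kappa]
   is the integral of the limit weight, whose exact value is irrelevant. *)
Lemma weak_partial_translated_box (j : 'I_n) a b (t : R) :
  (forall i, a ord0 i < b ord0 i) -> 0 < t ->
  let e := t *: basis_vec j in let H := rV_box a (b + e) in
  exists2 kappa : R, `|kappa| <= t * fine (mu H) &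
  forall U u w (c : R), measurable U -> weak_partial U j u w -> H `<=` U ->
  `|(\int[mu]_(x in open_box (a + e) (b + e)) u x)%R -
    (\int[mu]_(x in open_box a b) u x)%R - c * kappa| <=
   t * (\int[mu]_(x in H) `|w x - c|)%R.
Proof.
move=> ab t0 e H.
have /choice[chi /choice[P chiP]] : forall i, exists chi, exists P : nat -> R -> R,
  [/\ forall m, smooth_line (chi m), forall m, smooth_line (P m),
      forall m (x : R), is_derive x 1 (P m) (chi m x) &
   [/\ forall m x, 0 <= chi m x <= 1,
       forall m x, x <= a ord0 i \/ b ord0 i <= x -> chi m x = 0 &
       forall x, a ord0 i < x < b ord0 i -> exists N, forall m, (N <= m)%N -> chi m x = 1]].
  by move=> i; exact: interval_cutoff.
(* The integral of the cut-off over [[s - t, s]]. Its derivative is the cut-off minus its translate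
   by [t], so the integrals of [u] against it tend to the integral over the box minus that over the
   translated box. *)
pose th m (s : R) := P j m s + -1 * P j m (1 * s + - t).
pose dth m (s : R) := chi j m s + -1 * (1 * chi j m (1 * s + - t)).
pose psi m i := if i == j then th m else chi i m.
pose phi m := prod_fun (psi m).
pose dphi m := prod_fun (fun_upd (psi m) j (dth m)).
have [_ sPj dPj [chij01 chij0 chij1]] := chiP j.
have eE i : e ord0 i = if i == j then t else 0.
  by rewrite /e !mxE eqxx/=; case: eqP; rewrite ?mulr1 ?mulr0.
have spsi m i : smooth_line (psi m i).
  rewrite /psi; case: eqP => _; last by have [] := chiP i.
  apply: smooth_lineD => //; apply: smooth_lineM; first exact: smooth_line_cst.
  exact: smooth_line_affine.
have dth_ m (s : R) : is_derive s 1 (th m) (dth m s).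
  exact: (is_derive_fun_add (dPj _ _) (is_derive_fun_scale _ (is_derive_affine (dPj _ _)))).
have dphiE m : 'D_(basis_vec j) (phi m) = dphi m.
  apply/funext => x; apply: derive_prod_fun => y.
  by rewrite /psi eqxx; exact: dth_.
have th_bd m s : 0 <= th m s <= t /\ (s <= a ord0 j \/ b ord0 j + t <= s -> th m s = 0).
  have ts : s - t <= s by rewrite gerBl ltW.
  have [|z] := @MVT_segment R (P j m) (chi j m) (s - t) s ts (fun z _ => dPj m z).
    by apply: continuous_subspaceT; exact: smooth_line_continuous.
  rewrite in_itv/= => /andP[z1 z2]; rewrite (_ : s - (s - t) = t); last by ring.
  move=> E.
  have thE : th m s = chi j m z * t by rewrite -E /th mulN1r mul1r.
  split.
    have /andP[c0 c1] := chij01 m z; rewrite thE mulr_ge0// ?(ltW t0)//=.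
    by rewrite ger_pMl.
  move=> h; rewrite thE chij0 ?mul0r//; case: h => h.
    by left; exact: le_trans h.
  by right; rewrite -lerBrDr in h; exact: le_trans z1.
have mH : measurable H by exact: measurable_rV_box.
have psi_out m x : ~ H x -> phi m x = 0.
  move=> nHx; apply/eqP/prodf_eq0.
  have [i nHi] : exists i, ~~ (x ord0 i \in `[a ord0 i, (b + e) ord0 i]).
    apply: contrapT => h; apply: nHx => i; apply: contrapT => /negP hi.
    by apply: h; exists i.
  exists i => //; move: nHi; rewrite in_itv/= mxE eE negb_and -!ltNge /psi.
  case: eqP => [->|_].
    move=> h; have [_ ->//] := th_bd m (x ord0 j).
    by case/orP : h => /ltW; [left|right].
  rewrite addr0; have [_ _ _ [_ c0 _]] := chiP i => h; rewrite c0//.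
  by case/orP : h => /ltW; [left|right].
have dpsi_out m x : ~ H x -> dphi m x = 0.
  move=> nHx; rewrite -dphiE.
  have oH : open (~` H).
    rewrite openC; apply: compact_closed; [exact: norm_hausdorff|exact: compact_rV_box].
  rewrite (@near_eq_derive _ _ _ _ (cst 0)); first by rewrite derive_cst.
  have /openP_dist/(_ _ nHx)[d d0 xd] := oH.
  apply/nbhs_ballP; exists d => //= y; rewrite mx_norm_ball => /xd.
  exact: psi_out.
have testphi m U : H `<=` U -> test_function U (phi m).
  move=> HU.
  have sH : Defs.support (phi m) `<=` H.
    rewrite /Defs.support; have cH : closed H.
      by apply: compact_closed; [exact: norm_hausdorff|exact: compact_rV_box].
    rewrite [X in _ `<=` X]((closure_id H).1 cH); apply: closureS => x /= /eqP phix.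
    by apply: contrapT => /(psi_out m).
  split; [exact: smooth_prod_fun| |exact: subset_trans HU].
  by apply: subclosed_compact (@compact_rV_box _ _) sH; exact: closed_closure.
have mphi m : measurable_fun setT (phi m).
  apply: continuous_measurable_rV => x.
  by apply: differentiable_continuous; exact: differentiable_prod_fun.
have sdth m : forall i, smooth_line (fun_upd (psi m) j (dth m) i).
  move=> i; rewrite /fun_upd; case: eqP => // _.
  by apply: (@smooth_line_derive _ (th m)) => //; have := spsi m j; rewrite /psi eqxx.
have mdphi m : measurable_fun setT (dphi m).
  apply: continuous_measurable_rV => x.
  by apply: differentiable_continuous; exact: differentiable_prod_fun.
have phi_bd m x : `|phi m x| <= t.
  rewrite /phi /prod_fun (bigD1 j)//= normrM -[leRHS]mulr1.
  apply: ler_pM => //.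
    rewrite /psi eqxx; have [/andP[h0 h1] _] := th_bd m (x ord0 j).
    by rewrite ger0_norm.
  rewrite normr_prod; apply: prodr_ile1 => i ij; rewrite normr_ge0/= ?/fun_upd /psi (negbTE ij).
  by have [_ _ _ [/(_ m (x ord0 i))/andP[h0 h1] _ _]] := chiP i; rewrite ger0_norm.
have dphi_bd m x : `|dphi m x| <= 1.
  rewrite /dphi prod_fun_upd normrM -[leRHS]mulr1; apply: ler_pM => //.
    rewrite /dth mulN1r mul1r ler_norml.
    have /andP[A1 A2] := chij01 m (x ord0 j).
    have /andP[B1 B2] := chij01 m (1 * x ord0 j - t).
    by apply/andP; split; lra.
  rewrite normr_prod; apply: prodr_ile1 => i ij; rewrite normr_ge0/= ?/fun_upd /psi (negbTE ij).
  by have [_ _ _ [/(_ m (x ord0 i))/andP[h0 h1] _ _]] := chiP i; rewrite ger0_norm.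
pose kap m := (\int[mu]_(x in H) phi m x)%R.
have muH : (mu H < +oo)%E.
  rewrite /H lebesgue_measure_rV_box ?ltry// => i; rewrite mxE eE.
  by case: eqP => _; rewrite ?addr0 ?ltW// (lt_trans (ab i))// ltrDl.
have iH (h : V -> R) (M : R) : measurable_fun setT h -> (forall x, `|h x| <= M) ->
    mu.-integrable H (EFin \o h).
  move=> mh hM; apply: measurable_bounded_integrable => //.
  - exact: measurable_funTS.
  - by exists M; split; [exact: num_real|move=> N MN x _ /=; exact: le_trans (ltW MN)].
have kap_bd m : `|kap m| <= t * fine (mu H).
  apply: le_trans (le_normr_Rintegral mH (iH _ _ (mphi m) (phi_bd m))) _.
  rewrite -Rintegral_cst//; apply: le_Rintegral => //.
  - apply: (iH _ t); first by apply: measurableT_comp.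
    by move=> x; rewrite normr_id.
  - by apply: (iH _ t) => // x; rewrite gtr0_norm.
(* A cluster value suffices, since the integrals with [u] converge along the whole sequence. It is
   chosen before [u], [w] and [c], hence common to all of them. *)
have [kappa kle kclus] := real_seq_cluster kap_bd.
exists kappa => // U u w c mU [lu lw weak] HU.
have iu := compact_integrable mU lu (@compact_rV_box _ _) mH HU.
have iw := compact_integrable mU lw (@compact_rV_box _ _) mH HU.
have ic : mu.-integrable H (EFin \o cst c) by apply: (iH _ `|c|).
have iM (v h : V -> R) (M : R) : mu.-integrable H (EFin \o v) -> measurable_fun setT h ->
    (forall x, `|h x| <= M) -> mu.-integrable H (EFin \o (fun x => v x * h x)).
  move=> iv mh hM; apply: (@integrableMl _ _ _ mu H mH (EFin \o v) h) => //.
    exact: measurable_funTS.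
  by exists M; split; [exact: num_real|move=> N MN x _ /=; exact: le_trans (ltW MN)].
pose A m := (\int[mu]_(x in H) (u x * dphi m x))%R.
(* The weak derivative turns the left-hand side into the integral of [(w - c) * phi m], and [phi m]
   is at most [t]. *)
have key m : `|- A m - c * kap m| <= t * (\int[mu]_(x in H) `|w x - c|)%R.
  have E1 : - A m = (\int[mu]_(x in H) (w x * phi m x))%R.
    have := weak _ (testphi m U HU).
    rewrite (@eq_Rintegral _ _ _ mu U (fun x => u x * dphi m x)); last first.
      by move=> x _; rewrite -dphiE.
    rewrite (Rintegral_support HU); last by move=> x _ /dpsi_out ->; rewrite mulr0.
    rewrite (@Rintegral_support U _ _ HU); last by move=> x _ /psi_out ->; rewrite mulr0.
    by rewrite /A => ->; rewrite opprK.
  have E2 : c * kap m = (\int[mu]_(x in H) (c * phi m x))%R.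
    by rewrite /kap RintegralZl//; exact: (iH _ t).
  have iwp : mu.-integrable H (EFin \o (fun x => w x * phi m x)) by apply: (iM _ _ t).
  have icp : mu.-integrable H (EFin \o (fun x => c * phi m x)).
    by apply: (iM (cst c) _ t).
  have iwc : mu.-integrable H (EFin \o (fun x => w x - c)).
    exact: integrable_EFinB.
  rewrite E1 E2 -RintegralB//.
  have iwcp : mu.-integrable H (EFin \o (fun x => w x * phi m x - c * phi m x)).
    exact: integrable_EFinB.
  apply: le_trans (le_normr_Rintegral mH iwcp) _.
  have iwcn : mu.-integrable H (EFin \o (fun x => `|w x - c|)) by exact: integrable_norm.
  rewrite -RintegralZl//; apply: le_Rintegral => //.
  - exact: integrable_norm.
  - exact: (@integrableZl _ _ _ mu H mH t _ iwcn).
  - by move=> x _; rewrite -mulrBl normrM mulrC ler_wpM2r.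
pose ob1 : set V := open_box a b; pose ob2 : set V := open_box (a + e) (b + e).
have mob1 : measurable ob1 by exact: measurable_open_box.
have mob2 : measurable ob2 by exact: measurable_open_box.
pose lim x : R := u x * (\1_ob1 x - \1_ob2 x).
have ob1H : ob1 `<=` H.
  move=> x xo i; have /andP[x1 x2] := xo i; rewrite in_itv/= mxE eE (ltW x1)/=.
  by case: eqP => _; rewrite ?addr0 ltW// (lt_trans x2)// ltrDl.
have ob2H : ob2 `<=` H.
  move=> x xo i; have := xo i.
  rewrite in_itv/= [(a + e) _ _]mxE [(b + e) _ _]mxE eE => /andP[x1 x2].
  rewrite (ltW x2) andbT; apply: le_trans (ltW x1).
  by case: eqP => _; rewrite ?addr0// lerDl ltW.
have Alim : (\int[mu]_(x in H) lim x)%R =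
    (\int[mu]_(x in ob1) u x)%R - (\int[mu]_(x in ob2) u x)%R.
  have m1 : measurable_fun setT (\1_ob1 : V -> R) by exact: measurable_indic.
  have m2 : measurable_fun setT (\1_ob2 : V -> R) by exact: measurable_indic.
  have bd (o : set V) x : `|(\1_o x : R)| <= 1.
    by rewrite indicE; case: (x \in o); rewrite ?normr1 ?normr0.
  have R1 (o : set V) : o `<=` H -> (\int[mu]_(x in o) u x)%R =
      (\int[mu]_(x in H) (u x * \1_o x))%R.
    move=> oH; rewrite (@Rintegral_support H o).
    - by apply: eq_Rintegral => x xo; rewrite indicE xo mulr1.
    - exact: oH.
    - by move=> x _ nox; rewrite indicE memNset// mulr0.
  rewrite !R1// -RintegralB//; [|exact: (iM _ _ 1)|exact: (iM _ _ 1)].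
  by apply: eq_Rintegral => x _; rewrite /lim mulrBr.
rewrite -/ob1 -/ob2 -[X in `|X - _|]opprB -Alim.
apply/ler_addgt0Pr => ep ep0.
have ep20 : 0 < ep / 2 by rewrite divr_gt0.
have [|||||N HN] := @Rintegral_cvg H (fun m x => u x * dphi m x) lim (fun x => `|u x|) mH _ _ _ _ _ _ ep20.
- move=> m; apply: measurable_funM; last exact: measurable_funTS.
  by case/integrableP: iu => /measurable_EFinP.
- move=> x Hx.
  have dthN : exists N, forall m, (N <= m)%N -> fun_upd (psi m) j (dth m) j (x ord0 j) *
     \prod_(i | i != j) fun_upd (psi m) j (dth m) i (x ord0 i) = \1_ob1 x - \1_ob2 x.
    have ev i s : exists N, forall m, (N <= m)%N ->
        chi i m s = (a ord0 i < s < b ord0 i)%R%:R.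
      have [_ _ _ [_ c0 c1]] := chiP i.
      have [/c1//|ns] := boolP (a ord0 i < s < b ord0 i).
      exists 0%N => m _; apply: c0.
      by move: ns; rewrite negb_and -!leNgt => /orP.
    have /choice[N HN] := fun i => ev i (x ord0 i).
    have [N' HN'] := ev j (x ord0 j - t).
    exists (maxn N' (\max_i N i)) => m; rewrite geq_max => /andP[/HN' e' /bigmax_leqP mN].
    rewrite (eq_bigr (fun i => (a ord0 i < x ord0 i < b ord0 i)%R%:R)); last first.
      by move=> i ij; rewrite /fun_upd /psi (negbTE ij) HN// mN.
    rewrite /fun_upd eqxx /dth !mul1r mulN1r e' HN ?mN// mulrBl.
    rewrite /ob1 /ob2 !indic_open_box; congr (_ - _); first by rewrite [RHS](bigD1 j).
    rewrite [RHS](bigD1 j)//= !mxE eqxx/= eqxx mulr1 ltrBrDr ltrBlDr; congr (_ * _).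
    by apply: eq_bigr => i ij; rewrite !mxE eqxx (negbTE ij) mulr0 !addr0.
  have [N HN] := dthN; exists N => m /HN e1.
  by rewrite /lim -e1 /dphi /prod_fun (bigD1 j).
- exact: integrable_norm.
- by move=> m x Hx; rewrite normrM ler_piMr.
- apply: measurable_funM; first by case/integrableP: iu => /measurable_EFinP.
  by apply: measurable_funTS; apply: measurable_funB; exact: measurable_indic.
have c0 : 0 < ep / (2 * (`|c| + 1)) by rewrite divr_gt0// mulr_gt0// ltr_wpDl.
have [m Nm km] := kclus _ N c0.
have := HN m Nm; have := key m; rewrite -/(A m) => k1 k2.
have k3 : `|c * kappa - c * kap m| <= ep / 2.
  rewrite -mulrBr normrM; apply: le_trans (ler_wpM2l (normr_ge0 c) (ltW km)) _.
  have c1 : 0 < `|c| + 1 by rewrite ltr_wpDl.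
  rewrite [leLHS](_ : _ = (ep / 2) * (`|c| / (`|c| + 1))).
    by rewrite ler_piMr ?(ltW ep20)// ler_pdivrMr// mul1r lerDl.
  by rewrite invfM; ring.
move: k1 k2 k3; rewrite -/(A m) ltr_norml !ler_norml => /andP[? ?] /andP[? ?] /andP[? ?].
by apply/andP; split; lra.
Qed.
End translated_boxes.

(** * Averages over dyadic cells *)

Section dyadic_cells.
Context {R : realType} {n : nat}.
Local Notation V := 'rV[R]_n.
Local Notation mu := (@lebesgue_measure_rV R n).
Implicit Types (lev : 'I_n -> nat) (x y a b : V).

Definition mean (A : set V) (h : V -> R) : R :=
  (fine (mu A))^-1 * (\int[mu]_(x in A) h x)%R.

Lemma rV_box_lty a b : (forall i, a ord0 i <= b ord0 i) -> (mu (rV_box a b) < +oo)%E.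
Proof. by move=> ab; rewrite lebesgue_measure_rV_box ?ltry. Qed.

(** The upper half is the lower one translated by half a side, and the mean over either half differs
    from the mean over the cell by plus or minus half the difference of the means of the two
    halves. *)
Lemma weak_partial_half (j : 'I_n) a b : (forall i, a ord0 i < b ord0 i) ->
  exists2 kappa : bool -> R, (forall s, `|kappa s| <= b ord0 j - a ord0 j) &
  forall U u w (c : R), measurable U -> weak_partial U j u w -> rV_box a b `<=` U ->
  forall s : bool,
  `|mean (if s then cell a (row_upd b j ((a ord0 j + b ord0 j) / 2))
          else cell (row_upd a j ((a ord0 j + b ord0 j) / 2)) b) u
    - mean (cell a b) u - c * kappa s| <=
  (b ord0 j - a ord0 j) * mean (cell a b) (fun x => `|w x - c|).
Proof.
move=> ab; set m := (a ord0 j + b ord0 j) / 2.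
pose t := (b ord0 j - a ord0 j) / 2.
have abj := ab j.
have t0 : 0 < t by rewrite divr_gt0// subr_gt0.
pose b1 := row_upd b j m; pose a2 := row_upd a j m.
have amb : a ord0 j < m < b ord0 j by rewrite /m; apply/andP; split; lra.
have ab1 i : a ord0 i < b1 ord0 i.
  by rewrite mxE; case: eqP => // ->; case/andP: amb.
have a2b i : a2 ord0 i < b ord0 i.
  by rewrite mxE; case: eqP => // ->; case/andP: amb.
have [kap kapt kapP] := weak_partial_translated_box j ab1 t0.
have ae : a + t *: basis_vec j = a2.
  apply/rowP => i; rewrite !mxE eqxx/=; case: eqP => [->|_].
    by rewrite mulr1 /t /m; field.
  by rewrite mulr0 addr0.
have be : b1 + t *: basis_vec j = b.
  apply/rowP => i; rewrite !mxE eqxx/=; case: eqP => [->|_].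
    by rewrite mulr1 /t /m; field.
  by rewrite mulr0 addr0.
rewrite be ae in kapt kapP.
pose v : R := \prod_i (b ord0 i - a ord0 i).
have v0 : 0 < v by apply: prodr_gt0 => i _; rewrite subr_gt0.
have fv : fine (mu (cell a b)) = v.
  by rewrite measure_cell// => i; exact: ltW.
have fvb : fine (mu (rV_box a b)) = v.
  by rewrite lebesgue_measure_rV_box// => i; exact: ltW.
have half_prod (h : 'I_n -> R) : (forall i, i != j -> h i = b ord0 i - a ord0 i) ->
    h j = t -> \prod_i h i = v / 2.
  move=> hi hj; rewrite /v (bigD1 j)//= hj [in RHS](bigD1 j)//= /t mulrAC.
  by congr (_ / _); congr (_ * _); apply: eq_bigr => i ij; exact: hi.
have fv1 : fine (mu (cell a b1)) = v / 2.
  rewrite measure_cell/=; last by move=> i; exact: ltW.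
  apply: half_prod => [i ij|]; first by rewrite mxE (negbTE ij).
  by rewrite mxE eqxx /m /t; field.
have fv2 : fine (mu (cell a2 b)) = v / 2.
  rewrite measure_cell/=; last by move=> i; exact: ltW.
  apply: half_prod => [i ij|]; first by rewrite mxE (negbTE ij).
  by rewrite mxE eqxx /m /t; field.
exists (fun s => if s then - (kap / v) else kap / v).
  have kv : `|kap / v| <= b ord0 j - a ord0 j.
    rewrite normrM normfV (gtr0_norm v0) ler_pdivrMr//.
    apply: le_trans kapt _; rewrite fvb ler_pM2r// /t; lra.
  by case; rewrite ?normrN.
move=> U u w c mU wp HU s.
have {kapP} := kapP U u w c mU wp HU.
have [lu lw _] := wp.
have mB := measurable_rV_box a b.
have iu := compact_integrable mU lu (@compact_rV_box _ _ _ _) mB HU.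
have iw := compact_integrable mU lw (@compact_rV_box _ _ _ _) mB HU.
have mC := measurable_cell a b.
have mC1 := measurable_cell a b1.
have mC2 := measurable_cell a2 b.
have le_ i : a ord0 i <= b ord0 i by exact: ltW.
have sub1 : rV_box a b1 `<=` rV_box a b.
  move=> x xb i; have := xb i; rewrite !in_itv/= => /andP[-> h]/=; apply: le_trans h _.
  by rewrite mxE; case: eqP => // ->; apply/ltW; case/andP: amb.
have sub2 : rV_box a2 b `<=` rV_box a b.
  move=> x xb i; have := xb i; rewrite !in_itv/= => /andP[h ->]; rewrite andbT.
  apply: le_trans h; rewrite mxE.
  by case: eqP => // ->; apply/ltW; case/andP: amb.
have iu1 := integrableS mB (measurable_rV_box a b1) sub1 iu.
have iu2 := integrableS mB (measurable_rV_box a2 b) sub2 iu.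
have I2E : (\int[mu]_(x in open_box a2 b) u x)%R = (\int[mu]_(x in cell a2 b) u x)%R.
  rewrite -(@Rintegral_eq_box _ _ a2 b)//; last 3 first.
  - by move=> i; exact: ltW.
  - exact: measurable_open_box.
  - by move=> x /open_box_sub_cell/cell_sub_box.
  by apply: Rintegral_eq_box => //; [move=> i; exact: ltW|exact: open_box_sub_cell|exact: cell_sub_box].
have I1E : (\int[mu]_(x in open_box a b1) u x)%R = (\int[mu]_(x in cell a b1) u x)%R.
  rewrite -(@Rintegral_eq_box _ _ a b1)//; last 3 first.
  - by move=> i; exact: ltW.
  - exact: measurable_open_box.
  - by move=> x /open_box_sub_cell/cell_sub_box.
  by apply: Rintegral_eq_box => //; [move=> i; exact: ltW|exact: open_box_sub_cell|exact: cell_sub_box].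
have iwc : mu.-integrable (rV_box a b) (EFin \o (fun x => `|w x - c|)).
  apply: integrable_norm; apply: integrable_EFinB => //.
  apply: measurable_bounded_integrable => //.
    exact: rV_box_lty.
  by exists `|c|; split; [exact: num_real|move=> N MN x _ /=; exact: ltW].
have WE : (\int[mu]_(x in rV_box a b) `|w x - c|)%R = (\int[mu]_(x in cell a b) `|w x - c|)%R.
  by apply: Rintegral_eq_box => //; [exact: open_box_sub_cell|exact: cell_sub_box].
have cellU : cell a b = cell a b1 `|` cell a2 b.
  apply/seteqP; split => [x xab|x [xab|xab] i].
  - have [xm|xm] := leP (x ord0 j) m; [left|right] => i; rewrite mxE.
      by have := xab i; case: eqP => // -> /andP[-> _].
    by have := xab i; case: eqP => // -> /andP[_ ->]; rewrite xm.
  - have /andP[-> h] := xab i; apply: le_trans h _; rewrite mxE.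
    by case: eqP => // ->; apply/ltW; case/andP: amb.
  - have /andP[h ->] := xab i; rewrite andbT; apply: le_lt_trans h; rewrite mxE.
    by case: eqP => // ->; apply/ltW; case/andP: amb.
have IE : (\int[mu]_(x in cell a b) u x)%R =
    (\int[mu]_(x in cell a b1) u x)%R + (\int[mu]_(x in cell a2 b) u x)%R.
  rewrite cellU Rintegral_setU//.
    by rewrite -cellU; apply: integrableS iu => //; exact: cell_sub_box.
  rewrite disj_set2E; apply/eqP/seteqP; split => // x [/(_ j) + /(_ j)].
  by rewrite !mxE eqxx => /andP[_ x1] /andP[x2 _]; move: (lt_le_trans x2 x1); rewrite ltxx.
rewrite WE I1E I2E; set I1 := (\int[mu]_(x in cell a b1) u x)%R.
set I2 := (\int[mu]_(x in cell a2 b) u x)%R.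
set D := (\int[mu]_(x in cell a b) `|w x - c|)%R => key.
have D0 : 0 <= D by apply: Rintegral_ge0.
have tD : t * D / v <= (b ord0 j - a ord0 j) * mean (cell a b) (fun x => `|w x - c|).
  rewrite /mean fv -/D [_^-1 * _]mulrC mulrA ler_pM2r ?invr_gt0//.
  by rewrite ler_wpM2r// /t; lra.
apply: le_trans tD; rewrite ler_pdivlMr// -[X in _ * X]gtr0_norm// -normrM.
have vn : v != 0 by rewrite gt_eqF.
case: s; rewrite /mean -/b1 -/a2 ?fv1 ?fv2 fv IE -/I1 -/I2.
  rewrite -normrN (_ : - _ = I2 - I1 - c * kap)//; field.
  exact: vn.
rewrite (_ : _ * v = I2 - I1 - c * kap)//; field.
exact: vn.
Qed.

(** Levels are given per coordinate because cells are later halved in some directions only. The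
    index is a ceiling minus 1 because a cell contains its upper faces and not its lower ones. *)
Definition dy_index lev x : {ffun 'I_n -> int} :=
  [ffun i => Num.ceil (2 ^+ lev i * x ord0 i) - 1].

Definition dy_lo lev (z : {ffun 'I_n -> int}) : V := \row_i ((z i)%:~R / 2 ^+ lev i).

Definition dy_hi lev (z : {ffun 'I_n -> int}) : V := \row_i ((z i + 1)%:~R / 2 ^+ lev i).

Definition dcell lev z : set V := cell (dy_lo lev z) (dy_hi lev z).

Definition dbox lev z : set V := rV_box (dy_lo lev z) (dy_hi lev z).

Definition lev_incr lev (j : 'I_n) : 'I_n -> nat := fun i => (lev i + (j == i))%N.

Lemma pow2_gt0 (k : nat) : 0 < 2 ^+ k :> R. Proof. by rewrite exprn_gt0. Qed.

Lemma dy_lo_hi lev z i : dy_hi lev z ord0 i = dy_lo lev z ord0 i + (2 ^+ lev i)^-1.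
Proof. by rewrite !mxE intrD mulrDl mul1r. Qed.

Lemma dy_lt lev z i : dy_lo lev z ord0 i < dy_hi lev z ord0 i.
Proof. by rewrite dy_lo_hi ltrDl invr_gt0 pow2_gt0. Qed.

Lemma mem_dcell lev z x : dcell lev z x <-> z = dy_index lev x.
Proof.
have E (z' : {ffun 'I_n -> int}) i :
    (dy_lo lev z' ord0 i < x ord0 i <= dy_hi lev z' ord0 i) =
    (Num.ceil (2 ^+ lev i * x ord0 i) == z' i + 1).
  rewrite !mxE ltr_pdivrMr ?pow2_gt0// ler_pdivlMr ?pow2_gt0// [_ * _ ^+ _]mulrC.
  by rewrite ceil_eq addrK.
split => [zx|-> i]; last by rewrite E ffunE subrK.
apply/ffunP => i; have := zx i; rewrite E => /eqP e.
by rewrite ffunE e addrK.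
Qed.

Lemma dcell_dy_index lev x : dcell lev (dy_index lev x) x.
Proof. exact/mem_dcell. Qed.

Definition dvol lev : R := \prod_i (2 ^+ lev i)^-1.

Lemma dvol_gt0 lev : 0 < dvol lev.
Proof. by apply: prodr_gt0 => i _; rewrite invr_gt0 pow2_gt0. Qed.

Lemma measure_dcell lev z : mu (dcell lev z) = (dvol lev)%:E.
Proof.
rewrite measure_cell; last by move=> i; exact/ltW/dy_lt.
by congr EFin; apply: eq_bigr => i _; rewrite dy_lo_hi addrAC subrr add0r.
Qed.

Lemma dcell_dist lev z x y i : dbox lev z x -> dbox lev z y ->
  `|x ord0 i - y ord0 i| <= (2 ^+ lev i)^-1.
Proof.
move=> /(_ i) + /(_ i); rewrite !in_itv/= dy_lo_hi => /andP[? ?] /andP[? ?].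
by rewrite ler_norml; apply/andP; split; lra.
Qed.

Lemma dcell_half lev j x : let z := dy_index lev x in
  let m := (dy_lo lev z ord0 j + dy_hi lev z ord0 j) / 2 in
  let z' := dy_index (lev_incr lev j) x in
  exists s : bool,
   (dy_lo (lev_incr lev j) z', dy_hi (lev_incr lev j) z') =
   if s then (dy_lo lev z, row_upd (dy_hi lev z) j m)
   else (row_upd (dy_lo lev z) j m, dy_hi lev z).
Proof.
move=> z m z'.
have pn k : (2 : R) ^+ k != 0 by rewrite expf_neq0.
pose zs (s : bool) : {ffun 'I_n -> int} :=
  [ffun i => if i == j then 2 * z j + (if s then 0 else 1) else z i].
have mE : m = (2 * z j + 1)%:~R / 2 ^+ (lev j).+1.
  rewrite /m !mxE exprS !intrD !intrM; field; exact: pn.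
have lo_hi s : (dy_lo (lev_incr lev j) (zs s), dy_hi (lev_incr lev j) (zs s)) =
   if s then (dy_lo lev z, row_upd (dy_hi lev z) j m)
   else (row_upd (dy_lo lev z) j m, dy_hi lev z).
  case: s; congr pair; apply/rowP => i; rewrite !mxE /zs ffunE /lev_incr [j == i]eq_sym;
    case: eqP => [->|_]; rewrite ?addn0 ?addn1 ?mE ?exprS ?addr0//.
  - by rewrite !intrM; field; exact: pn.
  - by rewrite !intrD !intrM; field; exact: pn.
have zx := dcell_dy_index lev x.
have [s sx] : exists s, dcell (lev_incr lev j) (zs s) x.
  have [xm|xm] := leP (x ord0 j) m.
    exists true; rewrite /dcell; have [-> ->] := lo_hi true.
    move=> i; have /andP[h1 h2] := zx i; rewrite h1/= mxE.
    by case: eqP => // ->.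
  exists false; rewrite /dcell; have [-> ->] := lo_hi false.
  move=> i; have /andP[h1 h2] := zx i; rewrite h2 andbT mxE.
  by case: eqP => // ->.
by exists s; rewrite -lo_hi /z' -((mem_dcell _ _ _).1 sx).
Qed.

Variables (lev0 : 'I_n -> nat) (js : nat -> 'I_n).

Definition chain_lev (s : nat) : 'I_n -> nat :=
  fun i => (lev0 i + \sum_(r < s) (js r == i))%N.

Lemma chain_levS s : chain_lev s.+1 = lev_incr (chain_lev s) (js s).
Proof. by apply/funext => i; rewrite /chain_lev /lev_incr big_ord_recr addnA. Qed.

Definition chain_side (s : nat) : R := (2 ^+ chain_lev s (js s))^-1.

Lemma chain_nested s x :
  dbox (chain_lev s.+1) (dy_index (chain_lev s.+1) x) `<=`
  dbox (chain_lev s) (dy_index (chain_lev s) x).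
Proof.
rewrite chain_levS /dbox; have [b] := dcell_half (chain_lev s) (js s) x.
set lo := dy_lo (chain_lev s) _; set hi := dy_hi (chain_lev s) _.
have lh : lo ord0 (js s) < hi ord0 (js s) by exact: dy_lt.
case: b => -[-> ->] y xy i; have := xy i; rewrite !in_itv/= => /andP[h1 h2];
  rewrite ?h1 ?h2 ?andbT/=.
  by apply: le_trans h2 _; rewrite [leLHS]mxE; case: (eqVneq i (js s)) => // ->; lra.
by apply: le_trans h1; rewrite [leRHS]mxE; case: (eqVneq i (js s)) => // ->; lra.
Qed.

Lemma chain_nested_le s t x : (s <= t)%N ->
  dbox (chain_lev t) (dy_index (chain_lev t) x) `<=`
  dbox (chain_lev s) (dy_index (chain_lev s) x).
Proof.
elim: t => [|t ih]; first by rewrite leqn0 => /eqP ->.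
rewrite leq_eqVlt => /predU1P[->//|]; rewrite ltnS => /ih h.
exact: subset_trans (@chain_nested _ _) h.
Qed.

(** The halving estimates telescope along the cells containing [x]. As [kappa] depends on the cells
    alone, the components of a map share it, and the linear terms are the entries of one matrix
    applied to one vector; [c = 0] gives a plain oscillation bound. *)
Lemma dyadic_chain x : exists2 kappa : nat -> R,
  (forall s, `|kappa s| <= chain_side s) &
  forall U u (w : 'I_n -> V -> R) (c : 'I_n -> R), measurable U ->
    (forall s, weak_partial U (js s) u (w (js s))) ->
    dbox lev0 (dy_index lev0 x) `<=` U -> forall S,
  `|mean (dcell (chain_lev S) (dy_index (chain_lev S) x)) u -
    mean (dcell lev0 (dy_index lev0 x)) u - \sum_(s < S) c (js s) * kappa s| <=
  \sum_(s < S) chain_side s * mean (dcell (chain_lev s) (dy_index (chain_lev s) x))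
    (fun y => `|w (js s) y - c (js s)|).
Proof.
have lev00 : chain_lev 0 = lev0 by apply/funext => i; rewrite /chain_lev big_ord0 addn0.
have /choice[kap kapP] s : exists kappa : R, `|kappa| <= chain_side s /\
  forall U u w (c : R), measurable U -> weak_partial U (js s) u w ->
    dbox (chain_lev s) (dy_index (chain_lev s) x) `<=` U ->
  `|mean (dcell (chain_lev s.+1) (dy_index (chain_lev s.+1) x)) u -
    mean (dcell (chain_lev s) (dy_index (chain_lev s) x)) u - c * kappa| <=
  chain_side s * mean (dcell (chain_lev s) (dy_index (chain_lev s) x)) (fun y => `|w y - c|).
  have [kap kap1 kap2] := weak_partial_half (js s)
    (fun i => dy_lt (chain_lev s) (dy_index (chain_lev s) x) i).
  rewrite chain_levS; have [b bE] := dcell_half (chain_lev s) (js s) x.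
  have sideE : chain_side s = dy_hi (chain_lev s) (dy_index (chain_lev s) x) ord0 (js s) -
      dy_lo (chain_lev s) (dy_index (chain_lev s) x) ord0 (js s).
    by rewrite dy_lo_hi addrAC subrr add0r.
  exists (kap b); rewrite sideE; split => // U u w c mU wp BU.
  have := kap2 U u w c mU wp BU b; congr (`|mean _ _ - _ - _| <= _).
  by rewrite /dcell; case: b bE {kap1 kap2} => -[-> ->].
exists kap => [s|U u w c mU wp BU S]; first by case: (kapP s).
elim: S => [|S ih]; first by rewrite !big_ord0 lev00 subrr subr0 normr0.
rewrite !big_ord_recr/=; have [_ /(_ U u _ (c (js S)) mU (wp S))] := kapP S.
have BS : dbox (chain_lev S) (dy_index (chain_lev S) x) `<=` U.
  apply: subset_trans BU; rewrite -[X in _ `<=` dbox X _]lev00 -[X in _ `<=` dbox _ (dy_index X _)]lev00.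
  exact: chain_nested_le.
move=> /(_ BS) h; apply: le_trans (lerD ih h); apply: le_trans (ler_normD _ _).
by rewrite le_eqVlt; apply/orP; left; apply/eqP; congr (`|_|); ring.
Qed.
End dyadic_cells.

(** * Outer measure and regularity *)

Section covers.
Context {R : realType} {n : nat}.
Local Notation V := 'rV[R]_n.
Local Notation mu := (@lebesgue_measure_rV R n).
Local Open Scope ereal_scope.

(** An upper bound for the outer measure, meaningful for images whose measurability is not
    established. *)
Definition covered (A : set V) (c : \bar R) :=
  exists B, [/\ measurable B, A `<=` B & mu B <= c].

Lemma covered_le (A A' : set V) (c c' : \bar R) : covered A c -> A' `<=` A -> c <= c' ->
  covered A' c'.
Proof.
move=> [B [mB AB Bc]] AA cc; exists B; split => //; first exact: subset_trans AB.
exact: le_trans cc.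
Qed.

Lemma covered0 : covered set0 0.
Proof. by exists set0; split => //; rewrite measure0. Qed.

(** The bookkeeping behind the covers below: each piece [A z] of an image is charged to the integral
    of [h] over its own piece [D z] of the domain, and these pieces are disjoint. *)
Lemma covered_bigcup (T : countType) (P : T -> Prop) (A D : T -> set V) (E : set V)
    (h : V -> R) : measurable E -> measurable_fun E h -> (forall x, E x -> (0 <= h x)%R) ->
  (forall z, P z -> [/\ measurable (D z), D z `<=` E &
     covered (A z) (\int[mu]_(x in D z) (h x)%:E)]) ->
  (forall z z' x, P z -> P z' -> D z x -> D z' x -> z = z') ->
  covered [set x | exists2 z, P z & A z x] (\int[mu]_(x in E) (h x)%:E).
Proof.
move=> mE mh h0 PD tD.
have /choice[B BP] z : exists B : set V, P z -> [/\ measurable B, A z `<=` B &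
    mu B <= \int[mu]_(x in D z) (h x)%:E].
  have [Pz|nPz] := pselect (P z); last by exists set0.
  by have [_ _ [B BP]] := PD z Pz; exists B.
pose pick (F : T -> set V) k : set V :=
  if @pickle_inv T k is Some z then if `[< P z >] then F z else set0 else set0.
have pickP F k x : pick F k x -> exists z, [/\ P z, pickle z = k & F z x].
  rewrite /pick; case E1 : (pickle_inv k) => [z|//]; case: asboolP => // Pz Fzx.
  by exists z; split => //; have := @pickle_invK T k; rewrite E1.
have pickE F z : P z -> pick F (pickle z) = F z.
  by move=> Pz; rewrite /pick pickleK_inv; case: asboolP.
have mpick F k : (forall z, P z -> measurable (F z)) -> measurable (pick F k).
  by move=> mF; rewrite /pick; case: pickle_inv => // z; case: asboolP => // /mF.
have mD k : measurable (pick D k) by apply: mpick => z /PD[].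
have mB k : measurable (pick B k) by apply: mpick => z /BP[].
have mUD : measurable (\bigcup_k pick D k) by exact: bigcup_measurable.
have UDE : \bigcup_k pick D k `<=` E.
  by move=> x [k _ /pickP[z [/PD[_ DE _] _ /DE]]].
exists (\bigcup_k pick B k); split.
- exact: bigcup_measurable.
- move=> x [z Pz Azx]; exists (pickle z) => //; rewrite pickE//.
  by have [_ AB _] := BP z Pz; exact: AB.
apply: le_trans (@measure_sigma_subadditive _ _ _ mu _ (pick B) mB _ _) _ => //.
  exact: bigcup_measurable.
apply: (@le_trans _ _ (\sum_(k <oo) \int[mu]_(x in pick D k) (h x)%:E)).
  apply: lee_nneseries => [k _ _|k _]; first exact: measure_ge0.
  rewrite /pick; case: pickle_inv => [z|]; last by rewrite measure0 integral_set0.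
  case: asboolP => [Pz|_]; last by rewrite measure0 integral_set0.
  by have [] := BP z Pz.
rewrite -ge0_integral_bigcup//.
- apply: ge0_subset_integral => //; first exact/measurable_EFinP.
- apply/measurable_EFinP; exact: measurable_funS mh.
- by move=> x /UDE Ex; rewrite lee_fin h0.
- apply/trivIsetP => k k' _ _ kk'; apply/seteqP; split => // x.
  move=> [/pickP[z [Pz zk Dz]] /pickP[z' [Pz' zk' Dz']]].
  by move: kk'; rewrite -zk -zk' (tD z z' x)// eqxx.
Qed.

(** The intersections of the tails of the covers increase, and each has measure at most [c]. This
    transfers a bound valid at every scale to the points concerned by all sufficiently fine
    scales. *)
Lemma covered_liminf (A : nat -> set V) (c : \bar R) : (forall k, covered (A k) c) ->
  covered [set x | exists m, forall k, (m <= k)%N -> A k x] c.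
Proof.
move=> /choice[B BP]; pose C m := \bigcap_k B (m + k)%N.
have mC m : measurable (C m) by apply: bigcapT_measurable => k; case: (BP (m + k)%N).
have mUC : measurable (\bigcup_m C m) by exact: bigcup_measurable.
exists (\bigcup_m C m); split => //.
  move=> x [m xm]; exists m => // k _; have [_ AB _] := BP (m + k)%N.
  by apply: AB; apply: xm; exact: leq_addr.
have cv : mu (C m) @[m --> \oo] --> mu (\bigcup_m C m).
  apply: nondecreasing_cvg_mu => // m m' mm'; apply/subsetPset => x Cx k _.
  by have := Cx (m' - m + k)%N Logic.I; rewrite addnA subnKC.
apply: cvge_le cv; apply: nearW => m.
have [mB _ Bm] := BP m; apply: le_trans Bm; apply: le_measure; rewrite ?inE//.
by move=> x /(_ 0%N Logic.I); rewrite addn0.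
Qed.

Lemma covered_negligible (A : set V) : (forall e : R, (0 < e)%R -> covered A e%:E) ->
  mu.-negligible A.
Proof.
move=> Ae; have /choice[B BP] k : exists B, [/\ measurable B, A `<=` B & mu B <= (k.+1%:R^-1)%:E].
  by apply: Ae; rewrite invr_gt0.
have mB : measurable (\bigcap_k B k) by apply: bigcapT_measurable => k; case: (BP k).
exists (\bigcap_k B k); split => //; last by move=> x Ax k _; case: (BP k) => _ + _; apply.
apply/eqP; rewrite eq_le measure_ge0 andbT; apply/lee_addgt0Pr => e e0; rewrite add0e.
pose k := Num.truncn e^-1; have [mBk _ Bk] := BP k.
apply: (@le_trans _ _ (mu (B k))).
  by apply: le_measure; rewrite ?inE// => x; apply.
apply: le_trans Bk _; rewrite lee_fin -[leRHS]invrK lef_pV2 ?posrE ?invr_gt0//.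
exact/ltW/truncnS_gt.
Qed.
End covers.

Section regularity.
Context {R : realType} {n : nat}.
Local Notation V := 'rV[R]_n.
Local Notation mu := (@lebesgue_measure_rV R n).
Local Open Scope ereal_scope.
Variables (E : set V) (mE : measurable E) (muE : mu E < +oo).

Let nu := mrestr mu mE.

(** Inner closed sets are required along with outer open ones, which makes the class stable under
    complements and so a sigma-algebra. *)
Definition regular_set (A : set V) := forall e : R, (0 < e)%R ->
  exists F U, [/\ closed F, open U, F `<=` A, A `<=` U & nu (U `\` F) < e%:E].

Let nu_fin A : measurable A -> nu A < +oo.
Proof.
move=> mA; apply: le_lt_trans muE; rewrite /nu /mrestr; apply: le_measure; rewrite ?inE//.
exact: measurableI.
Qed.

Let closed_measurable_rV (F : set V) : closed F -> measurable F.
Proof.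
by move=> cF; rewrite -[F]setCK; apply: measurableC; apply: open_measurable_rV; rewrite openC.
Qed.

Lemma nu_decreasing_small (D : nat -> set V) (e : R) : (0 < e)%R ->
  (forall k, measurable (D k)) -> (forall k, D k.+1 `<=` D k) -> \bigcap_k D k = set0 ->
  exists k, nu (D k) < e%:E.
Proof.
move=> e0 mD dD D0.
have : nu (D k) @[k --> \oo] --> nu (\bigcap_k D k).
  apply: nonincreasing_cvg_mu => //; first exact: nu_fin.
    exact: bigcapT_measurable.
  by apply/nonincreasing_seqP => k; exact/subsetPset.
have nu0 : nu set0 = 0 by rewrite /nu /mrestr set0I measure0.
rewrite D0 nu0 => /fine_cvgP[_ /cvgrPdist_lt/(_ _ e0)[k _ /(_ k (leqnn k))]].
rewrite /= sub0r normrN => h; exists k.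
rewrite -[X in X < _]fineK ?lte_fin; last by rewrite ge0_fin_numE ?nu_fin ?measure_ge0.
exact: le_lt_trans (ler_norm _) h.
Qed.

Lemma regular_set_ray (i : 'I_n) (t : R) : regular_set [set x : V | (t < x ord0 i)%R].
Proof.
move=> e e0; pose F k := [set x : V | (t + k.+1%:R^-1 <= x ord0 i)%R].
have cc : continuous (fun x : V => x ord0 i) by exact: coord_continuous.
have oU : open [set x : V | (t < x ord0 i)%R].
  by apply: (@open_comp _ _ (fun x : V => x ord0 i) [set y | (t < y)%R]) => [x _|]; [exact: cc|exact: open_gt].
have cF k : closed (F k).
  by apply: (@closed_comp _ _ (fun x : V => x ord0 i) [set y | (t + k.+1%:R^-1 <= y)%R]) => [x _|]; [exact: cc|exact: closed_ge].
have [|||k kP] := @nu_decreasing_small (fun k => [set x : V | (t < x ord0 i)%R] `\` F k) e e0.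
- by move=> k; apply: measurableD; [exact: open_measurable_rV|exact: closed_measurable_rV].
- move=> k x [tx nF]; split => // Fx; apply: nF; apply: le_trans Fx.
  by rewrite lerD2l lef_pV2 ?posrE// ler_nat.
- apply/seteqP; split => // x xF; have [/= tx _] := xF 0%N Logic.I.
  have xt : (0 < x ord0 i - t)%R by rewrite subr_gt0.
  have [_ nF] := xF (Num.truncn (x ord0 i - t)^-1) Logic.I; apply: nF.
  rewrite /F/= addrC -lerBrDr -[leRHS]invrK lef_pV2 ?posrE ?invr_gt0//.
  exact/ltW/truncnS_gt.
exists (F k), [set x : V | (t < x ord0 i)%R]; split => // x /=; apply: lt_le_trans.
by rewrite ltrDl.
Qed.

Lemma regular_setC (A : set V) : regular_set A -> regular_set (~` A).
Proof.
move=> rA e e0; have [F [U [cF oU FA AU nUF]]] := rA e e0.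
exists (~` U), (~` F); split; [exact: open_closedC|exact: closed_openC| | |].
- exact: subsetC.
- exact: subsetC.
- by rewrite setDE setCK setIC -setDE.
Qed.

(** An infinite union of closed sets need not be closed, so only finitely many inner sets are kept;
    the finiteness of [nu] makes the remainder small. *)
Lemma regular_set_bigcup (A : nat -> set V) : (forall k, regular_set (A k)) ->
  regular_set (\bigcup_k A k).
Proof.
move=> rA e e0; have e20 : (0 < e / 2)%R by rewrite divr_gt0.
have /choice[FU FUP] k : exists FU : set V * set V, [/\ closed FU.1, open FU.2,
    FU.1 `<=` A k, A k `<=` FU.2 & nu (FU.2 `\` FU.1) < (e / 2 / (2 ^ k.+1)%:R)%:E].
  have [|F [U FUP]] := rA k (e / 2 / (2 ^ k.+1)%:R)%R; last by exists (F, U).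
  by rewrite divr_gt0// ltr0n expn_gt0.
pose F k := (FU k).1; pose U k := (FU k).2.
have cF k : closed (F k) by case: (FUP k).
have oU k : open (U k) by case: (FUP k).
have mF k : measurable (F k) by exact: closed_measurable_rV.
have mU k : measurable (U k) by exact: open_measurable_rV.
pose FN N := \big[setU/set0]_(k < N) F k.
have cFN N : closed (FN N) by exact: closed_bigsetU.
have FNP N x : FN N x <-> exists2 k, (k < N)%N & F k x.
  rewrite /FN -bigcup_mkord; split => [[k kN Fkx]|[k kN Fkx]]; exists k => //.
have mUF : measurable (\bigcup_k F k) by exact: bigcup_measurable.
have mUU : measurable (\bigcup_k U k) by exact: bigcup_measurable.
have mFN N : measurable (FN N) by exact: closed_measurable_rV.
have [|||N NP] := @nu_decreasing_small (fun N => (\bigcup_k F k) `\` FN N) _ e20.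
- by move=> N; exact: measurableD.
- move=> k x [Fx nFx]; split => // /FNP[i ik Fix]; apply: nFx; apply/FNP.
  by exists i => //; exact: ltnW.
- apply/seteqP; split => // x xF; have [[k _ Fkx] _] := xF 0%N Logic.I.
  by have [_ nF] := xF k.+1 Logic.I; apply: nF; apply/FNP; exists k.
exists (FN N), (\bigcup_k U k); split => //.
- exact: bigcup_open.
- by move=> x /FNP[k _ Fkx]; exists k => //; have [_ _ + _ _] := FUP k; apply.
- by move=> x [k _ Akx]; exists k => //; have [_ _ _ + _] := FUP k; apply.
have mUkF : measurable (\bigcup_k (U k `\` F k)).
  by apply: bigcup_measurable => k _; exact: measurableD.
have n1 : nu (\bigcup_k (U k `\` F k)) <= (e / 2)%:E.
  apply: le_trans (@measure_sigma_subadditive _ _ _ nu _ (fun k => U k `\` F k) _ _ _) _ => //.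
    by move=> k; exact: measurableD.
  apply: le_trans (epsilon_trick0 xpredT (ltW e20)).
  apply: lee_nneseries => [k _ _|k _]; first exact: measure_ge0.
  by have [_ _ _ _ /ltW] := FUP k.
apply: (@le_lt_trans _ _ (nu ((\bigcup_k (U k `\` F k)) `|` ((\bigcup_k F k) `\` FN N)))).
  apply: le_measure; rewrite ?inE; [exact: measurableD|apply: measurableU => //; exact: measurableD|].
  move=> x [[k _ Ukx] nFx]; have [Fkx|nFkx] := pselect (F k x).
    by right; split => //; exists k.
  by left; exists k.
apply: le_lt_trans (measureU2 _ _ _) _ => //; first exact: measurableD.
apply: (@le_lt_trans _ _ ((e / 2)%:E + nu ((\bigcup_k F k) `\` FN N))%E).
  exact: leeD2r.
by rewrite [in ltRHS](splitr e) EFinD lteD2lE.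
Qed.

Lemma measurable_regular_set (A : set V) : measurable A -> regular_set A.
Proof.
have rV0 : regular_set set0.
  move=> e e0; exists set0, set0; split => //; first exact: closed0.
  by rewrite set0D /nu /mrestr set0I measure0 lte_fin.
have coord (i : 'I_n) (B : set R) : measurable B -> regular_set [set x : V | B (x ord0 i)].
  have sub : (@RGenOInfty.G R).-sigma.-measurable `<=`
      [set B : set R | regular_set [set x : V | B (x ord0 i)]].
    apply: smallest_sub; last first.
      move=> _ [t ->] /=; have := @regular_set_ray i t; congr regular_set.
      by apply/seteqP; split => x /=; rewrite in_itv/= andbT.
    split => //= [B' rB|B' rB].
      have := regular_setC rB; congr regular_set.
      by apply/seteqP; split => x /=; [|case].
    exact: (regular_set_bigcup rB).
  by move=> mB; apply: sub; rewrite -RGenOInfty.measurableE.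
apply: smallest_sub.
  split => // [B rB|B rB]; first by rewrite setTD; exact: regular_setC.
  exact: regular_set_bigcup.
move=> B; rewrite -bigcup_seq => -[i _ [A' mA <-]]; rewrite setTI.
exact: coord.
Qed.
End regularity.

Section outer_approximation.
Context {R : realType} {n : nat}.
Local Notation V := 'rV[R]_n.
Local Notation mu := (@lebesgue_measure_rV R n).
Local Open Scope ereal_scope.
Variables (E : set V) (oE : open E) (muE : mu E < +oo).

Lemma open_superset_approx (A : set V) (e : R) : measurable A -> A `<=` E -> (0 < e)%R ->
  exists U, [/\ open U, A `<=` U, U `<=` E & mu (U `\` A) < e%:E].
Proof.
move=> mA AE e0; have mE := open_measurable_rV oE.
have [F [U [cF oU FA AU nUF]]] := measurable_regular_set mE muE mA e0.
exists (U `&` E); split => //; first exact: openI.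
  by move=> x Ax; split; [exact: AU|exact: AE].
have mU := open_measurable_rV oU.
have mF : measurable F.
  by rewrite -[F]setCK; apply: measurableC; apply: open_measurable_rV; rewrite openC.
apply: le_lt_trans nUF; rewrite /mrestr; apply: le_measure; rewrite ?inE.
- by apply: measurableD => //; exact: measurableI.
- by apply: measurableI => //; exact: measurableD.
- by move=> x [[Ux Ex] nAx]; split => //; split => // /FA.
Qed.

(** Outer regularity gives an open superset of small measure, and absolute continuity of the
    integral turns this into a small integral. *)
Lemma negligible_open_superset (h : V -> R) (Y : set V) (e : R) :
  mu.-integrable E (EFin \o h) -> mu.-negligible Y -> Y `<=` E -> (0 < e)%R ->
  exists U, [/\ open U, Y `<=` U, U `<=` E & \int[mu]_(x in U) `|h x|%:E < e%:E].
Proof.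
move=> ih [N [mN N0 YN]] YE e0; have mE := open_measurable_rV oE.
have ihE : mu.-integrable setT (EFin \o (h \_ E)%R).
  have := (integrable_mkcond (EFin \o h) mE).1 ih; congr (mu.-integrable setT _).
  by apply/funext => x /=; rewrite /patch; case: ifP.
have [d [d0 dP]] := integral_normr_continuous ihE e0.
have [||U [oU NU UE muU]] := @open_superset_approx (N `&` E) d _ _ d0.
- exact: measurableI.
- exact: subIsetr.
have mU := open_measurable_rV oU.
have mNE : measurable (N `&` E) by exact: measurableI.
exists U; split => //; first by move=> x Yx; apply: NU; split; [exact: YN|exact: YE].
have NE0 : mu (N `&` E) = 0.
  apply/eqP; rewrite eq_le measure_ge0 andbT -N0; apply: le_measure; rewrite ?inE//.
have Ud : mu U < d%:E.
  rewrite -(setDUK NU); apply: le_lt_trans (measureU2 _ _ _) _ => //.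
    exact: measurableD.
  by rewrite [X in X + _](_ : _ = 0)// add0e.
have iU : mu.-integrable U (EFin \o (fun x => `|(h \_ E)%R x|%R)).
  by apply: integrable_norm; exact: (integrableS measurableT).
have := dP U mU Ud; rewrite -lte_fin /Rintegral fineK; last exact: integrable_fin_num.
congr (_ < _); apply: eq_integral => x xU; congr (`|_|%:E)%R.
by rewrite patchE mem_set//; apply: UE; exact: set_mem.
Qed.
End outer_approximation.

(** * Density of functions constant on dyadic cells *)

Section dyadic_density.
Context {R : realType} {n : nat}.
Local Notation V := 'rV[R]_n.
Local Notation mu := (@lebesgue_measure_rV R n).

Definition ulev (l : nat) : 'I_n -> nat := fun=> l.

Definition constant_on_cells (l : nat) (s : V -> R) :=
  forall x y, dy_index (ulev l) x = dy_index (ulev l) y -> s x = s y.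

Lemma dy_index_mono (lev lev' : 'I_n -> nat) (x y : V) : (forall i, (lev i <= lev' i)%N) ->
  dy_index lev' x = dy_index lev' y -> dy_index lev x = dy_index lev y.
Proof.
move=> ll' /ffunP xy; apply/ffunP => i; have := xy i; rewrite !ffunE => /(addIr _) e.
congr (_ - _); pose k := (2 ^ (lev' i - lev i))%N.
(* A coarse cell is a union of [k] consecutive fine intervals in each coordinate, so the fine
   ceiling determines the coarse one. *)
have kP (z : V) (m : int) : (Num.ceil (2 ^+ lev i * z ord0 i) == m) =
    ((m - 1) * k%:Z < Num.ceil (2 ^+ lev' i * z ord0 i) <= m * k%:Z).
  have k0 : (0 : R) < k%:R by rewrite ltr0n expn_gt0.
  have -> : 2 ^+ lev' i * z ord0 i = (2 ^+ lev i * z ord0 i) * k%:R.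
    by rewrite /k natrX mulrAC -exprD subnKC.
  rewrite ceil_eq ceil_gt_int ceil_le_int !intrM ltr_pM2r ?ler_pM2r//.
by apply/eqP; rewrite kP e -kP.
Qed.

Lemma constant_on_cells_mono l l' s : (l <= l')%N ->
  constant_on_cells l s -> constant_on_cells l' s.
Proof. by move=> ll' sP x y xy; apply: sP; exact: dy_index_mono xy. Qed.

Lemma dy_hi_cell (lev : 'I_n -> nat) z : dcell lev z (dy_hi lev z : V).
Proof. by move=> i; rewrite lexx andbT dy_lt. Qed.

Lemma measurable_constant_on_cells l s : constant_on_cells l s ->
  measurable_fun setT s.
Proof.
move=> sP _ Y mY; rewrite setTI.
rewrite (_ : _ @^-1` _ = \bigcup_z (if `[< Y (s (dy_hi (ulev l) z)) >] then
   dcell (ulev l) z else set0)).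
  apply: countable_bigcupT_measurable => // z.
  by case: ifP => // _; exact: measurable_cell.
apply/seteqP; split => x /=.
  move=> Ysx; exists (dy_index (ulev l) x) => //; case: asboolP => [_|].
    exact: dcell_dy_index.
  by case; rewrite (sP _ x)//; apply/esym/mem_dcell; exact: dy_hi_cell.
move=> [z _]; case: asboolP => // Yz /mem_dcell zx.
by rewrite (sP x (dy_hi (ulev l) z))// -zx; exact/mem_dcell/dy_hi_cell.
Qed.

Variables (E : set V) (oE : open E) (muE : (mu E < +oo)%E).

(** Combined with the weak-type bound along chains of cells, this density in [L^1] plays the part of
    the differentiation of integrals. *)
Definition cells_approx (h : V -> R) := mu.-integrable E (EFin \o h) /\
  forall e : R, 0 < e -> exists l s, [/\ constant_on_cells l s,
    mu.-integrable E (EFin \o s) & (\int[mu]_(x in E) `|h x - s x|)%R < e].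

Let mE : measurable E := open_measurable_rV oE.

Lemma cells_approx_close (h : V -> R) : mu.-integrable E (EFin \o h) ->
  (forall e : R, 0 < e -> exists2 g, cells_approx g &
     (\int[mu]_(x in E) `|h x - g x|)%R < e) -> cells_approx h.
Proof.
move=> ih hg; split => // e e0; have e20 : 0 < e / 2 by rewrite divr_gt0.
have [g [ig gs] hge] := hg _ e20; have [l [s [sl is_ gse]]] := gs _ e20.
exists l, s; split => //.
have N1 := integrable_norm (integrable_EFinB mE ih ig).
have N2 := integrable_norm (integrable_EFinB mE ig is_).
have N3 := integrable_norm (integrable_EFinB mE ih is_).
rewrite (splitr e); apply: le_lt_trans (ltrD hge gse).
rewrite -RintegralD//; apply: le_Rintegral => //.
  by have := integrableD mE N1 N2; apply: eq_integrable.
by move=> x _; exact: ler_distD.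
Qed.

Lemma cells_approxD (h g : V -> R) : cells_approx h -> cells_approx g ->
  cells_approx (fun x => h x + g x).
Proof.
move=> [ih ha] [ig ga]; have ihg : mu.-integrable E (EFin \o (fun x => h x + g x)).
  by have := integrableD mE ih ig; apply: eq_integrable.
split => // e e0; have e20 : 0 < e / 2 by rewrite divr_gt0.
have [l [s [sl is_ hs]]] := ha _ e20; have [k [t [tk it gt_]]] := ga _ e20.
have ist : mu.-integrable E (EFin \o (fun x => s x + t x)).
  by have := integrableD mE is_ it; apply: eq_integrable.
exists (maxn l k), (fun x => s x + t x); split => //.
  move=> x y xy; congr (_ + _).
    exact: (constant_on_cells_mono (leq_maxl l k) sl).
  exact: (constant_on_cells_mono (leq_maxr l k) tk).
have N1 := integrable_norm (integrable_EFinB mE ih is_).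
have N2 := integrable_norm (integrable_EFinB mE ig it).
have N3 := integrable_norm (integrable_EFinB mE ihg ist).
rewrite (splitr e); apply: le_lt_trans (ltrD hs gt_).
rewrite -RintegralD//; apply: le_Rintegral => //.
  by have := integrableD mE N1 N2; apply: eq_integrable.
by move=> x _; rewrite opprD addrACA ler_normD.
Qed.

Lemma cells_approxZ (c : R) (h : V -> R) : cells_approx h ->
  cells_approx (fun x => c * h x).
Proof.
move=> [ih ha]; split; first exact: (integrableZl mE c ih).
move=> e e0; have c0 : 0 < `|c| + 1 by rewrite ltr_wpDl.
have [l [s [sl is_ hs]]] := ha _ (divr_gt0 e0 c0).
exists l, (fun x => c * s x); split; [|exact: (integrableZl mE c is_)|].
  by move=> x y xy; rewrite (sl x y).
rewrite (@eq_Rintegral _ _ _ mu E (fun x => `|c| * `|h x - s x|)); last first.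
  by move=> x _; rewrite -mulrBr normrM.
have N1 := integrable_norm (integrable_EFinB mE ih is_).
rewrite RintegralZl//; move: hs; rewrite ltr_pdivlMr// mulrC; apply: le_lt_trans.
by rewrite ler_wpM2r ?lerDl// Rintegral_ge0.
Qed.

Definition inner_cells (U : set V) (l : nat) : set V :=
  [set x | dbox (ulev l) (dy_index (ulev l) x) `<=` U].

Lemma pow2_small (d : R) : 0 < d -> exists l, forall m, (l <= m)%N -> (2 ^+ m)^-1 < d.
Proof.
move=> d0; exists (Num.truncn d^-1).+1 => m lm.
rewrite -[ltRHS]invrK ltf_pV2 ?posrE ?invr_gt0 ?pow2_gt0//.
apply: lt_le_trans (truncnS_gt _) _; rewrite -natrX ler_nat.
by apply: leq_trans lm _; exact/ltnW/ltn_expl.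
Qed.

Lemma inner_cells_exhaust (U : set V) x : open U -> U x ->
  exists l, forall m, (l <= m)%N -> inner_cells U m x.
Proof.
move=> /openP_dist oU Ux; have [d d0 xd] := oU x Ux.
have [l lP] := pow2_small d0; exists l => m lm y xy; apply: xd.
apply: rV_norm_lt => // i; rewrite !mxE; apply: le_lt_trans (lP m lm).
apply: dcell_dist xy => //; exact/cell_sub_box/dcell_dy_index.
Qed.

Lemma inner_cells_sub (U : set V) l : inner_cells U l `<=` U.
Proof. by move=> x; apply; exact/cell_sub_box/dcell_dy_index. Qed.

Lemma inner_cells_mono (U : set V) l : inner_cells U l `<=` inner_cells U l.+1.
Proof.
move=> x xU; apply: subset_trans xU => y xy i.
have p0 k : (0 : R) < 2 ^+ k by exact: pow2_gt0.
have := xy i; have := dcell_dy_index (ulev l) x i; have := dcell_dy_index (ulev l.+1) x i.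
rewrite !in_itv/= !mxE /ulev.
move: (dy_index _ x i) (dy_index _ x i) => z z'.
rewrite !ltr_pdivrMr ?p0// !ler_pdivrMr ?p0// !ler_pdivlMr ?p0// exprS.
set X := x ord0 i; set Y := y ord0 i; set P := 2 ^+ l.
have -> : X * (2 * P) = 2 * (X * P) by ring.
have -> : Y * (2 * P) = 2 * (Y * P) by ring.
move=> /andP[a1 a2] /andP[b1 b2] /andP[c1 c2].
(* The endpoints of both intervals are integers over one power of 2, so that the two intervals,
   having a point in common, are nested. *)
have h1 : (z'%:~R < (2 * (z + 1))%:~R :> R) by rewrite intrM; apply: lt_le_trans a1 _; rewrite ler_pM2l.
have h2 : ((2 * z)%:~R < (z' + 1)%:~R :> R) by rewrite intrM; apply: lt_le_trans a2; rewrite ltr_pM2l.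
move: h1 h2; rewrite !ltr_int => h1 h2.
have h3 : 2 * z <= z' by rewrite -ltzD1.
have h4 : z' + 1 <= 2 * (z + 1) by rewrite lezD1.
have {}h3 : 2 * z%:~R <= z'%:~R :> R by rewrite -[2]/(2%:~R) -intrM ler_int.
have {}h4 : (z' + 1)%:~R <= 2 * (z + 1)%:~R :> R by rewrite -[2]/(2%:~R) -intrM ler_int.
by apply/andP; split; rewrite -(@ler_pM2l _ 2)//; [apply: le_trans h3 c1|apply: le_trans c2 h4].
Qed.

Lemma inner_cells_constant (U : set V) l x y :
  dy_index (ulev l) x = dy_index (ulev l) y -> inner_cells U l x -> inner_cells U l y.
Proof. by rewrite /inner_cells /= => ->. Qed.

Lemma measurable_inner_cells (U : set V) l : measurable (inner_cells U l).
Proof.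
pose s (x : V) : R := \1_(inner_cells U l) x.
have sl : constant_on_cells l s.
  move=> x y xy; rewrite /s !indicE; congr ((nat_of_bool _)%:R); apply/idP/idP; rewrite !inE.
    exact: inner_cells_constant.
  by apply: inner_cells_constant.
have := measurable_constant_on_cells sl measurableT (measurable_set1 (1 : R)).
rewrite setTI; congr measurable; apply/seteqP; split => x /=; rewrite /s indicE.
  by case: (boolP (x \in _)) => [/set_mem//|_ /eqP]; rewrite eq_sym oner_eq0.
by move=> xU; rewrite mem_set.
Qed.
End dyadic_density.

Section dyadic_density_integrable.
Context {R : realType} {n : nat}.
Local Notation V := 'rV[R]_n.
Local Notation mu := (@lebesgue_measure_rV R n).
Variables (E : set V) (oE : open E) (muE : (mu E < +oo)%E).

Let mE : measurable E := open_measurable_rV oE.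

Let integrable_indic (A : set V) : measurable A -> mu.-integrable E (EFin \o \1_A).
Proof.
move=> mA; apply: measurable_bounded_integrable => //.
exists 1; split; first exact: num_real.
move=> M M1 x _ /=; rewrite indicE; case: (x \in A); rewrite ?normr1 ?normr0 ltW//.
exact: lt_trans M1.
Qed.

(** [A] is enlarged to an open [U], and [U] is exhausted by its dyadic cells; the errors are the
    differences [D1] and [D2]. *)
Lemma cells_approx_indic (A : set V) : measurable A -> cells_approx E (\1_A : V -> R).
Proof.
move=> mA; split; first exact: integrable_indic.
move=> e e0; have e20 : 0 < e / 2 by rewrite divr_gt0.
have mAE : measurable (A `&` E) by exact: measurableI.
have [U [oU AU UE muU]] := open_superset_approx oE muE mAE (@subIsetr _ _ _) e20.
have mU := open_measurable_rV oU.
have [|||l lP] := @nu_decreasing_small _ _ E mE muE (fun l => U `\` inner_cells U l) _ e20.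
- by move=> l; apply: measurableD => //; exact: measurable_inner_cells.
- by move=> l x [Ux nx]; split => // /inner_cells_mono.
- apply/seteqP; split => // x xU; have [Ux _] := xU 0%N Logic.I.
  by have [l lP] := inner_cells_exhaust oU Ux; have [_] := xU l Logic.I; apply; exact: lP.
have mI := measurable_inner_cells U l.
exists l, \1_(inner_cells U l); split.
- move=> x y xy; rewrite !indicE; congr ((nat_of_bool _)%:R); apply/idP/idP; rewrite !inE.
    exact: inner_cells_constant.
  by apply: inner_cells_constant.
- exact: integrable_indic.
pose D1 := U `\` (A `&` E); pose D2 := U `\` inner_cells U l.
have mD1 : measurable D1 by exact: measurableD.
have mD2 : measurable D2 by exact: measurableD.
have iD D : measurable D -> D `<=` E -> (mu D < (e / 2)%:E)%E -> (\int[mu]_(x in E) \1_D x)%R < e / 2.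
  move=> mD DE De; rewrite /Rintegral integral_indic// (setIidl DE).
  by rewrite -lte_fin fineK// ge0_fin_numE ?measure_ge0// (lt_trans De)// ltry.
have D1e := iD _ mD1 (subset_trans (@subDsetl _ _ _) UE) muU.
have D2e : (\int[mu]_(x in E) \1_D2 x)%R < e / 2.
  apply: iD => //; first exact: (subset_trans (@subDsetl _ _ _) UE).
  by move: lP; rewrite /mrestr setIidl//; exact: (subset_trans (@subDsetl _ _ _) UE).
rewrite (splitr e); apply: le_lt_trans (ltrD D1e D2e).
rewrite -RintegralD//; [|exact: integrable_indic|exact: integrable_indic].
apply: le_Rintegral => //.
- by apply: integrable_norm; apply: integrable_EFinB => //; exact: integrable_indic.
- by have := integrableD mE (integrable_indic mD1) (integrable_indic mD2); apply: eq_integrable.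
move=> x Ex; rewrite !indicE.
have [xA|xA] := pselect (A x); have [xI|xI] := pselect (inner_cells U l x);
  rewrite ?(mem_set xA) ?(memNset xA) ?(mem_set xI) ?(memNset xI).
- by rewrite subrr normr0 addr_ge0.
- rewrite [x \in D2]mem_set ?subr0 ?normr1 ?lerDr//.
  by split => //; apply: AU.
- rewrite [x \in D1]mem_set ?sub0r ?normrN ?normr1 ?lerDl//.
  by split; [exact: inner_cells_sub xI|case].
- by rewrite subrr normr0 addr_ge0.
Qed.

Lemma cells_approx_sum (I : Type) (r : seq I) (F : I -> V -> R) :
  (forall i, cells_approx E (F i)) -> cells_approx E (fun x => \sum_(i <- r) F i x).
Proof.
move=> FE; elim: r => [|i r ih].
  rewrite (_ : (fun x : V => _) = (fun x => 0 * (\1_(set0 : set V) x : R))).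
    by apply: cells_approxZ => //; exact: cells_approx_indic.
  by apply/funext => x; rewrite big_nil mul0r.
rewrite (_ : (fun x : V => _) = (fun x => F i x + \sum_(j <- r) F j x)).
  exact: cells_approxD.
by apply/funext => x; rewrite big_cons.
Qed.

Theorem integrable_cells_approx (h : V -> R) : mu.-integrable E (EFin \o h) ->
  cells_approx E h.
Proof.
move=> ih; have [g [ig _ gl]] := approximation_sfun_integrable mE ih.
apply: (cells_approx_close oE ih) => e e0.
move: gl => /fine_cvgP[_ /cvgrPdist_lt/(_ _ e0)[k _ /(_ k (leqnn k))]] /=.
rewrite sub0r normrN => ge_; exists (g k : V -> R); last first.
  rewrite /Rintegral; apply: le_lt_trans ge_; rewrite ger0_norm.
    by rewrite le_eqVlt; apply/orP; left; apply/eqP; congr fine; apply: eq_integral.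
  by apply: fine_ge0; exact: integral_ge0.
have mgk (t : R) : measurable (g k @^-1` [set t]).
  have mg : measurable_fun [set: V] (g k) by [].
  by have := mg measurableT [set t] (measurable_set1 t); rewrite setTI.
rewrite (funext (fimfunEord (g k))); apply: cells_approx_sum => i.
by apply: cells_approxZ => //; apply: cells_approx_indic; exact: mgk.
Qed.
End dyadic_density_integrable.

(** * Images under nearly degenerate affine maps *)

Section degenerate_affine_images.
Context {R : realType} {n : nat}.
Local Notation V := 'rV[R]_n.
Local Notation mu := (@lebesgue_measure_rV R n).

Lemma covered_finite (T : finType) (A : T -> set V) (c : R) :
  (forall k, covered (A k) c%:E) -> covered (\bigcup_k A k) (#|T|%:R * c)%:E.
Proof.
move=> Ac; suff : covered [set x | exists2 k, k \in enum T & A k x] ((size (enum T))%:R * c)%:E.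
  rewrite -cardE => h; apply: covered_le h _ (lexx _) => x [k _ Akx].
  by exists k => //; rewrite mem_enum.
elim: (enum T) => [|k s [B [mB sB Bc]]].
  by rewrite mul0r; apply: covered_le (@covered0 _ _) _ (lexx _) => x [].
have [Bk [mBk kB Bkc]] := Ac k; exists (Bk `|` B); split.
- exact: measurableU.
- move=> x [i]; rewrite inE => /predU1P[->|ks] Aix; first by left; exact: kB.
  by right; apply: sB; exists i.
apply: le_trans (measureU2 _ _ _) _ => //.
by rewrite /= -natr1 mulrDl mul1r addrC EFinD leeD.
Qed.

Lemma grid_index (M : nat) (T t : R) : 0 < T -> 0 <= t <= T ->
  exists k : 'I_M.+1, k%:R * (T / M.+1%:R) <= t <= (k%:R + 1) * (T / M.+1%:R).
Proof.
move=> T0 /andP[t0 tT]; pose d := T / M.+1%:R.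
have d0 : 0 < d by rewrite divr_gt0.
have Md : M.+1%:R * d = T by rewrite mulrC divfK.
have [tM|tM] := leP t (M%:R * d).
  have h : (Num.truncn (t / d) < M.+1)%N.
    rewrite ltnS -(ler_nat R); apply: le_trans (_ : t / d <= _).
      by rewrite truncn_le divr_ge0// ltW.
    by rewrite ler_pdivrMr.
  exists (Ordinal h) => /=; rewrite -/d -ler_pdivlMr// -[_ <= _ * d]ler_pdivrMr//.
  have /truncn_itv/andP[-> h2] : 0 <= t / d by rewrite divr_ge0// ltW.
  by rewrite natr1 ltW.
exists ord_max => /=; rewrite -/d (ltW tM)/= natr1 Md//.
Qed.

(* A singular matrix has a left null vector; normalized to have a largest entry
   1 at [i0], it confines that coordinate to a short interval once the others
   are known up to [d]. *)
Lemma covered_degenerate_affine (A : 'M[R]_n) (a : V) (L rho eps : R) :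
  \det A = 0 -> (forall i j, `|A i j| <= L) -> 0 < rho -> 0 < eps <= 1 ->
  let r0 := n%:R * L + 1 in
  covered [set y : V | exists xi : 'I_n -> R, (forall j, `|xi j| <= rho) /\
      forall i, `|y ord0 i - a ord0 i - \sum_j A i j * xi j| <= eps * rho]
    ((2 * r0) ^+ n.-1 * (2 * (n%:R * (1 + 2 * r0))) * eps * rho ^+ n)%:E.
Proof.
move=> /eqP/det0P[v v0 vA] AL rho0 /andP[eps0 eps1] r0.
have [i0 vi0] : exists i0, v ord0 i0 != 0.
  apply: contrapT => h; move/eqP : v0; apply; apply/rowP => i; rewrite mxE.
  by apply/eqP/negPn/negP => hi; apply: h; exists i.
pose im := [arg max_(i > i0) `|v ord0 i|]%O.
have imP i : `|v ord0 i| <= `|v ord0 im| by rewrite /im; case: arg_maxP => // j _; exact.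
have vim : v ord0 im != 0.
  by rewrite -normr_gt0 (lt_le_trans _ (imP i0))// normr_gt0.
pose nu i := v ord0 i / v ord0 im.
have nu1 i : `|nu i| <= 1.
  by rewrite /nu normrM normfV ler_pdivrMr ?normr_gt0// mul1r.
have nuim : nu im = 1 by rewrite /nu mulfV.
have nuA j : \sum_i nu i * A i j = 0.
  have /rowP/(_ j) := vA; rewrite !mxE => e.
  transitivity ((\sum_i v ord0 i * A i j) / v ord0 im); last by rewrite e mul0r.
  by rewrite mulr_suml; apply: eq_bigr => i _; rewrite /nu mulrAC.
have n0 : (0 < n)%N by apply: leq_ltn_trans (ltn_ord im).
have L0 : 0 <= L := le_trans (normr_ge0 _) (AL im im).
have r00 : 0 < r0 by rewrite /r0 ltr_wpDl// mulr_ge0.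
(* Every such [y] is within [R0] of [a] in each coordinate, since [n L rho + eps rho <= r0 rho]. *)
pose R0 := r0 * rho.
have R00 : 0 < R0 by rewrite mulr_gt0.
pose M := Num.truncn eps^-1.
pose d := 2 * R0 / M.+1%:R.
have d0 : 0 < d by rewrite divr_gt0// mulr_gt0.
have d_le : d <= 2 * R0 * eps.
  rewrite /d ler_pM2l ?mulr_gt0// -[leRHS]invrK lef_pV2 ?posrE ?invr_gt0//.
  exact/ltW/truncnS_gt.
(* Half-length of the interval left to coordinate [im]: each coordinate contributes an error
   [eps * rho] and an uncertainty of at most [d]. *)
pose w := n%:R * (eps * rho + d).
have w0 : 0 < w by rewrite mulr_gt0 ?ltr0n// addr_gt0// mulr_gt0.
pose lo (k : {ffun 'I_n -> 'I_M.+1}) i := - R0 + (k i)%:R * d.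
pose cen k := a ord0 im - \sum_(i | i != im) nu i * lo k i.
(* The short interval of coordinate [im] is also cut into [M + 1] pieces, which keeps a single index
   set and does not change the total volume. *)
pose bl k : V := \row_i (if i == im then cen k - w + (k i)%:R * (2 * w / M.+1%:R)
                         else a ord0 i + lo k i).
pose bh k : V := \row_i (if i == im then cen k - w + ((k i)%:R + 1) * (2 * w / M.+1%:R)
                         else a ord0 i + lo k i + d).
have M0 : (0 : R) < M.+1%:R by [].
have blh k i : bl k ord0 i <= bh k ord0 i.
  rewrite !mxE; case: eqP => _; last by rewrite lerDl ltW.
  by rewrite lerD2l ler_pM2r ?lerDl// divr_gt0// mulr_gt0.
have muB k : mu (rV_box (bl k) (bh k)) = (d ^+ n.-1 * (2 * w / M.+1%:R))%:E.
  rewrite lebesgue_measure_rV_box//; congr EFin; rewrite (bigD1 im)//= mulrC; congr (_ * _).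
    rewrite (eq_bigr (fun=> d)).
      by rewrite prodr_const; congr (_ ^+ _); rewrite cardC1 card_ord.
    by move=> i ii; rewrite !mxE (negbTE ii) addrAC subrr add0r.
  by rewrite !mxE eqxx; ring.
have cov k : covered (rV_box (bl k) (bh k)) (d ^+ n.-1 * (2 * w / M.+1%:R))%:E.
  by exists (rV_box (bl k) (bh k)); split => //; [exact: measurable_rV_box|rewrite -(muB k)].
apply: covered_le (covered_finite cov) _ _.
  move=> y [xi [xirho yxi]].
  have yR i : `|y ord0 i - a ord0 i| <= R0.
    rewrite -(subrK (\sum_j A i j * xi j) (y ord0 i - a ord0 i)).
    apply: le_trans (ler_normD _ _) _; rewrite /R0 /r0 mulrDl mul1r addrC lerD//.
      apply: le_trans (ler_norm_sum _ _ _) _.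
      apply: le_trans (_ : \sum_(j < n) L * rho <= _).
        by apply: ler_sum => j _; rewrite normrM ler_pM.
      by rewrite sumr_const card_ord -mulrA mulr_natl.
    by apply: le_trans (yxi i) _; rewrite ler_piMl// ltW.
  have yR' i : 0 <= y ord0 i - a ord0 i + R0 <= 2 * R0.
    by have := yR i; rewrite ler_norml => /andP[? ?]; apply/andP; split; lra.
  have /choice[k kP] i := grid_index M (mulr_gt0 (ltr0Sn R 1) R00) (yR' i).
  have ke (k' : {ffun 'I_n -> 'I_M.+1}) i : k' i = k i ->
      0 <= y ord0 i - a ord0 i - lo k' i <= d.
    move=> e; have := kP i; rewrite /lo e -/d mulrDl mul1r.
    by move=> /andP[? ?]; apply/andP; split; lra.
  have key (k' : {ffun 'I_n -> 'I_M.+1}) : (forall i, i != im -> k' i = k i) ->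
      0 <= y ord0 im - cen k' + w <= 2 * w.
    move=> kk.
    suff : `|y ord0 im - cen k'| <= w.
      by rewrite ler_norml => /andP[? ?]; apply/andP; split; lra.
    (* Since [nu] annihilates [A] from the left, the combination of the coordinates with weights
       [nu] does not see [xi]. *)
    have -> : y ord0 im - cen k' =
      \sum_i nu i * (y ord0 i - a ord0 i - \sum_j A i j * xi j) -
      \sum_(i | i != im) nu i * (y ord0 i - a ord0 i - lo k' i).
      have -> : \sum_i nu i * (y ord0 i - a ord0 i - \sum_j A i j * xi j) =
          \sum_i nu i * (y ord0 i - a ord0 i).
        under eq_bigr do rewrite mulrBr.
        rewrite sumrB [X in _ - X](_ : _ = 0) ?subr0//.
        under eq_bigr do rewrite mulr_sumr.
        rewrite exchange_big/= big1// => j _.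
        under eq_bigr do rewrite mulrA.
        by rewrite -mulr_suml nuA mul0r.
      have -> : \sum_(i | i != im) nu i * (y ord0 i - a ord0 i - lo k' i) =
          \sum_(i | i != im) nu i * (y ord0 i - a ord0 i) - \sum_(i | i != im) nu i * lo k' i.
        by rewrite -sumrB; apply: eq_bigr => i _; rewrite mulrBr.
      rewrite (bigD1 im)//= nuim mul1r /cen; ring.
    rewrite /w mulrDr; apply: le_trans (ler_normB _ _) _; apply: lerD.
      apply: le_trans (ler_norm_sum _ _ _) _.
      apply: le_trans (_ : \sum_(i < n) eps * rho <= _).
        apply: ler_sum => i _; rewrite normrM -[leRHS]mul1r; exact: ler_pM.
      by rewrite sumr_const card_ord mulr_natl.
    apply: le_trans (ler_norm_sum _ _ _) _.
    apply: le_trans (_ : \sum_(i < n | i != im) d <= _).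
      apply: ler_sum => i ii; rewrite normrM -[leRHS]mul1r; apply: ler_pM => //.
      by have /andP[h1 h2] := ke k' i (kk i ii); rewrite ger0_norm.
    rewrite sumr_const -[_ *+ _]mulr_natl ler_wpM2r ?(ltW d0)// ler_nat.
    by rewrite cardC1 card_ord leq_pred.
  pose k1 : {ffun 'I_n -> 'I_M.+1} := [ffun i => k i].
  have [km kmP] := grid_index M (mulr_gt0 (ltr0Sn R 1) w0)
    (key k1 (fun i _ => ffunE _ i)).
  (* [cen] does not read the entry at [im], which can therefore be chosen last. *)
  pose k2 : {ffun 'I_n -> 'I_M.+1} := [ffun i => if i == im then km else k i].
  have k2E i : i != im -> k2 i = k i by move=> ii; rewrite ffunE (negbTE ii).
  have cenE : cen k2 = cen k1.
    rewrite /cen; congr (_ - _); apply: eq_bigr => i ii; rewrite /lo k2E//.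
    by rewrite ffunE.
  exists k2 => // i; rewrite in_itv/= !mxE; case: eqP => [->|/eqP ii].
    rewrite cenE ffunE eqxx; move: kmP => /andP[].
    set t1 := _%:R * _; set t2 := (_ + 1) * _ => h1 h2.
    by apply/andP; split; lra.
  have /andP[h1 h2] := ke k2 i (k2E i ii).
  by apply/andP; split; lra.
rewrite lee_fin card_ffun !card_ord natrX.
have Md : M.+1%:R * d = 2 * R0 by rewrite /d mulrC divfK.
have -> : M.+1%:R ^+ n * (d ^+ n.-1 * (2 * w / M.+1%:R)) = (2 * R0) ^+ n.-1 * (2 * w).
  rewrite -{1}(prednK n0) exprS -Md [(_ * d) ^+ _]exprMn; field.
  by rewrite gt_eqF.
have -> : (2 * r0) ^+ n.-1 * (2 * (n%:R * (1 + 2 * r0))) * eps * rho ^+ n =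
    (2 * R0) ^+ n.-1 * (2 * (n%:R * (1 + 2 * r0)) * eps * rho).
  have -> : rho ^+ n = rho * rho ^+ n.-1 by rewrite -exprS prednK.
  rewrite /R0 [2 * (r0 * rho)]mulrA [(2 * r0 * rho) ^+ _]exprMn; ring.
rewrite ler_wpM2l ?exprn_ge0 ?mulr_ge0 ?(ltW r00) ?(ltW rho0)//.
rewrite -!mulrA ler_wpM2l// /w ler_wpM2l//.
have -> : (1 + 2 * r0) * (eps * rho) = eps * rho + 2 * R0 * eps by rewrite /R0; ring.
by rewrite lerD2l.
Qed.
End degenerate_affine_images.

(** * Degenerate gradients *)

Section cyclic_halving.
Context {R : realType}.

Lemma cyclic_count (m b s : nat) : (b < m)%N ->
  (s %/ m <= \sum_(r < s) (r %% m == b))%N.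
Proof.
move=> bm; have m0 : (0 < m)%N by apply: leq_ltn_trans bm.
have -> : (\sum_(r < s) (r %% m == b) = \sum_(0 <= r < s) (r %% m == b))%N.
  by rewrite big_mkord.
have h q : (q <= \sum_(0 <= r < q * m) (r %% m == b))%N.
  elim: q => // q ih; rewrite mulSn addnC (big_cat_nat (n := q * m)) ?leq_addr//=.
  have -> : (\sum_(q * m <= i < q * m + m) (i %% m == b) = \sum_(i < m) ((i + q * m) %% m == b))%N.
    by rewrite -{1}[(q * m)%N]add0n big_addn addKn big_mkord.
  rewrite -addn1 leq_add// (bigD1 (Ordinal bm))//= [(b + _)%N]addnC modnMDl modn_small// eqxx.
  exact: leq_addr.
apply: leq_trans (h _) _; rewrite [leqRHS](big_cat_nat (n := s %/ m * m))//=.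
  exact: leq_addr.
exact: leq_trunc_div.
Qed.

Lemma geometric_sum_le (t : R) S : 0 <= t < 1 -> \sum_(s < S) t ^+ s <= (1 - t)^-1.
Proof.
move=> /andP[t0 t1]; have t10 : 0 < 1 - t by rewrite subr_gt0.
rewrite -[leRHS]mul1r ler_pdivlMr// mulrC.
have -> : (1 - t) * \sum_(s < S) t ^+ s = 1 - t ^+ S.
  by rewrite -[in RHS]opprB subrX1 -mulNr opprB.
by rewrite gerBl exprn_ge0.
Qed.

(** When [m + 1] directions are halved in turn, sides decay like [2 ^ (- s / (m + 1))], up to a
    factor 2 for the rounding in [s %/ m.+1]; this beats growth [2 ^ (c s)]. It serves with [c = 0]
    for all directions and with [c = 1 / q] for fewer than [q] directions. *)
Lemma cyclic_geometric_bound (m : nat) (c : R) : 0 <= c < m.+1%:R^-1 ->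
  exists2 K : R, 0 < K &
  forall S, \sum_(s < S) (2 ^+ (s %/ m.+1))^-1 * (2 `^ c) ^+ s <= K.
Proof.
move=> /andP[c0 cm]; pose t : R := 2 `^ (c - m.+1%:R^-1).
have t0 : 0 < t by exact: powR_gt0.
have t1 : t < 1.
  by rewrite /t /powR pnatr_eq0/= expR_lt1 pmulr_llt0 ?subr_lt0// ln_gt0// ltr1n.
exists (2 * (1 - t)^-1); first by rewrite mulr_gt0// invr_gt0 subr_gt0.
move=> S; apply: le_trans (_ : \sum_(s < S) 2 * t ^+ s <= _); last first.
  by rewrite -mulr_sumr ler_wpM2l// geometric_sum_le// (ltW t0).
apply: ler_sum => s _.
have two x y : (2 : R) `^ (x + y) = 2 `^ x * 2 `^ y by rewrite powRD// pnatr_eq0 implybT.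
have -> : (2 ^+ (s %/ m.+1))^-1 = (2 : R) `^ (- (s %/ m.+1)%:R) by rewrite powR_invn.
rewrite -[(2 `^ c) ^+ _]powR_mulrn ?powR_ge0// -[t ^+ _]powR_mulrn ?powR_ge0//.
rewrite /t -!powRrM -two -[X in _ <= X * _](@powRr1 _ 2)// -two.
apply: ler_powR; first by rewrite ler1n.
rewrite mulrBl addrCA [leLHS]addrC lerD2l.
rewrite lerBrDr addrC -lerBrDr opprK mulrC ler_pdivrMr// [1 + _]addrC natr1 -natrM ler_nat.
by rewrite ltnW// ltn_ceil.
Qed.

Context {n : nat}.
Local Notation V := 'rV[R]_n.
Variables (m : nat) (e : 'I_m.+1 -> 'I_n) (inj_e : injective e).

Definition cyc (s : nat) : 'I_n := e (Ordinal (ltn_pmod s (ltn0Sn m))).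

Lemma cyc_chain_lev lev0 S (b : 'I_m.+1) :
  (lev0 (e b) + S %/ m.+1 <= chain_lev lev0 cyc S (e b))%N.
Proof.
rewrite leq_add2l (leq_trans (cyclic_count S (ltn_ord b)))//.
by apply: leq_sum => r _; rewrite /cyc inj_eq//.
Qed.

Lemma cyc_chain_side lev0 s : @chain_side R n lev0 cyc s <=
  (2 ^+ lev0 (cyc s))^-1 * (2 ^+ (s %/ m.+1))^-1.
Proof.
rewrite /chain_side -invfM -exprD lef_pV2 ?posrE ?exprn_gt0//.
by rewrite ler_weXn2l ?ler1n// cyc_chain_lev.
Qed.
End cyclic_halving.

Section means.
Context {R : realType} {n : nat}.
Local Notation V := 'rV[R]_n.
Local Notation mu := (@lebesgue_measure_rV R n).
Implicit Types (lev : 'I_n -> nat) (h u : V -> R).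

Lemma integrable_cst_fin (D : set V) (c : R) : measurable D -> (mu D < +oo)%E ->
  mu.-integrable D (EFin \o cst c).
Proof.
move=> mD muD; apply: measurable_bounded_integrable => //.
exists `|c|; split; first exact: num_real.
by move=> M cM x _ /=; apply: ltW.
Qed.

Lemma integrable_sum_Rintegral (D : set V) (T : Type) (r : seq T) (F : T -> V -> R) :
  measurable D -> (forall t, mu.-integrable D (EFin \o F t)) ->
  mu.-integrable D (EFin \o (fun x => \sum_(t <- r) F t x)) /\
  (\int[mu]_(x in D) \sum_(t <- r) F t x)%R = \sum_(t <- r) (\int[mu]_(x in D) F t x)%R.
Proof.
move=> mD iF; elim: r => [|t r [ih1 ih2]].
  rewrite big_nil (_ : (fun x => _) = cst 0); last by apply/funext => x; rewrite big_nil.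
  by split; [exact: integrable0|rewrite Rintegral_cst// mul0r].
have E : (fun x => \sum_(t <- t :: r) F t x) = (fun x => F t x + \sum_(t <- r) F t x).
  by apply/funext => x; rewrite big_cons.
rewrite E big_cons RintegralD// ih2; split => //.
by have := integrableD mD (iF t) ih1; apply: eq_integrable.
Qed.

Lemma measurable_dcell lev z : measurable (dcell lev z : set V).
Proof. exact: measurable_cell. Qed.

Lemma dcell_lty lev z : (mu (dcell lev z) < +oo)%E.
Proof. by rewrite measure_dcell ltry. Qed.

Lemma mean_dcellE lev z h : mean (dcell lev z) h =
  (dvol lev)^-1 * (\int[mu]_(x in dcell lev z) h x)%R.
Proof. by rewrite /mean measure_dcell. Qed.

Lemma le_mean_dcell lev z h u : mu.-integrable (dcell lev z) (EFin \o h) ->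
  mu.-integrable (dcell lev z) (EFin \o u) -> (forall x, dcell lev z x -> h x <= u x) ->
  mean (dcell lev z) h <= mean (dcell lev z) u.
Proof.
move=> ih iu hu; rewrite !mean_dcellE ler_wpM2l ?invr_ge0 ?(ltW (dvol_gt0 _))//.
by apply: le_Rintegral => //; exact: measurable_dcell.
Qed.

Lemma mean_dist (D : set V) u (c eta : R) : measurable D -> (mu D < +oo)%E ->
  0 < fine (mu D) -> mu.-integrable D (EFin \o u) ->
  (forall x, D x -> `|u x - c| <= eta) -> `|mean D u - c| <= eta.
Proof.
move=> mD muD D0 iu uc.
have ic k := integrable_cst_fin k mD muD.
have cstE k : (fine (mu D))^-1 * (\int[mu]_(x in D) (cst k x))%R = k.
  by rewrite Rintegral_cst// mulrCA mulVf ?mulr1// gt_eqF.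
rewrite /mean -[X in _ - X]cstE -mulrBr -RintegralB//.
rewrite normrM gtr0_norm ?invr_gt0// -[leRHS]cstE ler_pM2l ?invr_gt0//.
apply: le_trans (le_normr_Rintegral mD _) _; first exact: integrable_EFinB.
by apply: le_Rintegral => //; apply: integrable_norm; exact: integrable_EFinB.
Qed.

Lemma mean_dcell_dist lev z u (c eta : R) : mu.-integrable (dcell lev z) (EFin \o u) ->
  (forall x, dcell lev z x -> `|u x - c| <= eta) -> `|mean (dcell lev z) u - c| <= eta.
Proof.
apply: mean_dist; [exact: measurable_dcell|exact: dcell_lty|].
by rewrite measure_dcell dvol_gt0.
Qed.

Lemma compact_dbox lev z : compact (dbox lev z : set V).
Proof. exact: compact_rV_box. Qed.

Lemma dcell_sub_dbox lev z : dcell lev z `<=` (dbox lev z : set V).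
Proof. exact: cell_sub_box. Qed.

Lemma locally_integrable_dcell (U : set V) lev z u : measurable U ->
  locally_integrable_on U u -> dbox lev z `<=` U -> mu.-integrable (dcell lev z) (EFin \o u).
Proof.
move=> mU lu zU; have mB := measurable_rV_box (dy_lo lev z : V) (dy_hi lev z).
apply: (integrableS mB (measurable_dcell _ _) (@dcell_sub_dbox _ _)).
exact: compact_integrable mU lu (@compact_dbox _ _) mB zU.
Qed.

Lemma covered_setU (A B : set V) (a b : \bar R) :
  covered A a -> covered B b -> covered (A `|` B) (a + b)%E.
Proof.
move=> [A' [mA AA Aa]] [B' [mB BB Bb]]; exists (A' `|` B'); split.
- exact: measurableU.
- exact: setUSS.
by apply: le_trans (measureU2 _ _ _) _ => //; exact: leeD.
Qed.

Lemma covered_dcell_mean lev z h : mu.-integrable (dcell lev z) (EFin \o h) ->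
  1 <= mean (dcell lev z) h -> covered (dcell lev z) (\int[mu]_(x in dcell lev z) (h x)%:E).
Proof.
move=> ih; rewrite mean_dcellE ler_pdivlMl ?dvol_gt0// mulr1 => h1.
have mD := measurable_dcell lev z.
exists (dcell lev z); split => //; rewrite measure_dcell.
by rewrite -(fineK (integrable_fin_num mD ih)) lee_fin.
Qed.

Lemma covered_ge1 (D : set V) h : measurable D -> measurable_fun D h ->
  (forall x, D x -> 1 <= h x) -> covered D (\int[mu]_(x in D) (h x)%:E).
Proof.
move=> mD mh h1; exists D; split => //.
rewrite -[leLHS]mul1e -integral_cst//; apply: ge0_le_integral => //.
exact/measurable_EFinP.
Qed.

Lemma negligible_bigcup_count (T : countType) (F : T -> set V) :
  (forall t, mu.-negligible (F t)) -> mu.-negligible (\bigcup_t F t).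
Proof.
move=> F0; pose G k := if @unpickle T k is Some t then F t else set0.
apply: negligibleS (_ : mu.-negligible (\bigcup_k G k)).
  by move=> x [t _ Fx]; exists (pickle t) => //; rewrite /G pickleK.
apply: negligible_bigcup => k; rewrite /G; case: unpickle => // ; exact: negligible_set0.
Qed.

Lemma dcell_mono lev lev' z (x : V) : (forall i, (lev i <= lev' i)%N) ->
  dcell lev z x -> dcell lev' (dy_index lev' x) `<=` (dcell lev z : set V).
Proof.
move=> ll zx y /mem_dcell E; apply/mem_dcell; move/mem_dcell : zx => ->.
exact: dy_index_mono E.
Qed.

Lemma chain_lev_ge lev0 (js : nat -> 'I_n) s i : (lev0 i <= chain_lev lev0 js s i)%N.
Proof. exact: leq_addr. Qed.

Lemma chain_lev_homo lev0 (js : nat -> 'I_n) s t i : (s <= t)%N ->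
  (chain_lev lev0 js s i <= chain_lev lev0 js t i)%N.
Proof.
move=> st; rewrite leq_add2l -!(big_mkord xpredT (fun r => nat_of_bool (js r == i))).
by rewrite [leqRHS](big_cat_nat (n := s))//= leq_addr.
Qed.

(* Weak-type bound for the maximal function along a chain of halvings: a point
   is charged to the first cell of its chain on which the mean is large. *)
Lemma covered_maximal lev lev0 (js : nat -> 'I_n) S z h (eps : R) :
  (forall i, (lev i <= lev0 i)%N) -> 0 < eps ->
  mu.-integrable (dcell lev z) (EFin \o h) -> (forall x, 0 <= h x) ->
  covered [set y | dcell lev z y /\ (eps < h y \/ exists2 s, (s < S)%N &
      eps < mean (dcell (chain_lev lev0 js s) (dy_index (chain_lev lev0 js s) y)) h)]
    (2 * (eps^-1 * (\int[mu]_(x in dcell lev z) h x)%R))%:E.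
Proof.
move=> ll e0 ih h0; set Q := dcell lev z; set g := fun x => eps^-1 * h x.
have mQ : measurable Q by exact: measurable_dcell.
have ig : mu.-integrable Q (EFin \o g) by exact: (integrableZl mQ eps^-1 ih).
have mg : measurable_fun Q g by apply/measurable_EFinP; exact: measurable_int ig.
have mh : measurable_fun Q h by apply/measurable_EFinP; exact: measurable_int ih.
have g0 x : Q x -> 0 <= g x by move=> _; rewrite mulr_ge0// invr_ge0 ltW.
have gE : (\int[mu]_(x in Q) (g x)%:E)%E = (eps^-1 * (\int[mu]_(x in Q) h x)%R)%:E.
  by rewrite -RintegralZl// fineK//; exact: integrable_fin_num.
rewrite mulr_natl mulr2n EFinD -gE.
pose lv s := chain_lev lev0 js s.
have lvl s i : (lev i <= lv s i)%N by apply: leq_trans (ll i) _; exact: chain_lev_ge.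
pose P (t : nat * {ffun 'I_n -> int}) := exists2 y, Q y & [/\ t.2 = dy_index (lv t.1) y,
  eps < mean (dcell (lv t.1) t.2) h &
  forall r, (r < t.1)%N -> ~ eps < mean (dcell (lv r) (dy_index (lv r) y)) h].
pose D (t : nat * {ffun 'I_n -> int}) : set V := dcell (lv t.1) t.2.
have c1 : covered [set x | exists2 t, P t & D t x] (\int[mu]_(x in Q) (g x)%:E).
  apply: (covered_bigcup (D := D) mQ mg g0) => [[s w] [y Qy [/= -> h1 _]]|].
    have DQ : D (s, dy_index (lv s) y) `<=` Q by exact: dcell_mono.
    have mD := measurable_dcell (lv s) (dy_index (lv s) y).
    have iD := integrableS mQ mD DQ ih.
    split => //; apply: covered_dcell_mean; first exact: integrableS mQ mD DQ ig.
    rewrite mean_dcellE RintegralZl// mulrCA -mean_dcellE.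
    by rewrite ler_pdivlMl// mulr1 ltW.
  (* Two selected cells of different steps that meet are nested, and the coarser one, whose mean is
     already large, contradicts the choice of the finer one as first. *)
  have key (s s' : nat) (y y' x : V) : dy_index (lv s) y = dy_index (lv s) x ->
      dy_index (lv s') y' = dy_index (lv s') x -> (s < s')%N ->
      eps < mean (dcell (lv s) (dy_index (lv s) y)) h ->
      (forall r, (r < s')%N -> ~ eps < mean (dcell (lv r) (dy_index (lv r) y')) h) -> False.
    move=> E E' ss' b /(_ _ ss'); apply.
    by rewrite (dy_index_mono (fun i => chain_lev_homo lev0 js i (ltnW ss')) E') -E.
  move=> [s w] [s' w'] x [y Qy [/= -> b1 b2]] [y' Qy' [/= -> b1' b2']].
  rewrite /D/= => /mem_dcell E /mem_dcell E'.
  have [ss|ss|ss] := ltngtP s s'; last by rewrite E E' ss.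
  - by case: (key _ _ _ _ _ E E' ss b1 b2').
  - by case: (key _ _ _ _ _ E' E ss b1' b2).
pose B := Q `&` [set y | eps < h y].
have mB : measurable B.
  have := mh mQ `]eps, +oo[%classic (measurable_itv _); congr measurable.
  by rewrite /B; congr (_ `&` _); apply/seteqP; split => x /=; rewrite in_itv/= andbT.
have BQ : B `<=` Q by move=> x [].
have c2 : covered B (\int[mu]_(x in Q) (g x)%:E).
  apply: covered_le (_ : covered B (\int[mu]_(x in B) (g x)%:E)) _ _ => //.
    apply: covered_ge1 => //; first exact: measurable_funS mg.
    by move=> x [_ /= /ltW hx]; rewrite /g ler_pdivlMl// mulr1.
  by apply: ge0_subset_integral => //; exact/measurable_EFinP.
apply: (covered_le (covered_setU c1 c2) _ (lexx _)) => y [Qy [hy|[s sS hs]]]; first by right.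
left; have exs : exists s, `[< eps < mean (dcell (lv s) (dy_index (lv s) y)) h >].
  by exists s; apply/asboolP.
have [s1 /asboolP s1P s1m] := ex_minnP exs.
exists (s1, dy_index (lv s1) y); last exact: dcell_dy_index.
exists y => //; split => // r rs /asboolP /s1m; rewrite leqNgt.
by rewrite rs.
Qed.
End means.

Section singular_gradient.
Context {R : realType} {n' : nat}.
Local Notation n := n'.+1.
Local Notation V := 'rV[R]_n.
Local Notation mu := (@lebesgue_measure_rV R n).
Local Notation js := (@cyc n n' id).
Local Notation lv l s := (chain_lev (ulev l) js s).
Implicit Types (f : V -> V) (Df : V -> 'M[R]_n) (U E G : set V).

Lemma dvol_ulev l : @dvol R n (ulev l) = ((2 ^+ l)^-1) ^+ n.
Proof. by rewrite /dvol (eq_bigr (fun=> (2 ^+ l)^-1))// prodr_const card_ord. Qed.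

(** Along the chain of cells from [z] to a point [y] of [G], the linear terms add up to [c] applied
    to a vector of size [K * 2 ^ - l]. Replacing [c] by [Df] at one fixed point of [G], where the
    determinant vanishes, places the whole image near one degenerate affine image. *)
Lemma covered_singular_cell (L : R) : 0 <= L -> exists2 C, 0 <= C &
  forall U f Df l z S (eps : R) (c : 'I_n -> 'I_n -> R) G, measurable U ->
  weak_gradient U f Df -> dbox (ulev l) z `<=` U -> 0 < eps <= 1 ->
  G `<=` dcell (ulev l) z ->
  (forall y, G y -> [/\ \det (Df y) = 0, forall i j, `|Df y i j| <= L,
     forall i j, `|Df y i j - c i j| <= eps,
     forall s i j, (s < S)%N ->
       mean (dcell (lv l s) (dy_index (lv l s) y)) (fun x => `|Df x i j - c i j|) <= eps &
     forall y' i, dcell (lv l S) (dy_index (lv l S) y) y' ->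
       `|f y' ord0 i - f y ord0 i| <= eps * (2 ^+ l)^-1]) ->
  covered (f @` G) (\int[mu]_(x in dcell (ulev l) z) (C * eps)%:E).
Proof.
move=> L0; have [|K K0 KP] := @cyclic_geometric_bound R n' 0.
  by rewrite lexx/= invr_gt0 ltr0n.
(* The summands of [Kt] account for the value at [y] against the last mean, the oscillation of the
   gradient along the chain, and the replacement of [c]. *)
pose r0 := n%:R * L + 1; pose Kt := 1 + K + n%:R * K.
have r00 : 0 < r0 by rewrite /r0 ltr_wpDl// mulr_ge0.
have Kt0 : 0 < Kt by rewrite !addr_gt0// mulr_gt0.
have KKt : K <= Kt by rewrite /Kt addrAC lerDr addr_ge0// mulr_ge0// ltW.
pose C := (2 * r0) ^+ n.-1 * (2 * (n%:R * (1 + 2 * r0))) * Kt ^+ n.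
have C0 : 0 <= C.
  have h : 0 <= 2 * r0 by rewrite mulr_ge0// ltW.
  by rewrite /C !mulr_ge0// ?exprn_ge0// ?(ltW Kt0)// addr_ge0.
exists C.
  exact: C0.
move=> U f Df l z S eps c G mU wf zU /andP[eps0 eps1] Gz GP.
pose r : R := (2 ^+ l)^-1; have r_gt0 : 0 < r by rewrite invr_gt0 exprn_gt0.
have [[x0 Gx0]|G0] := pselect (exists x, G x); last first.
  apply: covered_le (@covered0 R n) _ _.
    by move=> y [x Gx _]; apply: G0; exists x.
  by apply: integral_ge0 => x _; rewrite lee_fin mulr_ge0// ltW.
have [d0 DL Dc _ _] := GP _ Gx0.
pose a : V := \row_i mean (dcell (ulev l) z) (fun x => f x ord0 i).
have rho0 : 0 < Kt * r by exact: mulr_gt0.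
have eps01 : 0 < eps <= 1 by apply/andP.
apply: (covered_le (covered_degenerate_affine a d0 DL rho0 eps01)); last first.
  rewrite integral_cst; last exact: measurable_dcell.
  rewrite [X in (_ * X)%E](_ : _ = (@dvol R n (ulev l))%:E); last exact: measure_dcell.
  rewrite -EFinM lee_fin dvol_ulev -/r -/r0 /C [(Kt * r) ^+ _]exprMn.
  by rewrite le_eqVlt; apply/orP; left; apply/eqP; ring.
move=> _ [y Gy <-] /=; have [_ _ _ yS yosc] := GP _ Gy.
have [kap kap1 kap2] := @dyadic_chain R n (ulev l) js y.
have yz : dy_index (ulev l) y = z by apply/esym/mem_dcell/Gz.
have side_sum : \sum_(s < S) chain_side (ulev l) js s <= K * r.
  apply: le_trans (_ : \sum_(s < S) ((2 ^+ (s %/ n))^-1 * (2 `^ 0) ^+ s) * r <= _).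
    apply: ler_sum => s _; rewrite powRr0 expr1n mulr1 mulrC.
    exact: (@cyc_chain_side R n n' id).
  by rewrite -mulr_suml ler_wpM2r ?(ltW r_gt0).
have kap_sum : \sum_(s < S) `|kap s| <= K * r.
  by apply: le_trans side_sum; apply: ler_sum => s _; exact: kap1.
(* The same vector for all components [i], because [kap] does not depend on the function. *)
pose xi j := \sum_(s < S) (js s == j)%:R * kap s.
have xi_le j : `|xi j| <= K * r.
  apply: le_trans (ler_norm_sum _ _ _) _; apply: le_trans kap_sum.
  apply: ler_sum => s _; rewrite normrM normr_nat; case: eqP => _; rewrite ?mul1r//.
  by rewrite mul0r.
exists xi; split => [j|i].
  by apply: le_trans (xi_le j) _; rewrite ler_pM2r.
have c_xi : \sum_(s < S) c i (js s) * kap s = \sum_j c i j * xi j.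
  under [RHS]eq_bigr do rewrite mulr_sumr.
  rewrite exchange_big/=; apply: eq_bigr => s _.
  rewrite (bigD1 (js s))//= eqxx mul1r big1 ?addr0// => j.
  by rewrite eq_sym => /negbTE ->; rewrite mul0r mulr0.
have B U' : U' = dbox (ulev l) (dy_index (ulev l) y) -> U' `<=` U by move=> ->; rewrite yz.
have wp s : weak_partial U (js s) (fun x => f x ord0 i) (fun x => Df x i (js s)) by exact: wf.
have h1 := kap2 U (fun x => f x ord0 i) (fun j x => Df x i j) (c i) mU wp (B _ erefl) S.
have lfi : locally_integrable_on U (fun x => f x ord0 i) by have [] := wf i ord0.
have h2 : `|mean (dcell (lv l S) (dy_index (lv l S) y)) (fun x => f x ord0 i) - f y ord0 i| <= eps * r.
  apply: mean_dcell_dist; last by move=> y'; exact: yosc.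
  apply: (locally_integrable_dcell mU lfi).
  have := @chain_nested_le R n (ulev l) js 0 S y (leq0n S).
  have -> : lv l 0 = ulev l by apply/funext => k; rewrite /chain_lev big_ord0 addn0.
  by move=> h; apply: subset_trans h (B _ erefl).
have h3 : \sum_(s < S) chain_side (ulev l) js s *
    mean (dcell (lv l s) (dy_index (lv l s) y)) (fun x => `|Df x i (js s) - c i (js s)|) <= eps * (K * r).
  apply: le_trans (_ : \sum_(s < S) chain_side (ulev l) js s * eps <= _).
    apply: ler_sum => s _; rewrite ler_wpM2l ?invr_ge0 ?exprn_ge0//.
    exact: yS.
  by rewrite -mulr_suml mulrC ler_pM2l.
have h4 : `|\sum_j (c i j - Df x0 i j) * xi j| <= n%:R * (eps * (K * r)).
  apply: le_trans (ler_norm_sum _ _ _) _.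
  apply: le_trans (_ : \sum_(j < n) eps * (K * r) <= _).
    by apply: ler_sum => j _; rewrite normrM ler_pM// distrC.
  by rewrite sumr_const card_ord mulr_natl.
have aE : a ord0 i = mean (dcell (ulev l) (dy_index (ulev l) y)) (fun x => f x ord0 i).
  by rewrite mxE yz.
rewrite aE; set ms := mean (dcell (lv l S) _) _ in h1 h2; set m0 := mean (dcell (ulev l) _) _ in h1 *.
have -> : f y ord0 i - m0 - \sum_j Df x0 i j * xi j =
    - (ms - f y ord0 i) + (ms - m0 - \sum_(s < S) c i (js s) * kap s) +
    \sum_j (c i j - Df x0 i j) * xi j.
  have -> : \sum_j (c i j - Df x0 i j) * xi j = \sum_j c i j * xi j - \sum_j Df x0 i j * xi j.
    by rewrite -sumrB; apply: eq_bigr => j _; rewrite mulrBl.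
  by rewrite c_xi; ring.
apply: le_trans (ler_normD _ _) _.
apply: le_trans (_ : (eps * r + eps * (K * r)) + n%:R * (eps * (K * r)) <= _).
  apply: lerD h4; apply: le_trans (ler_normD _ _) _; rewrite normrN.
  by apply: lerD h2 _; exact: le_trans h1 h3.
by rewrite le_eqVlt; apply/orP; left; apply/eqP; rewrite /Kt; ring.
Qed.

Lemma dbox_ulev_sub l0 l z0 (y : V) U : (l0 <= l)%N -> dcell (ulev l0) z0 y ->
  dbox (ulev l0) z0 `<=` U -> dbox (ulev l) (dy_index (ulev l) y) `<=` U.
Proof.
move=> /subnK <- /mem_dcell -> h; rewrite -/(inner_cells U _ y).
by elim: (l - l0)%N => [|k ih]; [exact: h|rewrite addSn; exact: inner_cells_mono].
Qed.

(** The level [l] is fixed first, to approximate the gradient; then [S], by uniform continuity, so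
    that [f] varies over the last cells by little even compared with [2 ^ - l]. *)
Lemma fine_cells E f Df l0 z0 (eps : R) : open E -> (mu E < +oo)%E ->
  (forall i j, mu.-integrable E (EFin \o (fun x => Df x i j))) ->
  {within dbox (ulev l0) z0, continuous f} -> dbox (ulev l0) z0 `<=` E ->
  0 < eps ->
  exists l S (s : 'I_n * 'I_n -> V -> R), [/\ (l0 <= l)%N,
    forall t, constant_on_cells l (s t),
    forall t, mu.-integrable E (EFin \o s t),
    (\int[mu]_(x in E) \sum_t `|Df x t.1 t.2 - s t x|)%R < eps &
    forall x y i, dbox (ulev l0) z0 x -> dbox (ulev l0) z0 y -> dcell (lv l S) (dy_index (lv l S) x) y ->
      `|f y ord0 i - f x ord0 i| <= eps * (2 ^+ l)^-1].
Proof.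
move=> oE muE iD cf zE eps0; have mE := open_measurable_rV oE.
pose d := eps / (#|{: 'I_n * 'I_n}|.+1)%:R.
have d0 : 0 < d by rewrite divr_gt0.
have /choice[ls lsP] (t : 'I_n * 'I_n) : exists ls : nat * (V -> R), [/\ constant_on_cells ls.1 ls.2,
    mu.-integrable E (EFin \o ls.2) & (\int[mu]_(x in E) `|Df x t.1 t.2 - ls.2 x|)%R < d].
  by have [_ /(_ _ d0)[l [s h]]] := integrable_cells_approx oE muE (iD t.1 t.2); exists (l, s).
pose l := maxn l0 (\max_t (ls t).1).
have er0 : 0 < eps * (2 ^+ l)^-1 by rewrite mulr_gt0// invr_gt0 exprn_gt0.
have [dl dl0 dlP] := compact_uniform_dist (@compact_dbox R n (ulev l0) z0) cf er0.
have [k kP] := pow2_small dl0.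
exists l, (k * n)%N, (fun t => (ls t).2); split.
- exact: leq_maxl.
- move=> t; have [h _ _] := lsP t; apply: constant_on_cells_mono h.
  by apply: leq_trans (leq_maxr _ _); exact: (leq_bigmax t).
- by move=> t; case: (lsP t).
- have [|_ ->] := @integrable_sum_Rintegral R n E _ (index_enum _)
    (fun t x => `|Df x t.1 t.2 - (ls t).2 x|) mE.
    move=> t; have [_ h _] := lsP t.
    by have := integrable_norm (integrable_EFinB mE (iD t.1 t.2) h).
  apply: le_lt_trans (_ : \sum_(t : 'I_n * 'I_n) d < _).
    by apply: ler_sum => t _; case: (lsP t) => _ _ /ltW.
  rewrite sumr_const -mulr_natl /d mulrCA gtr_pMr// ltr_pdivrMr// mul1r ltr_nat.
  exact: ltnSn.
- move=> x y i x0 y0 xy; have := rV_coord_le (f y - f x) i; rewrite !mxE => /le_trans; apply.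
  apply/ltW/dlP => //; apply: rV_norm_lt => // j; rewrite !mxE.
  apply: le_lt_trans (dcell_dist j (dcell_sub_dbox xy) (dcell_sub_dbox (dcell_dy_index _ x))) _.
  apply: kP; rewrite /chain_lev; apply: leq_trans (leq_addl _ _).
  have := cyclic_count (k * n) (ltn_ord j); rewrite mulnK// => /leq_trans; exact.
Qed.

(** Borel-Cantelli: outside a null set a point is good for all late approximations, and the images
    of the good points have measure of order [e m]. Taking lower limits makes the image null. *)
Lemma singular_image_box U E f Df l0 z0 : open E -> (mu E < +oo)%E -> measurable U ->
  E `<=` U -> weak_gradient U f Df ->
  (forall i j, mu.-integrable E (EFin \o (fun x => Df x i j))) ->
  {within dbox (ulev l0) z0, continuous f} -> dbox (ulev l0) z0 `<=` E ->
  mu.-negligible [set x | U x /\ \det (Df x) <> 0] ->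
  exists2 N, mu.-negligible N & mu.-negligible (f @` (dcell (ulev l0) z0 `\` N)).
Proof.
move=> oE muE mU EU wf iD cf zE nD; set Q := dcell (ulev l0) z0.
have mE := open_measurable_rV oE; have mQ : measurable Q by exact: measurable_dcell.
have zb : Q `<=` dbox (ulev l0) z0 by exact: dcell_sub_dbox.
have QE : Q `<=` E := subset_trans zb zE.
pose e (m : nat) : R := (2 ^+ m)^-1.
have e0 m : 0 < e m by rewrite invr_gt0 exprn_gt0.
have e1 m : e m <= 1 by rewrite invf_le1 ?exprn_gt0// exprn_ege1// ler1n.
(* The error is the square of [e m], so that the weak-type bound at level [e m] leaves an
   exceptional set of measure at most [2 * e m], which is summable. *)
have /choice[dat datP] m : exists d : nat * nat * ('I_n * 'I_n -> V -> R), [/\ (l0 <= d.1.1)%N,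
    forall t, constant_on_cells d.1.1 (d.2 t), forall t, mu.-integrable E (EFin \o d.2 t),
    (\int[mu]_(x in E) \sum_t `|Df x t.1 t.2 - d.2 t x|)%R < e m * e m &
    forall x y i, dbox (ulev l0) z0 x -> dbox (ulev l0) z0 y ->
      dcell (lv d.1.1 d.1.2) (dy_index (lv d.1.1 d.1.2) x) y ->
      `|f y ord0 i - f x ord0 i| <= (e m * e m) * (2 ^+ d.1.1)^-1].
  have [l [S [s h]]] := fine_cells oE muE iD cf zE (mulr_gt0 (e0 m) (e0 m)).
  by exists (l, S, s).
pose l m := (dat m).1.1; pose S m := (dat m).1.2; pose s m := (dat m).2.
pose h m x := \sum_t `|Df x t.1 t.2 - s m t x|.
have h0 m x : 0 <= h m x by apply: sumr_ge0.
have ih m : mu.-integrable E (EFin \o h m).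
  have [|//] := @integrable_sum_Rintegral R n E _ (index_enum _)
    (fun t x => `|Df x t.1 t.2 - s m t x|) mE.
  move=> t; have [_ _ /(_ t) is_ _ _] := datP m.
  by have := integrable_norm (integrable_EFinB mE (iD t.1 t.2) is_).
have ihQ m : mu.-integrable Q (EFin \o h m) by exact: integrableS (ih m).
have hle m x i j : `|Df x i j - s m (i, j) x| <= h m x.
  by rewrite /h (bigD1 (i, j))//= lerDl sumr_ge0.
have /choice[B BP] m : exists B, [/\ measurable B,
    [set y | Q y /\ (e m < h m y \/ exists2 r, (r < S m)%N &
      e m < mean (dcell (lv (l m) r) (dy_index (lv (l m) r) y)) (h m))] `<=` B &
    (mu B <= (4 / (2 ^ m.+1)%:R)%:E)%E].
  have [l0l _ _ hm _] := datP m.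
  have [B [mB sB muB]] := covered_maximal js (S m) (fun i : 'I_n => l0l : ulev l0 i <= ulev (l m) i)%N
    (e0 m) (ihQ m) (h0 m).
  exists B; split => //; apply: le_trans muB _; rewrite lee_fin.
  have -> : 4 / (2 ^ m.+1)%:R = 2 * e m.
    by rewrite natrX exprS /e; field; rewrite expf_neq0.
  rewrite ler_pM2l// ler_pdivrMl//; apply: le_trans (ltW hm).
  have mh : measurable_fun E (EFin \o h m) by exact: measurable_int (ih m).
  rewrite /Rintegral fine_le//; [exact: integrable_fin_num (ihQ m)|exact: integrable_fin_num (ih m)|].
  by apply: ge0_subset_integral => // x _; rewrite lee_fin.
have B0 : mu (lim_sup_set B) = 0.
  apply: lim_sup_set_cvg0 => [m|]; first by case: (BP m).
  apply: (@le_lt_trans _ _ (\sum_(m <oo) (0 + (4 / (2 ^ m.+1)%:R)%:E))%E).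
    by apply: lee_nneseries => // m _; rewrite add0e; case: (BP m).
  apply: le_lt_trans (epsilon_trick xpredT _ _) _ => //.
  by rewrite eseries0// add0e ltry.
exists (lim_sup_set B `|` [set x | U x /\ \det (Df x) <> 0]).
  apply: negligibleU => //; exists (lim_sup_set B); split => //.
  apply: bigcap_measurable => // k _; apply: bigcup_measurable => j _.
  by case: (BP j).
(* The covering constant depends on a bound of the gradient, so the good points are sorted by [L]
   and the null images united afterwards. *)
pose G (L m : nat) := [set y | Q y /\ [/\ ~ B m y, \det (Df y) = 0 &
  forall i j, `|Df y i j| <= L%:R]].
apply: (@negligibleS _ _ _ _ (\bigcup_L f @` [set y | exists k, forall m, (k <= m)%N -> G L m y])).
  move=> _ [y [Qy /not_orP[nB nd]] <-].
  exists (Num.truncn (\sum_i \sum_j `|Df y i j|)).+1 => //; exists y => //.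
  have [k kP] : exists k, forall m, (k <= m)%N -> ~ B m y.
    apply: contrapT => hk; apply: nB => k _; apply: contrapT => hB.
    by apply: hk; exists k => m km Bm; apply: hB; exists m.
  exists k => m km; split => //; split; first exact: kP.
    by apply: contrapT => dn; apply: nd; split => //; apply: EU; exact: QE.
  move=> i j; apply: le_trans (ltW (truncnS_gt _)).
  rewrite (bigD1 i)//= (bigD1 j)//= -addrA lerDl addr_ge0// ?sumr_ge0// => i' _.
  exact: sumr_ge0.
apply: negligible_bigcup => L; apply: covered_negligible => eps eps0.
have [C C0 CP] := covered_singular_cell (ler0n R L).
have v0 : 0 <= C * dvol (ulev l0 : 'I_n -> nat) by rewrite mulr_ge0// ltW// dvol_gt0.
have v1 : 0 < 1 + C * dvol (ulev l0 : 'I_n -> nat) by rewrite ltr_wpDr.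
have [k0 k0P] := pow2_small (divr_gt0 eps0 v1).
suff cov k : covered (f @` G L (k + k0)%N) eps%:E.
  apply: (covered_le (covered_liminf cov)) (lexx _) => _ [y [k kP] <-].
  by exists k => m km; exists y => //; apply: kP; rewrite (leq_trans km)// leq_addr.
move: (k + k0)%N (leq_addl k k0) => m {k} k0m.
have [l0l sc _ _ osc] := datP m.
have cov : covered [set x | exists2 z, (exists2 y, Q y & z = dy_index (ulev (l m)) y) &
    (f @` (G L m `&` dcell (ulev (l m)) z)) x] (\int[mu]_(x in Q) (cst (C * e m) x)%:E)%E.
  apply: (covered_bigcup (D := fun z => dcell (ulev (l m)) z)) => //.
  - by move=> x _; rewrite /= mulr_ge0// ltW.
  - move=> z [y0 Qy0 zE0]; rewrite zE0.
    have DQ : dcell (ulev (l m)) (dy_index (ulev (l m)) y0) `<=` Q.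
      by apply: dcell_mono Qy0 => i.
    split => //; first exact: measurable_dcell.
    apply: (CP U f Df _ _ (S m) (e m) (fun i j => s m (i, j) y0)) => //.
    + by apply: dbox_ulev_sub Qy0 (subset_trans zE EU).
    + by rewrite e0 e1.
    + move=> y [[Qy [nBy dy Ly]] /mem_dcell yy0].
      have nbad : ~ (e m < h m y \/ exists2 r, (r < S m)%N &
          e m < mean (dcell (lv (l m) r) (dy_index (lv (l m) r) y)) (h m)).
        by move=> bad; apply: nBy; case: (BP m) => _ + _; apply.
      have sE x i j : dy_index (ulev (l m)) x = dy_index (ulev (l m)) y -> s m (i, j) x = s m (i, j) y0.
        by move=> xy; apply: sc; rewrite xy.
      split => //.
      * move=> i j; rewrite -(sE y)//; apply: le_trans (hle m y i j) _.
        by rewrite leNgt; apply/negP => hy; apply: nbad; left.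
      * move=> r i j rS; set D := dcell _ _.
        have DQ' : D `<=` Q.
          by apply: dcell_mono Qy => i'; apply: leq_trans l0l (chain_lev_ge _ _ _ _).
        have mD : measurable D by exact: measurable_dcell.
        apply: le_trans (_ : mean D (h m) <= _).
          apply: le_mean_dcell => //.
          - apply: integrable_norm; apply: integrable_EFinB => //.
              exact: integrableS mE mD (subset_trans DQ' QE) (iD i j).
            by apply: (integrable_cst_fin _ mD); exact: dcell_lty.
          - exact: integrableS mQ mD DQ' (ihQ m).
          - move=> x /mem_dcell xy; rewrite -(sE x i j)//.
            apply/esym; apply: dy_index_mono xy => i'; exact: chain_lev_ge.
        by rewrite leNgt; apply/negP => hy; apply: nbad; right; exists r.
      * move=> y' i yy'; apply: le_trans (osc y y' i _ _ _) _ => //; first exact: zb.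
          apply: zb; apply: dcell_mono yy' => //.
          by move=> i'; apply: leq_trans l0l (chain_lev_ge _ _ _ _).
        by rewrite ler_wpM2r ?invr_ge0 ?exprn_ge0// ler_piMr// ltW.
  - by move=> z z' x _ _ /mem_dcell -> /mem_dcell ->.
apply: (covered_le cov).
  move=> _ [y Gy <-]; exists (dy_index (ulev (l m)) y); first by exists y => //; case: Gy.
  by exists y => //; split => //; exact: dcell_dy_index.
have -> : (\int[mu]_(x in Q) (cst (C * e m) x)%:E)%E = ((C * e m)%:E * mu Q)%E.
  by rewrite -integral_cst.
rewrite [X in (_ * X)%E](_ : _ = (@dvol R n (ulev l0))%:E); last exact: measure_dcell.
rewrite -EFinM lee_fin mulrAC mulrC.
have := k0P m k0m; rewrite -/(e m) ltr_pdivlMr// => /ltW; apply: le_trans.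
by rewrite ler_pM2l// lerDr.
Qed.

(** Localization by pairs of nested dyadic boxes: the outer one, compact in [U], makes the gradient
    integrable, and its interior is the open set of finite measure around the inner one. Points on
    dyadic faces join the null set. *)
Theorem singular_image U f Df : open U -> {within U, continuous f} ->
  weak_gradient U f Df -> mu.-negligible [set x | U x /\ \det (Df x) <> 0] ->
  exists2 N, mu.-negligible N & mu.-negligible (f @` (U `\` N)).
Proof.
move=> oU cf wf nD; have mU := open_measurable_rV oU.
pose T := (nat * {ffun 'I_n -> int})%type.
pose bx (t : T) : set V := dbox (ulev t.1) t.2.
pose ob (t : T) : set V := open_box (dy_lo (ulev t.1) t.2) (dy_hi (ulev t.1) t.2).
have obx t : ob t `<=` bx t by move=> x /open_box_sub_cell; exact: cell_sub_box.
have oob t : open (ob t).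
  apply/openP_dist => x xo.
  have /choice[d dP] i : exists d : R, 0 < d /\ forall y : R, `|x ord0 i - y| < d ->
      dy_lo (ulev t.1) t.2 ord0 i < y < dy_hi (ulev t.1) t.2 ord0 i.
    have /andP[h1 h2] := xo i.
    exists (Num.min (x ord0 i - dy_lo (ulev t.1) t.2 ord0 i) (dy_hi (ulev t.1) t.2 ord0 i - x ord0 i)).
    split; first by rewrite lt_min !subr_gt0 h1.
    move=> y; rewrite lt_min !ltr_norml => /andP[/andP[? ?] /andP[? ?]].
    by apply/andP; split; lra.
  exists (\big[Num.min/1]_i d i).
    by apply: lt_bigmin => // i _; case: (dP i).
  move=> y xy i; have [_] := dP i; apply.
  apply: le_lt_trans (_ : `|x - y| < _); first by have := rV_coord_le (x - y) i; rewrite !mxE.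
  by apply: lt_le_trans xy _; exact: bigmin_le_cond.
have /choice[N NP] (tt : T * T) : exists N, bx tt.1 `<=` U -> bx tt.2 `<=` ob tt.1 ->
    mu.-negligible N /\ mu.-negligible (f @` (dcell (ulev tt.2.1) tt.2.2 `\` N)).
  have [b1|nb] := pselect (bx tt.1 `<=` U); last by exists set0.
  have [b2|nb] := pselect (bx tt.2 `<=` ob tt.1); last by exists set0.
  have lt0 i := dy_lt (ulev tt.1.1) tt.1.2 i : _ < _ :> R.
  have muo : (mu (ob tt.1) < +oo)%E.
    apply: le_lt_trans (rV_box_lty (fun i => ltW (lt0 i))).
    apply: le_measure; rewrite ?inE; [exact: measurable_open_box|exact: measurable_rV_box|exact: obx].
  have [||N N1 N2] := singular_image_box (oob tt.1) muo mU (subset_trans (@obx _) b1) wf _ _ b2 nD.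
  - move=> i j; have [_ lw _] := wf i j.
    apply: (integrableS (@measurable_rV_box R n _ _) (@measurable_open_box R n _ _) (@obx tt.1)).
    by apply: (compact_integrable mU lw _ (@measurable_rV_box R n _ _) b1); exact: compact_rV_box.
  - apply: continuous_subspaceW cf; apply: subset_trans b2 _.
    exact: subset_trans (@obx _) b1.
  by exists N.
pose N' := \bigcup_tt (if `[< bx tt.1 `<=` U /\ bx tt.2 `<=` ob tt.1 >] then N tt else set0).
pose bd := \bigcup_t (bx t `\` ob t).
exists (N' `|` bd).
  apply: negligibleU; apply: negligible_bigcup_count => t.
    case: asboolP => [[b1 b2]|_]; last exact: negligible_set0.
    by have [] := NP t b1 b2.
  exists (bx t `\` ob t); split => //.
    by apply: measurableD; [exact: measurable_rV_box|exact: measurable_open_box].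
  by apply: rV_box_negligible_boundary => i; exact/ltW/dy_lt.
apply: negligibleS (_ : mu.-negligible (\bigcup_tt (if `[< bx tt.1 `<=` U /\ bx tt.2 `<=` ob tt.1 >]
    then f @` (dcell (ulev tt.2.1) tt.2.2 `\` N tt) else set0))).
  move=> _ [x [Ux /not_orP[nN nb]] <-].
  have [l /(_ l (leqnn l)) lU] := inner_cells_exhaust oU Ux.
  pose t1 : T := (l, dy_index (ulev l) x).
  have xo : ob t1 x.
    apply: contrapT => nx; apply: nb; exists t1 => //; split => //.
    exact/dcell_sub_dbox/dcell_dy_index.
  have [l' /(_ l' (leqnn l')) lO] := inner_cells_exhaust (oob t1) xo.
  pose t2 : T := (l', dy_index (ulev l') x).
  have hb : bx t1 `<=` U /\ bx t2 `<=` ob t1 by [].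
  exists (t1, t2) => //; rewrite (asboolT hb); exists x => //; split.
    exact: dcell_dy_index.
  by move=> Nx; apply: nN; exists (t1, t2) => //; rewrite (asboolT hb).
apply: negligible_bigcup_count => tt; case: asboolP => [[b1 b2]|_]; last exact: negligible_set0.
by have [] := NP tt b1 b2.
Qed.
End singular_gradient.

(** * Lusin's condition for the partial inverse *)

Section partial_lusin.
Context {R : realType} {n : nat}.
Local Notation V := 'rV[R]_n.
Local Notation mu := (@lebesgue_measure_rV R n).
Implicit Types (lev : 'I_n -> nat) (h u H : V -> R) (U W Y : set V).

Lemma dbox_mono lev lev' z (x : V) : (forall i, (lev i <= lev' i)%N) ->
  dcell lev z x -> dbox lev' (dy_index lev' x) `<=` (dbox lev z : set V).
Proof.
move=> ll zx y xy i; have DQ := dcell_mono ll zx.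
have := xy i; rewrite !in_itv/= => /andP[a' b']; set z' := dy_index lev' x in DQ a' b' *.
have h2 : dcell lev' z' (dy_hi lev' z' : V) by exact: dy_hi_cell.
rewrite (le_trans _ a') ?(le_trans b')//; first by have /andP[] := DQ _ h2 i.
rewrite leNgt; apply/negP => lt1.
(* If the lower face stuck out, this point would belong to the small cell and not to the large
   one. *)
pose x' : V := row_upd (dy_hi lev' z') i (Num.min (dy_lo lev z ord0 i) (dy_hi lev' z' ord0 i)).
have : dcell lev' z' x'.
  move=> j; rewrite [x' _ _]mxE; case: eqP => [->|_]; last exact: h2.
  by rewrite lt_min lt1 dy_lt/= ge_min lexx orbT.
by move=> /DQ/(_ i); rewrite [x' _ _]mxE eqxx lt_min ltxx.
Qed.

Lemma dvol_chain_lev lev0 (js : nat -> 'I_n) s :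
  dvol (chain_lev lev0 js s) = dvol lev0 * (2 ^+ s)^-1 :> R.
Proof.
elim: s => [|s ih].
  by rewrite invr1 mulr1; congr dvol; apply/funext => i; rewrite /chain_lev big_ord0 addn0.
rewrite chain_levS exprS invfM mulrCA -ih /dvol (bigD1 (js s))//= [in RHS](bigD1 (js s))//=.
rewrite /lev_incr eqxx addn1 exprS invfM -mulrA; congr (_ * (_ * _)).
by apply: eq_bigr => i /negbTE; rewrite eq_sym => ->; rewrite addn0.
Qed.

(** A linear substitute for Jensen's inequality: once averaged, with [t ^ q] at least the mean of
    [a ^ q], it bounds the mean of [a] by [2 t]. *)
Lemma le_add_powR (q t a : R) : 1 <= q -> 0 < t -> 0 <= a ->
  a <= t + t `^ (1 - q) * a `^ q.
Proof.
move=> q1 t0 a0; have [at_|ta] := leP a t.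
  by rewrite (le_trans at_)// lerDl mulr_ge0 ?powR_ge0.
have a_gt0 : 0 < a by exact: lt_trans ta.
have q0 : 0 < q by exact: lt_le_trans q1.
apply: le_trans (_ : t `^ (1 - q) * a `^ q <= _); last by rewrite lerDr ltW.
rewrite -(mulr_powRB1 a0 q0) mulrCA -[leLHS]mulr1 ler_pM2l//.
rewrite -opprB powRN -ler_pdivrMl ?invr_gt0 ?powR_gt0// invrK mulr1.
by apply: ge0_ler_powR; rewrite ?subr_ge0// ?nnegrE; exact: ltW.
Qed.

Lemma sub_dcell_mean lev0 (js : nat -> 'I_n) s (y : V) H :
  mu.-integrable (dcell lev0 (dy_index lev0 y)) (EFin \o H) -> (forall x, 0 <= H x) ->
  mean (dcell (chain_lev lev0 js s) (dy_index (chain_lev lev0 js s) y)) H <=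
  2 ^+ s * mean (dcell lev0 (dy_index lev0 y)) H.
Proof.
move=> iH H0; rewrite !mean_dcellE dvol_chain_lev invfM invrK [(dvol _)^-1 * 2 ^+ s]mulrC.
rewrite -mulrA ler_pM2l ?exprn_gt0// ler_pM2l ?invr_gt0 ?dvol_gt0//.
set D := dcell (chain_lev _ _ _) _; set D0 := dcell lev0 _ in iH *.
have mD : measurable D by exact: measurable_dcell.
have mD0 : measurable D0 by exact: measurable_dcell.
have DD : D `<=` D0.
  by apply: dcell_mono (dcell_dy_index _ _) => i; exact: chain_lev_ge.
have iD := integrableS mD0 mD DD iH.
rewrite /Rintegral fine_le//; [exact: integrable_fin_num iD|exact: integrable_fin_num iH|].
apply: ge0_subset_integral => //; first exact: measurable_int iH.
by move=> x _; rewrite lee_fin.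
Qed.

Variables (m : nat) (e : 'I_m.+1 -> 'I_n) (inj_e : injective e) (q K : R).
Hypothesis q1 : 1 <= q.
Hypothesis KP : forall S, \sum_(s < S) (2 ^+ (s %/ m.+1))^-1 * (2 `^ q^-1) ^+ s <= K.
Local Notation js := (cyc e).

(* Only the coordinates in the range of [e] are halved; the side lengths then
   decay like [2 ^ (- s / (m + 1))], which beats the growth [2 ^ (s / q)] of the
   means because [m + 1 < q]. *)
Lemma partial_oscillation U u (w : 'I_n -> V -> R) H lev0 l (y : V) S (eta : R) :
  measurable U -> (forall j, weak_partial U j u (w j)) ->
  (forall k, lev0 (e k) = l) -> dbox lev0 (dy_index lev0 y) `<=` U ->
  (forall x, 0 <= H x) -> (forall j x, `|w j x| `^ q <= H x) ->
  mu.-integrable U (EFin \o H) ->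
  (forall y', dcell (chain_lev lev0 js S) (dy_index (chain_lev lev0 js S) y) y' ->
    `|u y' - u y| <= eta) ->
  `|u y - mean (dcell lev0 (dy_index lev0 y)) u| <=
    eta + (2 ^+ l)^-1 * (2 * K * (1 + mean (dcell lev0 (dy_index lev0 y)) H) `^ q^-1).
Proof.
move=> mU wu el DU H0 wH iH osc; set D0 := dcell lev0 (dy_index lev0 y).
have q0 : 0 < q by exact: lt_le_trans q1.
have mD0 : measurable D0 by exact: measurable_dcell.
have D0U : D0 `<=` U := subset_trans (@dcell_sub_dbox _ _ _ _) DU.
have iH0 := integrableS mU mD0 D0U iH.
set Ym := mean D0 H; pose lam := (1 + Ym) `^ q^-1.
have Ym0 : 0 <= Ym.
  rewrite /Ym mean_dcellE mulr_ge0 ?invr_ge0 ?(ltW (dvol_gt0 _))//.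
  by apply: fine_ge0; apply: integral_ge0 => x _; rewrite lee_fin.
have Ym1 : 0 < 1 + Ym by rewrite ltr_wpDr.
have lam0 : 0 < lam by exact: powR_gt0.
have [kap _ kap2] := @dyadic_chain R n lev0 js y.
(* With [c = 0] no linear part is split off: only the size of the gradient matters here. *)
have h1 := kap2 U u w (fun=> 0) mU (fun s => wu (js s)) DU S.
have lu : locally_integrable_on U u by case: (wu (e ord0)).
have DsU s : dbox (chain_lev lev0 js s) (dy_index (chain_lev lev0 js s) y) `<=` U.
  have := @chain_nested_le R n lev0 js 0 s y (leq0n s).
  have -> : chain_lev lev0 js 0 = lev0 by apply/funext => k; rewrite /chain_lev big_ord0 addn0.
  by move=> h; apply: subset_trans h DU.
have h2 : `|mean (dcell (chain_lev lev0 js S) (dy_index (chain_lev lev0 js S) y)) u - u y| <= eta.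
  by apply: mean_dcell_dist => //; exact: locally_integrable_dcell mU lu (DsU S).
(* After [s] halvings the mean of [H] has grown at most by [2 ^ s]; [t] is chosen so that [t ^ q]
   dominates it. *)
have h3 s : mean (dcell (chain_lev lev0 js s) (dy_index (chain_lev lev0 js s) y))
    (fun x => `|w (js s) x|) <= 2 * ((2 `^ q^-1) ^+ s * lam).
  set D := dcell _ _; set t := (2 `^ q^-1) ^+ s * lam.
  have t0 : 0 < t by rewrite mulr_gt0// exprn_gt0// powR_gt0.
  have tq : t `^ q = 2 ^+ s * (1 + Ym).
    rewrite /t powRM ?(ltW lam0) ?exprn_ge0 ?powR_ge0// /lam -powRrM mulVf ?gt_eqF//.
    rewrite powRr1 ?(ltW Ym1)//; congr (_ * _).
    by rewrite -[_ ^+ s in LHS]powR_mulrn ?powR_ge0// -!powRrM mulrCA mulVf ?gt_eqF// mulr1 powR_mulrn.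
  have mD : measurable D by exact: measurable_dcell.
  have DU' : D `<=` U := subset_trans (@dcell_sub_dbox _ _ _ _) (DsU s).
  have iHD := integrableS mU mD DU' iH.
  have lw : locally_integrable_on U (w (js s)) by case: (wu (js s)).
  have ic := integrable_cst_fin t mD (dcell_lty _ _).
  have iZ : mu.-integrable D (EFin \o (fun x => t `^ (1 - q) * H x)).
    exact: (integrableZl mD _ iHD).
  apply: le_trans (_ : mean D (fun x => t + t `^ (1 - q) * H x) <= _).
    apply: le_mean_dcell.
    - by apply: integrable_norm; exact: locally_integrable_dcell mU lw (DsU s).
    - by have := integrableD mD ic iZ; apply: eq_integrable.
    - move=> x _; apply: le_trans (le_add_powR q1 t0 (normr_ge0 _)) _.
      by rewrite lerD2l ler_wpM2l ?powR_ge0.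
  have -> : mean D (fun x => t + t `^ (1 - q) * H x) = t + t `^ (1 - q) * mean D H.
    rewrite !mean_dcellE RintegralD//.
    rewrite mulrDr RintegralZl// mulrCA; congr (_ + _).
    have E : fine (mu D) = dvol (chain_lev lev0 js s) by rewrite measure_dcell.
    rewrite [X in _ * X](_ : _ = t * fine (mu D)); last by rewrite -Rintegral_cst.
    by rewrite E mulrCA mulVf ?mulr1// gt_eqF// dvol_gt0.
  rewrite mulr_natl mulr2n lerD2l.
  apply: le_trans (_ : t `^ (1 - q) * (2 ^+ s * Ym) <= _).
    by rewrite ler_wpM2l ?powR_ge0//; exact: sub_dcell_mean.
  apply: le_trans (_ : t `^ (1 - q) * t `^ q <= _).
    by rewrite ler_wpM2l ?powR_ge0// tq ler_wpM2l ?exprn_ge0// lerDr.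
  by rewrite -powRD ?subrK ?powRr1 ?(ltW t0)// oner_eq0.
have h4 : \sum_(s < S) chain_side lev0 js s *
    mean (dcell (chain_lev lev0 js s) (dy_index (chain_lev lev0 js s) y))
      (fun x => `|w (js s) x - 0|) <= (2 ^+ l)^-1 * (2 * K * lam).
  apply: le_trans (_ : \sum_(s < S) ((2 ^+ (s %/ m.+1))^-1 * (2 `^ q^-1) ^+ s) *
      ((2 ^+ l)^-1 * (2 * lam)) <= _).
    apply: ler_sum => s _; under eq_fun do rewrite subr0.
    apply: le_trans (_ : ((2 ^+ l)^-1 * (2 ^+ (s %/ m.+1))^-1) * (2 * ((2 `^ q^-1) ^+ s * lam)) <= _).
      apply: ler_pM => //; first by rewrite invr_ge0 exprn_ge0.
        rewrite mean_dcellE mulr_ge0 ?invr_ge0 ?(ltW (dvol_gt0 _))//.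
        by apply: fine_ge0; apply: integral_ge0 => x _; rewrite lee_fin.
      by rewrite -(el (Ordinal (ltn_pmod s (ltn0Sn m)))); exact: cyc_chain_side.
    by rewrite le_eqVlt; apply/orP; left; apply/eqP; ring.
  rewrite -mulr_suml mulrC -!mulrA ler_pM2l ?invr_gt0 ?exprn_gt0//.
  by rewrite ler_pM2l// mulrC ler_pM2r.
rewrite -/lam; set ms := mean (dcell (chain_lev _ _ S) _) _ in h1 h2.
have E : \sum_(s < S) 0 * kap s = 0 by rewrite big1// => s _; rewrite mul0r.
rewrite E subr0 in h1.
have -> : u y - mean D0 u = - (ms - u y) + (ms - mean D0 u) by ring.
by apply: le_trans (ler_normD _ _) _; rewrite normrN lerD// (le_trans h1).
Qed.
End partial_lusin.

Section partial_inverse.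
Context {R : realType} {n : nat}.
Local Notation V := 'rV[R]_n.
Local Notation mu := (@lebesgue_measure_rV R n).
Variables (J : {set 'I_n}) (g : V -> V).

Definition replace_coords (y : V) : V := \row_i (if i \in J then g y ord0 i else y ord0 i).

Variables (U : set V) (Dg : V -> 'M[R]_n) (q : R) (H : V -> R).
Hypotheses (oU : open U) (muU : (mu U < +oo)%E) (cg : {within U, continuous g})
  (wg : weak_gradient U g Dg) (q1 : 1 <= q) (Jq : (#|J|)%:R < q)
  (H0 : forall x, 0 <= H x) (wH : forall i j x, `|Dg x i j| `^ q <= H x)
  (iH : mu.-integrable U (EFin \o H)).

Let mU : measurable U := open_measurable_rV oU.

(** The cell is cut into slabs, thin outside [J]. On a slab the components in [J] vary by
    [2 ^ - l * lam] up to a constant and the other coordinates stay in their intervals, so the image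
    lies in a box of volume comparable to that of the slab times [lam ^ #|J|]. *)
Lemma covered_replace_coords_cell : exists2 C : R, 0 <= C & forall l z,
  dbox (ulev l) z `<=` U ->
  covered (replace_coords @` dcell (ulev l) z)
    (\int[mu]_(x in dcell (ulev l) z) (C * (1 + H x))%:E).
Proof.
have [J0|[j0 j0J]] := set_0Vmem J.
  exists 1 => // l z zU; have mD := measurable_dcell (ulev l) z : measurable (_ : set V).
  have iHD := integrableS mU mD (subset_trans (@dcell_sub_dbox _ _ _ _) zU) iH.
  apply: covered_le (covered_ge1 (h := fun x => 1 * (1 + H x)) mD _ _) _ _ => //.
  - have mHD : measurable_fun (dcell (ulev l) z) H by apply/measurable_EFinP; exact: measurable_int iHD.
    by under eq_fun do rewrite mul1r; exact: measurable_funD.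
  - by move=> x _; rewrite mul1r lerDl.
  - move=> _ [x Dx <-]; rewrite (_ : replace_coords x = x)//.
    by apply/rowP => i; rewrite mxE J0 inE.
have [m mE] : exists m, #|J| = m.+1.
  by exists #|J|.-1; rewrite prednK//; apply/card_gt0P; exists j0.
pose e (k : 'I_m.+1) : 'I_n := enum_val (cast_ord (esym mE) k).
have inj_e : injective e by move=> a b /enum_val_inj /cast_ord_inj.
have eJ k : e k \in J by exact: enum_valP.
have Je j : j \in J -> exists k, e k = j.
  move=> jJ; exists (cast_ord mE (enum_rank_in jJ j)).
  by rewrite /e cast_ordK enum_rankK_in.
have q0 : 0 < q by exact: lt_le_trans q1.
have [|K K0 KP] := @cyclic_geometric_bound R m q^-1.
  by rewrite invr_ge0 (ltW q0)/= ltf_pV2 ?posrE// -mE.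
pose c := 1 + 2 * K.
have c0 : 0 < c by rewrite addr_gt0// mulr_gt0.
exists ((2 * c) ^+ m.+1); first by rewrite exprn_ge0// mulr_ge0// ltW.
move=> l z zU; set Q := dcell (ulev l) z; set C := (2 * c) ^+ m.+1.
have C0 : 0 <= C by rewrite exprn_ge0// mulr_ge0// ltW.
have mQ : measurable Q by exact: measurable_dcell.
have QU : Q `<=` U := subset_trans (@dcell_sub_dbox _ _ _ _) zU.
have r0 : (0 : R) < (2 ^+ l)^-1 by rewrite invr_gt0 exprn_gt0.
have [d d0 dP] := compact_uniform_dist (@compact_dbox R n (ulev l) z)
  (continuous_subspaceW zU cg) r0.
have [k kP] := pow2_small d0.
(* Outside [J] the sides are made smaller than the modulus of continuity [d] at once; only the
   [#|J|] remaining directions are halved and compete with [q]. *)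
pose L := maxn l k; pose lev0 (i : 'I_n) := if i \in J then l else L.
have llev i : (ulev l i <= lev0 i)%N by rewrite /lev0; case: ifP => // _; exact: leq_maxl.
have ihQ : mu.-integrable Q (EFin \o (fun x => C * (1 + H x))).
  have iQ := integrableS mU mQ QU iH.
  have := integrableZl mQ C (integrableD mQ (integrable_cst_fin 1 mQ (dcell_lty _ _)) iQ).
  exact: eq_integrable.
have mhQ : measurable_fun Q (fun x => C * (1 + H x)).
  by apply/measurable_EFinP; exact: measurable_int ihQ.
have cov : covered [set x | exists2 w, (exists2 y, Q y & w = dy_index lev0 y) &
    (replace_coords @` dcell lev0 w) x] (\int[mu]_(x in Q) (C * (1 + H x))%:E)%E.
  apply: (covered_bigcup (D := fun w => dcell lev0 w)) => //.
  - by move=> x _; rewrite mulr_ge0// addr_ge0.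
  - move=> w [y0 Qy0 wE]; rewrite wE; set D := dcell lev0 _.
    have DQ : D `<=` Q by exact: dcell_mono Qy0.
    have mD : measurable D by exact: measurable_dcell.
    split => //.
    have iHD := integrableS mU mD (subset_trans DQ QU) iH.
    pose lam := (1 + mean D H) `^ q^-1.
    have Ym0 : 0 <= mean D H.
      rewrite mean_dcellE mulr_ge0 ?invr_ge0 ?(ltW (dvol_gt0 _))//.
      by apply: fine_ge0; apply: integral_ge0 => x _; rewrite lee_fin.
    have lam1 : 1 <= lam.
      by rewrite -(powRr0 (1 + mean D H)); apply: ler_powR; rewrite ?lerDl// invr_ge0 ltW.
    have lam0 : 0 < lam by exact: lt_le_trans lam1.
    pose rho := (2 ^+ l)^-1 * (c * lam).
    have rho0 : 0 < rho by rewrite !mulr_gt0.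
    pose cen i := mean D (fun x => g x ord0 i).
    pose lo : V := \row_i (if i \in J then cen i - rho else dy_lo lev0 (dy_index lev0 y0) ord0 i).
    pose hi : V := \row_i (if i \in J then cen i + rho else dy_hi lev0 (dy_index lev0 y0) ord0 i).
    have DB : dbox lev0 (dy_index lev0 y0) `<=` (dbox (ulev l) z : set V).
      exact: dbox_mono llev Qy0.
    exists (rV_box lo hi); split; first exact: measurable_rV_box.
      move=> _ [y Dy <-] i; rewrite in_itv/= [lo _ _]mxE [hi _ _]mxE [replace_coords _ _ _]mxE.
      case: ifPn => [iJ|iJ]; last by have /andP[/ltW -> ->] := Dy i.
      have yE : dy_index lev0 y = dy_index lev0 y0 by apply/esym/mem_dcell.
      suff : `|g y ord0 i - cen i| <= rho.
        by rewrite ler_norml => /andP[? ?]; apply/andP; split; lra.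
      have := @partial_oscillation R n m e inj_e q K q1 KP U (fun x => g x ord0 i)
        (fun j x => Dg x i j) H lev0 l y (k * m.+1)%N (2 ^+ l)^-1 mU (wg i).
      rewrite yE -/D -/lam; move=> /(_ _ (subset_trans DB zU) H0 (wH i) iH) h.
      apply: le_trans (h _ _) _.
      - by move=> k'; rewrite /lev0 eJ.
      - move=> y' yy'; have := rV_coord_le (g y' - g y) i; rewrite !mxE => /le_trans; apply.
        have yD' : D y' by apply: dcell_mono yy' => // i'; exact: chain_lev_ge.
        apply/ltW/dP; [exact/dcell_sub_dbox/DQ|exact/dcell_sub_dbox/DQ|].
        apply: rV_norm_lt => // j; rewrite !mxE.
        apply: le_lt_trans (dcell_dist j (dcell_sub_dbox yy') (dcell_sub_dbox (dcell_dy_index _ y))) _.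
        apply: kP; have [jJ|jJ] := boolP (j \in J).
          have [b <-] := Je j jJ.
          apply: leq_trans (cyc_chain_lev inj_e lev0 (k * m.+1) b).
          by rewrite mulnK// leq_addl.
        apply: leq_trans (chain_lev_ge _ _ _ _); rewrite /lev0 (negbTE jJ).
        exact: leq_maxr.
      - rewrite /rho -[X in X + _]mulr1 -mulrDr ler_pM2l// /c [(1 + _) * lam]mulrDl mul1r.
        by rewrite lerD2r.
    have lohi i : lo ord0 i <= hi ord0 i.
      rewrite [lo _ _]mxE [hi _ _]mxE; case: ifP => _; last exact/ltW/dy_lt.
      by rewrite lerD2l ge0_cp// ltW.
    have -> : (\int[mu]_(x in D) (C * (1 + H x))%:E)%E = (C * (dvol lev0 * (1 + mean D H)))%:E.
      have iD := integrableS mQ mD DQ ihQ.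
      rewrite -(fineK (integrable_fin_num mD iD)); congr EFin.
      rewrite -[LHS]/(\int[mu]_(x in D) (C * (1 + H x)))%R.
      have i1 := integrable_cst_fin 1 mD (dcell_lty _ _).
      rewrite RintegralZl//; last by have := integrableD mD i1 iHD; apply: eq_integrable.
      congr (C * _); rewrite RintegralD// mulrDr mulr1 mean_dcellE mulrA mulfV ?gt_eqF ?dvol_gt0//.
      rewrite mul1r; congr (_ + _).
      have E : fine (mu D) = dvol lev0 by rewrite measure_dcell.
      by rewrite -E -[RHS]mul1r -Rintegral_cst.
    rewrite (lebesgue_measure_rV_box lohi) lee_fin.
    have -> : \prod_i (hi ord0 i - lo ord0 i) = dvol lev0 * (2 * (c * lam)) ^+ m.+1.
      rewrite -mE -prodr_const [in RHS]big_mkcond/= /dvol -big_split/=.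
      apply: eq_bigr => i _; rewrite [lo _ _]mxE [hi _ _]mxE.
      have [iJ|iJ] := boolP (i \in J); first by rewrite /lev0 iJ /rho; ring.
      by rewrite mulr1 dy_lo_hi addrAC subrr add0r.
    rewrite mulrA exprMn -/C mulrCA ler_wpM2l// ler_wpM2l ?(ltW (dvol_gt0 _))//.
    (* The summand 1 gives [lam >= 1], so [lam ^ #|J| <= lam ^ q = 1 + mean D H]: the box costs no
       more than the integral over the slab. *)
    rewrite -powR_mulrn ?(ltW lam0)//; apply: le_trans (ler_powR lam1 _) _.
      by apply: (ltW (y := q)); rewrite -mE.
    by rewrite /lam -powRrM mulVf ?gt_eqF// powRr1// addr_ge0.
  - by move=> w w' x _ _ /mem_dcell -> /mem_dcell ->.
apply: (covered_le cov) => // _ [y Qy <-].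
exists (dy_index lev0 y); first by exists y.
by exists y => //; exact: dcell_dy_index.
Qed.

(** An open superset of [Y] with small integral is exhausted by its dyadic cells, each of which
    satisfies the preceding bound. *)
Theorem negligible_replace_coords (Y : set V) : Y `<=` U -> mu.-negligible Y ->
  mu.-negligible (replace_coords @` Y).
Proof.
move=> YU nY; apply: covered_negligible => eps eps0.
have [C C0 CP] := covered_replace_coords_cell.
pose h x := C * (1 + H x).
have h0 x : 0 <= h x by rewrite mulr_ge0// addr_ge0.
have ih : mu.-integrable U (EFin \o h).
  have := integrableZl mU C (integrableD mU (integrable_cst_fin 1 mU muU) iH).
  exact: eq_integrable.
have [W [oW YW WU We]] := negligible_open_superset oU muU ih nY YU eps0.
have mW := open_measurable_rV oW.
have cov l : covered (replace_coords @` inner_cells W l) eps%:E.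
  have mh : measurable_fun W h.
    by apply/measurable_EFinP; exact: measurable_int (integrableS mU mW WU ih).
  have c1 : covered [set x | exists2 z, dbox (ulev l) z `<=` W &
      (replace_coords @` dcell (ulev l) z) x] (\int[mu]_(x in W) (h x)%:E)%E.
    apply: (covered_bigcup (D := fun z => dcell (ulev l) z)) => //.
    - move=> z zW; split; first exact: measurable_dcell.
        exact: subset_trans (@dcell_sub_dbox _ _ _ _) zW.
      exact: CP _ _ (subset_trans zW WU).
    - by move=> z z' x _ _ /mem_dcell -> /mem_dcell ->.
  apply: (covered_le c1).
    move=> _ [x xW <-]; exists (dy_index (ulev l) x) => //.
    by exists x => //; exact: dcell_dy_index.
  apply/ltW; apply: le_lt_trans We; rewrite le_eqVlt; apply/orP; left; apply/eqP.
  by apply: eq_integral => x _; rewrite ger0_norm.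
apply: (covered_le (covered_liminf cov)) (lexx _) => _ [x Yx <-].
have [l lP] := inner_cells_exhaust oW (YW _ Yx).
by exists l => k lk; exists x => //; exact: lP.
Qed.
End partial_inverse.

(** * Images of sets of full measure *)

Section sliding_averages.
Context {R : realType} {n : nat}.
Local Notation V := 'rV[R]_n.
Local Notation mu := (@lebesgue_measure_rV R n).
Implicit Types (x y lo hi : V) (u : V -> R) (U : set V).

(** The cube moves with [x], unlike a dyadic cell, so that the average is a continuous function and
    the covering theorem applies to it. *)
Definition avg (r : R) u x : R := mean (open_box x (x + const_mx r)) u.

Lemma measure_avg_box (r : R) x : 0 < r -> mu (open_box x (x + const_mx r)) = (r ^+ n)%:E.
Proof.
move=> r0; have xr i : x ord0 i <= (x + const_mx r) ord0 i by rewrite !mxE lerDl ltW.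
have [|_ ->] := measure_eq_box xr (measurable_open_box _ _) (@subset_refl _ _).
  by move=> y /open_box_sub_cell; exact: cell_sub_box.
rewrite (lebesgue_measure_rV_box xr); congr EFin.
rewrite (eq_bigr (fun=> r)) ?prodr_const ?card_ord// => i _.
by rewrite !mxE addrAC subrr add0r.
Qed.

Lemma le_Rintegral_subset (A B : set V) u : measurable A -> measurable B -> A `<=` B ->
  mu.-integrable B (EFin \o u) -> (forall x, 0 <= u x) ->
  (\int[mu]_(x in A) u x <= \int[mu]_(x in B) u x)%R.
Proof.
move=> mA mB AB iu u0; have iA := integrableS mB mA AB iu.
rewrite /Rintegral fine_le//; [exact: integrable_fin_num iA|exact: integrable_fin_num iu|].
by apply: ge0_subset_integral => //; [exact: measurable_int iu|move=> x _; rewrite lee_fin].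
Qed.

Lemma avg_translate U u (w : V -> R) (j : 'I_n) (r t : R) x lo hi : measurable U ->
  weak_partial U j u w -> 0 < r -> 0 < t -> rV_box lo hi `<=` U ->
  (forall i, lo ord0 i <= x ord0 i) ->
  (forall i, (x + t *: basis_vec j) ord0 i + r <= hi ord0 i) ->
  `|avg r u (x + t *: basis_vec j) - avg r u x| <=
    t * ((r ^+ n)^-1 * (\int[mu]_(y in rV_box lo hi) `|w y|)%R).
Proof.
move=> mU wu r0 t0 BU lox hix; set b := x + const_mx r; set e := t *: basis_vec j in hix *.
have xb i : x ord0 i < b ord0 i by rewrite !mxE ltrDl.
have [kap _ kapP] := weak_partial_translated_box j xb t0.
have mB := measurable_rV_box lo hi.
have HB : rV_box x (b + e) `<=` rV_box lo hi.
  move=> y xy i; have := xy i; rewrite !in_itv/= => /andP[h1 h2].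
  rewrite (le_trans (lox i) h1) (le_trans h2)//; apply: le_trans (hix i).
  by rewrite !mxE addrAC.
have mH := measurable_rV_box x (b + e).
have := kapP U u w 0 mU wu (subset_trans HB BU).
rewrite mul0r subr0 => h.
have iw : mu.-integrable (rV_box lo hi) (EFin \o w).
  by have [_ lw _] := wu; exact: compact_integrable mU lw (@compact_rV_box R n _ _) mB BU.
have beE : x + e + const_mx r = b + e by rewrite addrAC.
have rE z : fine (mu (open_box z (z + const_mx r))) = r ^+ n by rewrite measure_avg_box.
rewrite /avg /mean rE rE -mulrBr normrM gtr0_norm ?invr_gt0 ?exprn_gt0//.
rewrite mulrCA ler_pM2l ?invr_gt0 ?exprn_gt0// beE; apply: le_trans h _.
rewrite ler_pM2l//; under eq_Rintegral do rewrite subr0.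
by apply: le_Rintegral_subset => //; have := integrable_norm iw.
Qed.

Lemma avg_osc U u (w : 'I_n -> V -> R) (r : R) x y lo hi : measurable U ->
  (forall j, weak_partial U j u (w j)) -> 0 < r -> rV_box lo hi `<=` U ->
  (forall i, lo ord0 i <= x ord0 i) -> (forall i, lo ord0 i <= y ord0 i) ->
  (forall i, x ord0 i + r <= hi ord0 i) -> (forall i, y ord0 i + r <= hi ord0 i) ->
  `|avg r u x - avg r u y| <= \sum_j `|x ord0 j - y ord0 j| *
    ((r ^+ n)^-1 * (\int[mu]_(z in rV_box lo hi) `|w j z|)%R).
Proof.
move=> mU wu r0 BU lox loy hix hiy.
set c := fun j => (r ^+ n)^-1 * (\int[mu]_(z in rV_box lo hi) `|w j z|)%R.
have c0 j : 0 <= c j.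
  rewrite mulr_ge0 ?invr_ge0 ?exprn_ge0 ?(ltW r0)//; apply: fine_ge0.
  by apply: integral_ge0 => z _; rewrite lee_fin.
have step j (s : R) (v v' : V) : v' = v + s *: basis_vec j ->
    (forall i, lo ord0 i <= v ord0 i) -> (forall i, v ord0 i + r <= hi ord0 i) ->
    (forall i, lo ord0 i <= v' ord0 i) -> (forall i, v' ord0 i + r <= hi ord0 i) ->
    `|avg r u v - avg r u v'| <= `|s| * c j.
  move=> v'E lov hiv lov' hiv'; have [s0|s0|s0] := ltrgtP s 0.
  - have vE : v = v' + (- s) *: basis_vec j by rewrite v'E scaleNr addrK.
    have := @avg_translate U u (w j) j r (- s) v' lo hi mU (wu j) r0.
    by rewrite -vE oppr_gt0 (ltr0_norm s0); apply.
  - have := @avg_translate U u (w j) j r s v lo hi mU (wu j) r0.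
    by rewrite -v'E distrC (gtr0_norm s0); apply.
  - by rewrite v'E s0 scale0r addr0 subrr normr0 mulr_ge0.
(* The first [k] coordinates have already been moved from [x] to [y]; consecutive points differ
   along one axis, and all cubes stay in the given box. *)
pose P (k : nat) : V := \row_i (if (i < k)%N then y ord0 i else x ord0 i).
have lP k i : lo ord0 i <= P k ord0 i by rewrite mxE; case: ifP.
have hP k i : P k ord0 i + r <= hi ord0 i by rewrite mxE; case: ifP.
suff h k : (k <= n)%N -> `|avg r u x - avg r u (P k)| <=
    \sum_(j < n | (j < k)%N) `|x ord0 j - y ord0 j| * c j.
  have -> : y = P n by apply/rowP => i; rewrite mxE ltn_ord.
  apply: le_trans (h n (leqnn n)) _; rewrite le_eqVlt; apply/orP; left; apply/eqP.
  by apply: eq_big => j; rewrite ?ltn_ord// mxE ltn_ord.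
elim: k => [_|k ih kn].
  have -> : P 0%N = x by apply/rowP => i; rewrite mxE.
  by rewrite subrr normr0 sumr_ge0// => j _; rewrite mulr_ge0.
pose j := Ordinal kn.
have PS : P k.+1 = P k + (y ord0 j - x ord0 j) *: basis_vec j.
  apply/rowP => i; rewrite !mxE ltnS leq_eqVlt eqxx/= -[(i == k :> nat)]/(i == j).
  case: eqVneq => [->|_]; first by rewrite /= ltnn mulr1 addrCA subrr addr0.
  by rewrite mulr0 addr0.
rewrite (bigD1 j) ?ltnSn//= addrC.
rewrite (_ : avg r u x - _ = (avg r u x - avg r u (P k)) + (avg r u (P k) - avg r u (P k.+1))).
  apply: le_trans (ler_normD _ _) _; apply: lerD.
    apply: le_trans (ih (ltnW kn)) _; rewrite le_eqVlt; apply/orP; left; apply/eqP.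
    apply: eq_bigl => i; rewrite ltnS [in RHS]leq_eqVlt -[(i == k :> nat)]/(i == j).
    by case: eqVneq => [->|_]; rewrite ?ltnn ?andbT ?andbF.
  rewrite [`|x ord0 j - _|]distrC; exact: step PS _ _ _ _.
by rewrite addrA subrK.
Qed.
End sliding_averages.

Section covering_perturbation.
Context {R : realType} {n' : nat}.
Local Notation n := n'.+1.
Local Notation V := 'rV[R]_n.

Definition clamp (s : R) : R := Num.max 0 (Num.min 1 s).

Lemma clamp_itv s : 0 <= clamp s <= 1.
Proof. by rewrite /clamp le_max lexx/= ge_max ler01 ge_min lexx. Qed.

Lemma clamp_lip s t : `|clamp s - clamp t| <= `|s - t|.
Proof.
wlog st : s t / s <= t.
  by move=> h; have [/h//|/ltW/h] := leP s t; rewrite distrC [`|s - t|]distrC.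
suff [h1 h2] : clamp s <= clamp t /\ clamp t - clamp s <= t - s.
  apply: le_trans (_ : t - s <= _); last by rewrite distrC ler_norm.
  by rewrite ler_norml; apply/andP; split; lra.
by rewrite /clamp; case: (leP 1 s) => s1; case: (leP 1 t) => t1; rewrite ?(max_idPr ler01);
  do ?[case: (leP 0 s) => s0]; do ?[case: (leP 0 t) => t0]; split; lra.
Qed.

(* Cutting the perturbation [E] off near the level [r2] of [`|H - z0|] leaves the
   boundary values unchanged, so that the covering theorem applies to the sum. *)
Lemma covering_perturbation (U : set V) (H E : V -> V) (z0 : V) (r1 r2 r3 eta : R) :
  let C0 := [set x | closure U x /\ `|H x - z0| <= r3] in
  open U -> bounded_set U -> {within closure U, continuous H} ->
  (forall x, boundary U x -> H x = x) -> (forall x, boundary U x -> r3 < `|x - z0|) ->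
  r1 < r2 -> r2 < r3 -> {within C0, continuous E} -> (forall x, C0 x -> `|E x| <= eta) ->
  0 <= eta -> eta <= r2 - r1 ->
  forall z, U z -> `|z - z0| <= r1 - eta ->
  exists x, [/\ U x, `|H x - z0| <= r1 & z = H x + E x].
Proof.
move=> C0 oU bU cH Hid Ud r12 r23 cE Ee eta0 eta12.
have d0 : 0 < r2 - r1 by rewrite subr_gt0.
pose chi x := clamp ((r2 - `|H x - z0|) / (r2 - r1)).
have chi0 x : r2 <= `|H x - z0| -> chi x = 0.
  move=> h; rewrite /chi /clamp max_l// ge_min; apply/orP; right.
  by rewrite ler_pdivrMr// mul0r subr_le0.
have chi1 x : `|H x - z0| <= r1 -> chi x = 1.
  move=> h; rewrite /chi /clamp min_l ?max_r//.
  by rewrite ler_pdivlMr// mul1r lerD2l lerN2.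
have chi_lip x y : `|chi y - chi x| <= `|H y - H x| / (r2 - r1).
  apply: le_trans (clamp_lip _ _) _; rewrite -mulrBl normrM [`|_^-1|]gtr0_norm ?invr_gt0//.
  rewrite ler_pM2r ?invr_gt0//.
  have -> : r2 - `|H y - z0| - (r2 - `|H x - z0|) = `|H x - z0| - `|H y - z0| by ring.
  apply: le_trans (ler_dist_dist _ _) _.
  by rewrite [leRHS]distrC opprB addrA subrK.
pose Phi x := H x + chi x *: E x.
(* [E] is controlled on [C0] only. Where [H] is at distance at least [r3] from [z0], the cut-off
   vanishes at all nearby points, so [E] does not enter. *)
have cPhi : {within closure U, continuous Phi}.
  apply: continuous_withinP => x e clx e0; have [xr3|xr3] := ltP `|H x - z0| r3.
    have e4 : 0 < Num.min (e / 4) (r3 - `|H x - z0|) by rewrite lt_min divr_gt0// subr_gt0.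
    have [da da0 daP] := within_continuous_dist cH clx e4.
    have e2 : 0 < e / 2 by rewrite divr_gt0.
    have C0x : C0 x by split => //; exact: ltW.
    have [db db0 dbP] := within_continuous_dist cE C0x e2.
    exists (Num.min da db); first by rewrite lt_min da0.
    move=> y cly; rewrite lt_min => /andP[xda xdb].
    have := daP y cly xda; rewrite lt_min => /andP[h1 h2].
    have C0y : C0 y.
      split => //; rewrite -(subrK (H x) (H y)) -addrA (le_trans (ler_normD _ _))//.
      by rewrite distrC -lerBrDr ltW.
    have h3 := dbP y C0y xdb.
    have -> : Phi x - Phi y = (H x - H y) + ((chi x - chi y) *: E y + chi x *: (E x - E y)).
      rewrite /Phi scalerBl scalerBr opprD addrACA; congr (_ + _).
      by rewrite [RHS]addrC addrA subrK.
    apply: le_lt_trans (ler_normD _ _) _.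
    have h4 : `|(chi x - chi y) *: E y| <= `|H x - H y|.
      rewrite normrZ; apply: le_trans (_ : `|H x - H y| / (r2 - r1) * (r2 - r1) <= _).
        by apply: ler_pM => //; exact: le_trans (Ee _ C0y) _.
      by rewrite divfK// gt_eqF.
    have h5 : `|chi x *: (E x - E y)| <= `|E x - E y|.
      rewrite normrZ ler_piMl//; have /andP[c0 c1] := clamp_itv ((r2 - `|H x - z0|) / (r2 - r1)).
      by rewrite ger0_norm.
    have h6 := ler_normD ((chi x - chi y) *: E y) (chi x *: (E x - E y)).
    by lra.
  have e4 : 0 < Num.min e (r3 - r2) by rewrite lt_min e0 subr_gt0.
  have [da da0 daP] := within_continuous_dist cH clx e4.
  exists da => // y cly xy; have := daP y cly xy; rewrite lt_min => /andP[h1 h2].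
  have yr2 : r2 <= `|H y - z0|.
    have : `|H x - z0| <= `|H x - H y| + `|H y - z0|.
      by rewrite (le_trans _ (ler_normD _ _))// addrA subrK.
    by lra.
  by rewrite /Phi !chi0 ?scale0r ?addr0// (le_trans _ xr3)// ltW.
have Phid x : boundary U x -> Phi x = x.
  move=> bx; rewrite /Phi Hid// chi0 ?scale0r ?addr0// Hid// ltW//.
  exact: lt_trans r23 (Ud _ bx).
move=> z Uz zz0; have [x Ux xz] := covering_of_identity_on_boundary oU bU cPhi Phid Uz.
have clx : closure U x by exact: subset_closure.
have xr1 : `|H x - z0| <= r1.
  have [xr3|xr3] := leP `|H x - z0| r3; last first.
    by move: xz; rewrite /Phi chi0 ?scale0r ?addr0 => [xz|]; [rewrite xz in xr3; lra|lra].
  have : `|H x - z0| <= `|z - z0| + `|chi x *: E x|.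
    rewrite -xz /Phi -[X in `|X| <= _](addrK (chi x *: E x)) (addrAC (H x)) .
    exact: ler_normB.
  have : `|chi x *: E x| <= eta.
    rewrite normrZ; have /andP[c0 c1] := clamp_itv ((r2 - `|H x - z0|) / (r2 - r1)).
    rewrite ger0_norm//; apply: le_trans (ler_piMl _ c1) _ => //.
    by apply: Ee; split.
  by lra.
by exists x; split => //; rewrite -xz /Phi chi1// scale1r.
Qed.
End covering_perturbation.

Section lusin_degree.
Context {R : realType} {n' : nat}.
Local Notation n := n'.+1.
Local Notation V := 'rV[R]_n.
Local Notation mu := (@lebesgue_measure_rV R n).
Variables (J : {set 'I_n}) (U : set V) (f : V -> V) (Df : V -> 'M[R]_n) (p : R) (H0 : V -> R).
Hypotheses (oU : open U) (muU : (mu U < +oo)%E) (wf : weak_gradient U f Df) (p1 : 1 <= p)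
  (Jp : (#|~: J|)%:R <= p) (H00 : forall x, 0 <= H0 x)
  (DH : forall i j x, `|Df x i j| `^ p <= H0 x) (iH : mu.-integrable U (EFin \o H0)).

Let mU : measurable U := open_measurable_rV oU.
Local Notation r l := ((2 ^+ l)^-1 : R).

Definition partial_avg (l : nat) (x : V) : V :=
  \row_i (if i \in J then x ord0 i else avg (r l) (fun x => f x ord0 i) x).

(** The averages at the points of a cell read [f] up to one more side length in every direction,
    that is, on the doubled cell [bg]. *)
Let lo l z : V := dy_lo (ulev l) z.
Let hi2 l z : V := dy_hi (ulev l) z + const_mx (r l).
Let bg l z := rV_box (lo l z) (hi2 l z).

Let r_gt0 l : 0 < r l. Proof. by rewrite invr_gt0 exprn_gt0. Qed.

Let hi2E l z i : hi2 l z ord0 i = lo l z ord0 i + 2 * r l.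
Proof. by rewrite /hi2 mxE dy_lo_hi [const_mx _ _ _]mxE -addrA -mulr2n mulr_natl. Qed.

Let lohi l z i : lo l z ord0 i <= hi2 l z ord0 i.
Proof. by rewrite hi2E lerDl mulr_ge0// ltW. Qed.

Let fine_mu_cell l z : fine (mu (cell (lo l z) (hi2 l z))) = (2 * r l) ^+ n.
Proof.
rewrite measure_cell// (eq_bigr (fun=> 2 * r l)) ?prodr_const ?card_ord// => i _.
by rewrite hi2E addrAC subrr add0r.
Qed.

(** An averaged component varies over a cell by at most [r l * T], with [T] of order
    [(1 + M) ^ (1 / p)]; raising [T] to the number of averaged components costs at most [1 + M]. A
    single scale is involved, so equality with [p] is allowed. *)
Lemma covered_partial_avg_cell : exists2 C : R, 0 <= C & forall l z, bg l z `<=` U ->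
  covered (partial_avg l @` dcell (ulev l) z)
    (\int[mu]_(x in cell (lo l z) (hi2 l z)) (C * (1 + H0 x))%:E).
Proof.
have p0 : 0 < p by exact: lt_le_trans p1.
(* [2 ^ n] is the volume of the doubled cell divided by that of the cell; [n * n] generously bounds
   the number of directions. *)
pose c : R := (n * n)%:R * (2 ^+ n + 1).
have c0 : 0 <= c by rewrite mulr_ge0// addr_ge0// exprn_ge0.
pose C := (2 * c) ^+ #|~: J|.
have C0 : 0 <= C by rewrite exprn_ge0// mulr_ge0.
exists C => // l z zU; set D := cell (lo l z) (hi2 l z).
have mB : measurable (bg l z) by exact: measurable_rV_box.
have mD : measurable D by exact: measurable_cell.
have DB : D `<=` bg l z by exact: cell_sub_box.
have DU : D `<=` U := subset_trans DB zU.
have muD : (mu D < +oo)%E.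
  apply: le_lt_trans (rV_box_lty (fun i => lohi l z i)).
  by apply: le_measure; rewrite ?inE; [exact: measurable_cell|exact: measurable_rV_box|exact: cell_sub_box].
have iHD := integrableS mU mD DU iH.
have rn0 : 0 < (r l) ^+ n by rewrite exprn_gt0.
pose M := ((r l) ^+ n)^-1 * (\int[mu]_(x in D) H0 x)%R.
have M0 : 0 <= M.
  rewrite mulr_ge0 ?invr_ge0 ?(ltW rn0)//; apply: fine_ge0.
  by apply: integral_ge0 => x _; rewrite lee_fin.
have M1 : 0 < 1 + M by rewrite ltr_wpDr.
pose t := (1 + M) `^ p^-1.
have t1 : 1 <= t by rewrite -(powRr0 (1 + M)); apply: ler_powR; rewrite ?lerDl// invr_ge0 ltW.
have t0 : 0 < t by exact: lt_le_trans t1.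
have tp : t `^ p = 1 + M by rewrite /t -powRrM mulVf ?gt_eqF// powRr1// ltW.
pose I i j := ((r l) ^+ n)^-1 * (\int[mu]_(x in bg l z) `|Df x i j|)%R.
have lD i j : locally_integrable_on U (fun x => Df x i j) by case: (wf i j).
have I_le i j : I i j <= (2 ^+ n + 1) * t.
  have iB : mu.-integrable (bg l z) (EFin \o (fun x => Df x i j)).
    exact: compact_integrable mU (lD i j) (@compact_rV_box R n _ _) mB zU.
  rewrite /I (@Rintegral_eq_box R n (lo l z) (hi2 l z) D)//; last 2 first.
  - exact: open_box_sub_cell.
  - by have := integrable_norm iB.
  have iDD := integrable_norm (integrableS mB mD DB iB).
  have it := integrable_cst_fin t mD muD.
  have iZ : mu.-integrable D (EFin \o (fun x => t `^ (1 - p) * H0 x)) := integrableZl mD _ iHD.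
  apply: le_trans (_ : ((r l) ^+ n)^-1 * (\int[mu]_(x in D) (t + t `^ (1 - p) * H0 x))%R <= _).
    rewrite ler_pM2l ?invr_gt0//; apply: le_Rintegral => //.
      by have := integrableD mD it iZ; apply: eq_integrable.
    move=> x _; apply: le_trans (le_add_powR p1 t0 (normr_ge0 _)) _.
    by rewrite lerD2l ler_wpM2l ?powR_ge0.
  rewrite RintegralD// RintegralZl// mulrDr mulrCA -/M mulrDl mul1r; apply: lerD.
    rewrite [X in _ * X](_ : _ = t * fine (mu D)); last by rewrite -Rintegral_cst.
    rewrite fine_mu_cell exprMn mulrCA [_^-1 * _]mulrCA mulVf ?gt_eqF// mulr1 mulrC.
    exact: lexx.
  apply: le_trans (_ : t `^ (1 - p) * t `^ p <= _).
    by rewrite ler_wpM2l ?powR_ge0// tp lerDr.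
  by rewrite -powRD ?subrK ?powRr1 ?(ltW t0)// oner_eq0.
pose T := c * t.
have T0 : 0 <= T by rewrite mulr_ge0// ltW.
have osc x y i : dcell (ulev l) z x -> dcell (ulev l) z y ->
    `|avg (r l) (fun x => f x ord0 i) x - avg (r l) (fun x => f x ord0 i) y| <= r l * T.
  move=> zx zy.
  have xl (w : V) : dcell (ulev l) z w -> forall i, lo l z ord0 i <= w ord0 i.
    by move=> zw i'; have /andP[/ltW] := zw i'.
  have xh (w : V) : dcell (ulev l) z w -> forall i, w ord0 i + r l <= hi2 l z ord0 i.
    move=> zw i'; have /andP[_ h] := zw i'; rewrite /hi2 [X in _ <= X]mxE [const_mx _ _ _]mxE.
    by rewrite lerD2r.
  apply: le_trans (avg_osc mU (wf i) (r_gt0 l) zU (xl _ zx) (xl _ zy) (xh _ zx) (xh _ zy)) _.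
  apply: le_trans (_ : \sum_(j < n) r l * ((2 ^+ n + 1) * t) <= _).
    apply: ler_sum => j _; apply: ler_pM => //; last exact: I_le.
      rewrite mulr_ge0 ?invr_ge0 ?(ltW rn0)//; apply: fine_ge0.
      by apply: integral_ge0 => w _; rewrite lee_fin.
    exact: dcell_dist (dcell_sub_dbox zx) (dcell_sub_dbox zy).
  rewrite sumr_const card_ord -mulrnAr ler_pM2l// /T /c -[_ *+ n]mulr_natl -!mulrA.
  rewrite ler_wpM2r ?mulr_ge0 ?addr_ge0 ?exprn_ge0 ?(ltW t0)// ler_nat.
  by rewrite leq_pmull.
pose y0 : V := dy_hi (ulev l) z.
have zy0 : dcell (ulev l) z y0 by exact: dy_hi_cell.
pose cen i := avg (r l) (fun x => f x ord0 i) y0.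
pose a : V := \row_i (if i \in J then lo l z ord0 i else cen i - r l * T).
pose b : V := \row_i (if i \in J then lo l z ord0 i + r l else cen i + r l * T).
have ab i : a ord0 i <= b ord0 i.
  rewrite [a _ _]mxE [b _ _]mxE; case: ifP => _; first by rewrite lerDl ltW.
  by rewrite lerD2l ge0_cp// mulr_ge0// ltW.
exists (rV_box a b); split; first exact: measurable_rV_box.
  move=> _ [x zx <-] i; rewrite in_itv/= [a _ _]mxE [b _ _]mxE [partial_avg _ _ _ _]mxE.
  case: ifPn => iJ; first by have /andP[/ltW -> ] := zx i; rewrite dy_lo_hi.
  have := osc x y0 i zx zy0; rewrite -/(cen i) ler_norml => /andP[? ?].
  by apply/andP; split; lra.
have -> : (\int[mu]_(x in D) (C * (1 + H0 x))%:E)%E = (C * ((2 * r l) ^+ n + (r l) ^+ n * M))%:E.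
  have i1 := integrable_cst_fin 1 mD muD.
  have i2 : mu.-integrable D (EFin \o (fun x => 1 + H0 x)).
    by have := integrableD mD i1 iHD; apply: eq_integrable.
  have i3 : mu.-integrable D (EFin \o (fun x => C * (1 + H0 x))) := integrableZl mD C i2.
  rewrite -(fineK (integrable_fin_num mD i3)); congr EFin.
  rewrite -[LHS]/(\int[mu]_(x in D) (C * (1 + H0 x)))%R.
  rewrite RintegralZl//; congr (C * _); rewrite RintegralD//.
  rewrite /M mulrA mulfV ?gt_eqF// mul1r; congr (_ + _).
  by rewrite -(fine_mu_cell l z) -[RHS]mul1r -Rintegral_cst.
rewrite (lebesgue_measure_rV_box ab) lee_fin.
have -> : \prod_i (b ord0 i - a ord0 i) = (r l) ^+ n * (2 * T) ^+ #|~: J|.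
  have -> : (r l) ^+ n = \prod_(i < n) r l by rewrite prodr_const card_ord.
  rewrite -prodr_const [X in _ = _ * X]big_mkcond/= -big_split/=.
  apply: eq_bigr => i _; rewrite [a _ _]mxE [b _ _]mxE inE.
  by have [iJ|iJ] := boolP (i \in J); rewrite /=; ring.
have -> : (2 * T) ^+ #|~: J| = C * t ^+ #|~: J| by rewrite /T mulrA exprMn.
rewrite mulrCA ler_wpM2l//.
apply: le_trans (_ : (r l) ^+ n * (1 + M) <= _).
  rewrite ler_pM2l// -tp -powR_mulrn ?(ltW t0)//.
  exact: ler_powR.
rewrite mulrDr mulr1 lerD2r exprMn ler_peMl ?(ltW rn0)//.
by rewrite exprn_ege1// ler1n.
Qed.

(** Doubled cells overlap, but those whose indices have the same parities are disjoint; the constant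
    counts the parity classes. *)
Lemma covered_partial_avg : exists2 C : R, 0 <= C & forall l (W : set V),
  open W -> W `<=` U ->
  covered (partial_avg l @` [set x | bg l (dy_index (ulev l) x) `<=` W])
    (C * (\int[mu]_(x in W) (1 + H0 x))%R)%:E.
Proof.
have [C C0 CP] := covered_partial_avg_cell.
exists (#|{ffun 'I_n -> bool}|%:R * C); first by rewrite mulr_ge0.
move=> l W oW WU; have mW := open_measurable_rV oW.
pose h x := C * (1 + H0 x).
have h0 x : 0 <= h x by rewrite mulr_ge0// addr_ge0.
have muW : mu.-integrable W (EFin \o (fun x => 1 + H0 x)).
  have := integrableD mU (integrable_cst_fin 1 mU muU) iH.
  move=> /(integrableS mU mW WU); exact: eq_integrable.
have ih : mu.-integrable W (EFin \o h) := integrableZl mW C muW.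
have mh : measurable_fun W h by apply/measurable_EFinP; exact: measurable_int ih.
have cov (c : {ffun 'I_n -> bool}) : covered [set x | exists2 z,
     bg l z `<=` W /\ forall i, ((z i %% 2)%Z == 0) = c i &
     (partial_avg l @` dcell (ulev l) z) x] (C * (\int[mu]_(x in W) (1 + H0 x))%R)%:E.
  have -> : (C * (\int[mu]_(x in W) (1 + H0 x))%R)%:E = (\int[mu]_(x in W) (h x)%:E)%E.
    by rewrite -RintegralZl// /Rintegral fineK//; exact: integrable_fin_num ih.
  apply: (covered_bigcup (D := fun z => cell (lo l z) (hi2 l z))) => //.
  - move=> z [zW _]; split; first exact: measurable_cell.
      exact: subset_trans (@cell_sub_box _ _ _ _) zW.
    by apply: CP; exact: subset_trans zW WU.
  - move=> z z' x [_ cz] [_ cz'] zx zx'; apply/ffunP => i.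
    have := cz' i; rewrite -(cz i).
    have : (z i < z' i + 2)%R /\ (z' i < z i + 2)%R.
      have pl : (0 : R) < 2 ^+ l by rewrite exprn_gt0.
      have key (w w' : {ffun 'I_n -> int}) : cell (lo l w) (hi2 l w) x ->
          cell (lo l w') (hi2 l w') x -> (w i < w' i + 2)%R.
        move=> wx wx'; have /andP[h1 _] := wx i; have /andP[_ h2] := wx' i.
        have := lt_le_trans h1 h2; rewrite hi2E /lo !mxE.
        rewrite -[2 * _]/(2 / _) -mulrDl ltr_pM2r ?invr_gt0//.
        by rewrite -[X in _ + X]/(2%:~R) -intrD ltr_int.
      by split; exact: key.
    have := divz_eq (z i) 2; have := divz_eq (z' i) 2.
    have := modz_ge0 (z i) (isT : 2 != 0 :> int); have := modz_ge0 (z' i) (isT : 2 != 0 :> int).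
    have := ltz_pmod (z i) (isT : 0 < 2 :> int); have := ltz_pmod (z' i) (isT : 0 < 2 :> int).
    move: (z i %/ 2)%Z (z' i %/ 2)%Z (z i %% 2)%Z (z' i %% 2)%Z => k k' m m'.
    move: (z i) (z' i) => zi zi'; lia.
apply: (covered_le (covered_finite cov)); last by rewrite mulrA.
move=> _ [x xW <-]; exists [ffun i => (dy_index (ulev l) x i %% 2)%Z == 0] => //.
exists (dy_index (ulev l) x); first by split => // i; rewrite [RHS]ffunE.
by exists x => //; exact: dcell_dy_index.
Qed.

Theorem image_full_not_negligible (F : V -> V) (N : set V) : bounded_set U -> U !=set0 ->
  {within closure U, continuous F} -> (forall x, U x -> F x = f x) ->
  (forall x, boundary U x -> F x = x) -> mu.-negligible N ->
  ~ mu.-negligible ((fun x => \row_i (if i \in J then x ord0 i else F x ord0 i) : V) @` (U `\` N)).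
Proof.
move=> bU [z0 Uz0] cF Ff Fid nN; set H := fun x : V => \row_i _ : V => nH.
have [d d0 dU] := (openP_dist U).1 oU z0 Uz0.
have cH : {within closure U, continuous H}.
  apply: continuous_withinP => x e clx e0.
  have [b b0 bP] := within_continuous_dist cF clx e0.
  exists (Num.min b e); first by rewrite lt_min b0.
  move=> y cly; rewrite lt_min => /andP[xb xe]; apply: rV_norm_lt => // i; rewrite !mxE.
  case: ifP => _; first by apply: le_lt_trans xe; have := rV_coord_le (x - y) i; rewrite !mxE.
  by apply: le_lt_trans (bP y cly xb); have := rV_coord_le (F x - F y) i; rewrite !mxE.
have Hid x : boundary U x -> H x = x.
  by move=> bx; apply/rowP => i; rewrite mxE Fid//; case: ifP.
have nUd x : ~ U x -> d <= `|x - z0|.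
  by move=> nUx; rewrite leNgt; apply/negP => xd; apply: nUx; apply: dU; rewrite distrC.
(* Radii in quarters of [d]: the cut-off acts between [rho 1] and [rho 2], the perturbation is
   controlled up to [rho 3], the boundary is beyond. With errors up to [rho (1 / 2)], a cube of that
   radius is covered. *)
pose rho (k : R) := d * (k / 4).
have Ud x : boundary U x -> rho 3 < `|x - z0|.
  move=> /(boundary_open oU)[_ /nUd]; apply: lt_le_trans.
  by rewrite /rho gtr_pMr//; lra.
(* As [H] is the identity on the boundary, which is farther than [rho 3] from [z0], this is a
   compact subset of [U], and averages at small scales are taken inside [U]. *)
pose C0 := [set x | closure U x /\ `|H x - z0| <= rho 3].
have C0U : C0 `<=` U.
  move=> x [clx xr]; apply: contrapT => nUx.
  have bx : boundary U x by split => //; rewrite (interior_id U).1.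
  by have := Ud x bx; rewrite -{1}(Hid x bx) ltNge xr.
have [M M0 UM] := bounded_setP_norm bU.
have cl_le x : closure U x -> `|x| <= M.
  move=> /closureP_dist clx; apply/ler_addgt0Pr => e e0.
  have [y Uy xy] := clx _ e0.
  by rewrite -(subrK y x) addrC (le_trans (ler_normD _ _))// lerD// ltW// UM.
have ccl : compact (closure U).
  apply: subclosed_compact (@compact_ballP R n M) _; first exact: closed_closure.
  by move=> x; exact: cl_le.
have cC0 : compact C0.
  apply: subclosed_compact ccl _; last by move=> x [].
  move=> x /closureP_dist clx.
  have clUx : closure U x.
    apply: closed_closure; apply/closureP_dist => e e0.
    by have [y [cly _] xy] := clx _ e0; exists y.
  split => //; apply/ler_addgt0Pr => e e0.
  have [b b0 bP] := within_continuous_dist cH clUx e0.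
  have [y [cly yr] xy] := clx _ b0.
  rewrite -(subrK (H y) (H x)) -addrA addrC (le_trans (ler_normD _ _))// lerD//.
  exact/ltW/bP.
have [d1 d10 d1P] : exists2 d1, 0 < d1 & forall x y, C0 x -> `|x - y| < d1 -> U y.
  apply: contrapT => no.
  have /choice[v vP] (k : nat) : exists v : V * V, [/\ C0 v.1, `|v.1 - v.2| < k.+1%:R^-1 & ~ U v.2].
    apply: contrapT => nv; apply: no; exists k.+1%:R^-1 => // x y C0x xy.
    by apply: contrapT => nUy; apply: nv; exists (x, y).
  have [x C0x xv] := compact_seq_cluster cC0 (fun k => (let: And3 h _ _ := vP k in h) : C0 (v k).1).
  have [e e0 eU] := (openP_dist U).1 oU x (C0U _ C0x).
  have e2 : 0 < e / 2 by rewrite divr_gt0.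
  have [N0 N0P] : exists N0, forall k, (N0 <= k)%N -> (k.+1%:R^-1 : R) < e / 2.
    exists (Num.truncn (e / 2)^-1) => k Nk; rewrite -[ltRHS]invrK ltf_pV2 ?posrE ?invr_gt0//.
    by apply: lt_le_trans (truncnS_gt _) _; rewrite ler_nat.
  have [k Nk xk] := xv _ N0 e2; have [_ h nU] := vP k; apply: nU; apply: eU.
  rewrite -(subrK (v k).1 x) -addrA; apply: le_lt_trans (ler_normD _ _) _.
  by rewrite (splitr e) ltrD// (lt_trans h)// N0P.
pose E l (x : V) : V := \row_i (if i \in J then 0 else avg (r l) (fun x => f x ord0 i) x - F x ord0 i).
have HE l x : H x + E l x = partial_avg l x.
  apply/rowP => i; rewrite [LHS]mxE [H x _ _]mxE [E l x _ _]mxE [RHS]mxE.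
  by case: ifP => _; rewrite ?addr0// addrC subrK.
have box_sub l (x lo1 hi1 : V) : C0 x -> 2 * r l < d1 ->
    (forall i, x ord0 i - r l <= lo1 ord0 i) -> (forall i, hi1 ord0 i <= x ord0 i + 2 * r l) ->
    rV_box lo1 hi1 `<=` U.
  move=> C0x ld h1 h2 y xy; apply: (d1P x) => //; apply: rV_norm_lt => // i.
  have := xy i; rewrite in_itv/= !mxE => /andP[h3 h4]; have := h1 i; have := h2 i => h5 h6.
  by have := r_gt0 l; rewrite ltr_norml => ?; apply/andP; split; lra.
have cE l : 2 * r l < d1 -> {within C0, continuous (E l)}.
  move=> ld; apply: continuous_withinP => x e C0x e0.
  pose lo1 := x - const_mx (r l); pose hi1 := x + const_mx (2 * r l).
  have BU : rV_box lo1 hi1 `<=` U by apply: (box_sub l x) => // i; rewrite !mxE.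
  pose S := 1 + \sum_i \sum_j ((r l) ^+ n)^-1 * (\int[mu]_(z in rV_box lo1 hi1) `|Df z i j|)%R.
  have I0 i j : 0 <= ((r l) ^+ n)^-1 * (\int[mu]_(z in rV_box lo1 hi1) `|Df z i j|)%R.
    rewrite mulr_ge0 ?invr_ge0 ?exprn_ge0 ?(ltW (r_gt0 l))//; apply: fine_ge0.
    by apply: integral_ge0 => z _; rewrite lee_fin.
  have S0 : 0 < S by rewrite ltr_wpDr// sumr_ge0// => i _; rewrite sumr_ge0.
  have e2 : 0 < e / 2 by rewrite divr_gt0.
  have [b b0 bP] := within_continuous_dist cF (let: conj h _ := C0x in h) e2.
  have eS : 0 < e / 2 / S by rewrite divr_gt0.
  exists (Num.min b (Num.min (r l) (e / 2 / S))); first by rewrite !lt_min b0 r_gt0.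
  move=> y C0y; rewrite !lt_min => /and3P[xb xr xe]; apply: rV_norm_lt => // i.
  rewrite !mxE; case: ifP => _; first by rewrite subr0 normr0.
  have xyi k : `|x ord0 k - y ord0 k| <= `|x - y|.
    by have := rV_coord_le (x - y) k; rewrite !mxE.
  have xyr k : - r l <= x ord0 k - y ord0 k <= r l by rewrite -ler_norml (le_trans (xyi k))// ltW.
  have h1 : `|avg (r l) (fun x => f x ord0 i) x - avg (r l) (fun x => f x ord0 i) y| < e / 2.
    have := @avg_osc R n U (fun x => f x ord0 i) (fun j x => Df x i j) (r l) x y lo1 hi1 mU (wf i) (r_gt0 l) BU.
    have hr := r_gt0 l.
    move=> h; apply: le_lt_trans (h _ _ _ _) _.
    - by move=> k; rewrite !mxE; lra.
    - by move=> k; rewrite !mxE; have /andP[? ?] := xyr k; lra.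
    - by move=> k; rewrite !mxE; lra.
    - by move=> k; rewrite !mxE; have /andP[? ?] := xyr k; lra.
    apply: le_lt_trans (_ : `|x - y| * S < _); last by rewrite -ltr_pdivlMr.
    apply: le_trans (_ : \sum_j `|x - y| *
      (((r l) ^+ n)^-1 * (\int[mu]_(z in rV_box lo1 hi1) `|Df z i j|)%R) <= _).
      by apply: ler_sum => j _; rewrite ler_wpM2r.
    rewrite -mulr_sumr ler_wpM2l//; apply: le_trans (_ : S - 1 <= _); last by rewrite gerBl.
    rewrite /S addrAC subrr add0r [leRHS](bigD1 i)//= lerDl sumr_ge0// => i' _.
    exact: sumr_ge0.
  have h2 : `|F x ord0 i - F y ord0 i| < e / 2.
    have [cly _] := C0y; apply: le_lt_trans (bP y cly xb).
    by have := rV_coord_le (F x - F y) i; rewrite !mxE.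
  move: h1 h2; set a1 := avg _ _ x; set a2 := avg _ _ y => h1 h2.
  have -> : a1 - F x ord0 i - (a2 - F y ord0 i) = (a1 - a2) - (F x ord0 i - F y ord0 i) by ring.
  by apply: le_lt_trans (ler_normB _ _) _; rewrite (splitr e) ltrD.
have E_small e : 0 < e -> exists l0, forall l, (l0 <= l)%N -> 2 * r l < d1 /\ forall x, C0 x -> `|E l x| <= e.
  move=> e0; have [b b0 bP] := compact_uniform_dist ccl cF e0.
  have m0 : 0 < Num.min b (d1 / 2) by rewrite lt_min b0 divr_gt0.
  have [l0 l0P] := pow2_small m0; exists l0 => l l0l.
  have := l0P l l0l; rewrite lt_min => /andP[lb ld].
  have ld1 : 2 * r l < d1 by rewrite mulrC -ltr_pdivlMr.
  split => // x C0x; apply: rV_norm_le => [|i]; first exact: ltW.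
  rewrite mxE; case: ifP => _; first by rewrite normr0 ltW.
  have sub : open_box x (x + const_mx (r l)) `<=` rV_box x (x + const_mx (r l)).
    by move=> y /open_box_sub_cell; exact: cell_sub_box.
  have BU : rV_box x (x + const_mx (r l)) `<=` U.
    have hr := r_gt0 l; apply: (box_sub l x) => // k; rewrite ?mxE; lra.
  have mO : measurable (open_box x (x + const_mx (r l))) by exact: measurable_open_box.
  have muO := measure_avg_box x (r_gt0 l).
  apply: (mean_dist mO).
  - by rewrite muO ltry.
  - by rewrite muO exprn_gt0.
  - apply: (integrableS (measurable_rV_box _ _) mO sub).
    have [lf _ _] := wf i ord0.
    exact: compact_integrable mU lf (@compact_rV_box R n _ _) (measurable_rV_box _ _) BU.
  - move=> y yO; have Uy := BU _ (sub _ yO); rewrite -(Ff y Uy) distrC.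
    apply: le_trans (_ : `|F x - F y| <= _).
      by have := rV_coord_le (F x - F y) i; rewrite !mxE.
    apply/ltW/bP; [by case: C0x|exact: subset_closure|].
    apply: rV_norm_lt => // k; rewrite !mxE; apply: le_lt_trans lb.
    have := yO k; rewrite !mxE => /andP[h3 h4]; rewrite distrC ger0_norm; lra.
have [C C_ge0 CP] := covered_partial_avg.
have d8 : 0 < rho (1 / 2) by rewrite /rho mulr_gt0//; lra.
have r12 : rho 1 < rho 2 by rewrite /rho ltr_pM2l//; lra.
have r23 : rho 2 < rho 3 by rewrite /rho ltr_pM2l//; lra.
have [l1 l1P] := E_small _ d8.
pose Z := rV_box (z0 - const_mx (rho (1 / 2))) (z0 + const_mx (rho (1 / 2))).
have Zz z : Z z -> `|z - z0| <= rho (1 / 2).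
  move=> Zz; apply: rV_norm_le => [|i]; first exact: ltW.
  have := Zz i; rewrite in_itv/= !mxE ler_norml => /andP[h1 h2].
  by apply/andP; split; lra.
have solve z l : Z z -> (l1 <= l)%N -> exists x, C0 x /\ z = partial_avg l x.
  move=> /Zz zz0 /l1P[ld El].
  have Uz : U z.
    apply: dU; rewrite distrC; apply: le_lt_trans zz0 _; rewrite /rho gtr_pMr//; lra.
  have [||x [Ux xr xz]] := covering_perturbation oU bU cH Hid Ud r12 r23 (cE l ld) El (ltW d8) _ Uz.
  - by rewrite /rho -mulrBr ler_pM2l//; lra.
  - by apply: le_trans zz0 _; rewrite /rho -mulrBr ler_pM2l//; lra.
  exists x; split; last by rewrite -HE.
  split; first exact: subset_closure.
  by apply: le_trans xr _; rewrite /rho ler_pM2l//; lra.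
have i1H : mu.-integrable U (EFin \o (fun x => 1 + H0 x)).
  have := integrableD mU (integrable_cst_fin 1 mU muU) iH; exact: eq_integrable.
have nNU : mu.-negligible (N `&` U) by apply: negligibleS nN => x [].
(* A cube of positive measure is shown to be null. The points hit from doubled cells inside [W] at
   all large scales form a small set; for any other point, infinitely many scales have a solution
   whose doubled cell leaves [W]. *)
have nZ : mu.-negligible Z.
  apply: covered_negligible => e e0.
  have C1 : 0 < 1 + C by rewrite ltr_wpDr.
  have [W [oW NW WU We]] := negligible_open_superset oU muU i1H nNU (@subIsetr _ _ _)
    (divr_gt0 e0 C1).
  have cov l : covered (partial_avg l @` [set x | bg l (dy_index (ulev l) x) `<=` W]) e%:E.
    apply: covered_le (CP l W oW WU) (@subset_refl _ _) _; rewrite lee_fin.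
    have iW := integrableS mU (open_measurable_rV oW) WU i1H.
    have : (\int[mu]_(x in W) (1 + H0 x))%R < e / (1 + C).
      rewrite -lte_fin /Rintegral fineK; last exact: (integrable_fin_num (open_measurable_rV oW) iW).
      apply: le_lt_trans We; rewrite le_eqVlt; apply/orP; left; apply/eqP.
      by apply: eq_integral => x _; rewrite ger0_norm ?addr_ge0.
    move=> /ltW h; apply: le_trans (ler_wpM2l C_ge0 h) _.
    by rewrite mulrCA ler_piMr ?(ltW e0)// ler_pdivrMr// mul1r lerDr.
  have [B [mB nB0 HB]] := nH.
  have cB : covered B 0 by exists B; split => //; rewrite nB0.
  rewrite -[e%:E]adde0; apply: covered_le (covered_setU (covered_liminf cov) cB) _ (lexx _).
  move=> z Zz'; apply: contrapT => /not_orP[nlim nB]; apply: nB; apply: HB.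
  have /choice[k kP] m : exists k, (maxn m l1 <= k)%N /\
      ~ (partial_avg k @` [set x | bg k (dy_index (ulev k) x) `<=` W]) z.
    apply: contrapT => no; apply: nlim; exists (maxn m l1) => k mk.
    by apply: contrapT => nk; apply: no; exists k.
  have /choice[x xP] m : exists x, C0 x /\ z = partial_avg (k m) x.
    by apply: solve => //; have [h _] := kP m; exact: leq_trans (leq_maxr _ _) h.
  have [x' C0x' xx'] := compact_seq_cluster cC0 (fun m => (xP m).1).
  have km m : (m <= k m)%N by have [h _] := kP m; exact: leq_trans (leq_maxl _ _) h.
  have [clx' _] := C0x'.
  (* The solutions accumulate at [x'], where [H x' = z] because the averaging error tends to 0
     uniformly. If [x'] were in [N], the late doubled cells near it would be contained in [W]. *)
  exists x'; last first.
    apply/eqP; rewrite -subr_eq0 -normr_le0; apply/ler_addgt0Pr => e' e'0; rewrite add0r.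
    have e'2 : 0 < e' / 2 by rewrite divr_gt0.
    have [b b0 bP] := within_continuous_dist cH clx' e'2.
    have [l2 l2P] := E_small _ e'2.
    have [m lm xm] := xx' _ l2 b0.
    have [C0m zm] := xP m; have [clm _] := C0m.
    have [_ /(_ _ C0m) Em] := l2P (k m) (leq_trans lm (km m)).
    rewrite zm -HE opprD addrA; apply: le_trans (ler_normB _ _) _.
    by rewrite (splitr e') lerD// ltW// bP.
  split; first exact: C0U.
  move=> Nx'; have Wx' : W x' by apply: NW; split => //; exact: C0U.
  have [b b0 bW] := (openP_dist W).1 oW _ Wx'.
  have b4 : 0 < b / 4 by rewrite divr_gt0.
  have [l2 l2P] := pow2_small b4.
  have [m lm xm] := xx' _ l2 b4.
  have [C0m zm] := xP m; have [_] := kP m; apply; exists (x m) => //= y yb.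
  apply: bW; have rk := l2P (k m) (leq_trans lm (km m)).
  apply: rV_norm_lt => // i; rewrite !mxE.
  have h1 : `|x' ord0 i - x m ord0 i| < b / 4.
    by apply: le_lt_trans xm; have := rV_coord_le (x' - x m) i; rewrite !mxE.
  have := yb i; rewrite in_itv/= hi2E => /andP[h2 h3].
  have := dcell_dy_index (ulev (k m)) (x m) i; rewrite dy_lo_hi => /andP[h4 h5].
  move: h1; rewrite !ltr_norml => /andP[? ?]; move: h2 h3 h4 h5 rk.
  rewrite /lo /ulev; set D := dy_lo _ _ _ _; set rr := (2 ^+ k m)^-1 => *.
  by apply/andP; split; lra.
have [A [mA A0 ZA]] := nZ.
have mZ : measurable Z by exact: measurable_rV_box.
have : mu Z = 0.
  by apply/eqP; rewrite eq_le measure_ge0 andbT -A0; apply: le_measure; rewrite ?inE.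
rewrite lebesgue_measure_rV_box; last by move=> i; rewrite !mxE; lra.
move=> [] /eqP; apply/negP; rewrite gt_eqF// prodr_gt0// => i _; rewrite !mxE; lra.
Qed.
End lusin_degree.

(** * Integrable majorants and the conclusion *)

Section sobolev_data.
Context {R : realType}.

Lemma Lp_integrable_powR n (U : set 'rV[R]_n) (q : R) (w : 'rV[R]_n -> R) : measurable U ->
  Lp_on U q w -> (@lebesgue_measure_rV R n).-integrable U (EFin \o (fun x => `|w x| `^ q)).
Proof.
move=> mU [mw wq]; apply/integrableP; split.
  apply/measurable_EFinP; apply: (@measurableT_comp _ _ _ _ _ _ (fun t : R => t `^ q)).
    exact: measurable_powR.
  exact: measurableT_comp.
rewrite (eq_integral (fun x => (`|w x| `^ q)%:E))// => x _ /=.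
by rewrite ger0_norm// powR_ge0.
Qed.

Lemma sobolev_majorant n (U : set 'rV[R]_n) (q : R) (D : 'rV[R]_n -> 'M[R]_n) : measurable U ->
  (forall i j, Lp_on U q (fun x => D x i j)) ->
  exists H : 'rV[R]_n -> R, [/\ forall x, 0 <= H x, forall i j x, `|D x i j| `^ q <= H x &
    (@lebesgue_measure_rV R n).-integrable U (EFin \o H)].
Proof.
move=> mU DL; exists (fun x => \sum_(t : 'I_n * 'I_n) `|D x t.1 t.2| `^ q); split.
- by move=> x; apply: sumr_ge0 => t _; exact: powR_ge0.
- by move=> i j x; rewrite (bigD1 (i, j))//= lerDl sumr_ge0// => t _; exact: powR_ge0.
- by have [|] := @integrable_sum_Rintegral R n U _ (index_enum _)
    (fun t x => `|D x t.1 t.2| `^ q) mU => // t; exact: Lp_integrable_powR.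
Qed.

Lemma bounded_measure_lty n (U : set 'rV[R]_n) : measurable U -> bounded_set U ->
  (@lebesgue_measure_rV R n U < +oo)%E.
Proof.
move=> mU /bounded_setP_norm[M M0 UM].
have h i : (const_mx (- M) : 'rV[R]_n) ord0 i <= (const_mx M : 'rV[R]_n) ord0 i.
  by rewrite !mxE; lra.
apply: le_lt_trans (rV_box_lty h); apply: le_measure; rewrite ?inE//.
  exact: measurable_rV_box.
move=> x Ux i; rewrite in_itv/= !mxE -ler_norml; apply: le_trans (rV_coord_le _ _) _.
exact/ltW/UM.
Qed.

Lemma exists_set_card n k : (k <= n)%N -> exists K : {set 'I_n}, #|K| = k.
Proof.
move=> kn; exists [set widen_ord kn x | x : 'I_k].
rewrite card_imset ?card_ord// => x y /(congr1 val) /= xy; exact: val_inj.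
Qed.
End sobolev_data.

Theorem theorem3 (R : realType) (n : nat) (Omega : set 'rV[R]_n)
    (f g : 'rV[R]_n -> 'rV[R]_n) (Df : 'rV[R]_n -> 'M[R]_n) (p q : R)
    (Omega0 : Omega !=set0) (bOmega : bounded_set Omega) (oOmega : open Omega)
    (p1 : 1 <= p) (q1 : 1 <= q)
    (fg : bi_sobolev_homeo Omega f g)
    (fp : sobolev_W1 Omega p f) (gq : sobolev_W1 (f @` Omega) q g)
    (f_bd : identity_on_boundary Omega f)
    (fDf : weak_gradient Omega f Df)
    (Jf0 : {ae lebesgue_measure_rV n, forall x, Omega x -> \det (Df x) = 0}) :
  p + q <= n.+1%:R /\
  (p + q = n.+1%:R ->
    [/\ p \is a Num.nat, q \is a Num.nat &
      forall alpha : R, 0 < alpha < 1 ->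
        ~ bounded_hoelder Omega alpha f /\
        ~ bounded_hoelder (f @` Omega) alpha g]).
Proof.
suff pq : p + q < n.+1%:R by split; [exact: ltW|move=> e; rewrite e ltxx in pq].
rewrite ltNge; apply/negP => npq.
case: n Omega f g Df Omega0 bOmega oOmega fg fp gq f_bd fDf Jf0 npq
  => [|n'] U f g Df U0 bU oU fg fp gq f_bd fDf Jf0 npq.
  (* In dimension 0 the space is one point of mass 1 and the empty matrix has determinant 1, which
     contradicts the vanishing of the Jacobian. *)
  have [x Ux] := U0; have [B [mB B0 sB]] := Jf0.
  have Bx : B x by apply: sB => /= /(_ Ux); rewrite det_mx00 => /eqP; rewrite oner_eq0.
  move: B0; rewrite /= diracE (_ : 0 = x); last by apply/rowP; case.
  by rewrite mem_set// => -[] /eqP; rewrite oner_eq0.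
have mU := open_measurable_rV oU.
have muU := bounded_measure_lty mU bU.
have [[cf cg gf] _ _] := fg; have [F [cF Ff Fid]] := f_bd.
(* The data on [g] live on the image of [f]; identifying it with [U] makes its domain open and of
   finite measure. *)
have fU : f @` U = U by exact: (@image_of_homeo_identity_on_boundary _ _ U f g).
rewrite fU in cg gq.
(* Two gradients of [f] are at work: [Df], with vanishing determinant, for the null image, and the
   [p]-integrable [Df'] for the averages. *)
have [_ [Dg wg Lg]] := gq; have [_ [Df' wf Lf]] := fp.
have [Hg [Hg0 HgD iHg]] := sobolev_majorant mU Lg.
have [Hf [Hf0 HfD iHf]] := sobolev_majorant mU Lf.
have nD : (@lebesgue_measure_rV R n'.+1).-negligible [set x | U x /\ \det (Df x) <> 0].
  by apply: negligibleS Jf0 => x [Ux dx] /= h; apply: dx; exact: h.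
have [N nN nfN] := singular_image oU cf fDf nD.
(* Below the cap, [n'.+1 - k < n'.+2 - p <= q]; when the cap is reached, [n'.+1 - k = 0 < q]. *)
pose k := minn (Num.truncn p) n'.+1.
have [K Kk] := exists_set_card (geq_minr _ _ : (k <= n'.+1)%N).
have p0 : 0 <= p := le_trans ler01 p1.
have Kp : (#|~: ~: K|)%:R <= p.
  rewrite finset.setCK Kk; apply: le_trans (_ : (Num.truncn p)%:R <= p); last by rewrite truncn_le.
  by rewrite ler_nat geq_minl.
have Kq : (#|~: K|)%:R < q.
  have cK : (#|~: K| = n'.+1 - k)%N by rewrite cardsCs finset.setCK card_ord Kk.
  rewrite cK; have [pn|pn] := leqP n'.+1 (Num.truncn p).
    by rewrite /k (minn_idPr pn) subnn (lt_le_trans ltr01).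
  rewrite /k (minn_idPl (ltnW pn)) natrB ?(ltnW pn)//.
  have := truncnS_gt p; rewrite -natr1; move: npq; rewrite -natr1 => *; lra.
have YU : f @` (U `\` N) `<=` U by rewrite -[X in _ `<=` X]fU => _ [x [Ux _] <-]; exists x.
have nK := negligible_replace_coords oU muU cg wg q1 Kq Hg0 HgD iHg YU nfN.
apply: (image_full_not_negligible oU muU wf p1 Kp Hf0 HfD iHf bU U0 cF Ff Fid nN).
apply: negligibleS nK => _ [x [Ux nNx] <-].
(* At [f x] the replaced coordinates are those of [g (f x) = x] and the others those of [f x], which
   is the mixed map at [x]. *)
exists (f x); first by exists x.
by apply/rowP => i; rewrite !mxE gf// Ff.
Qed.
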